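(* Let $\gamma>0$ and $\zeta\in[0,2)$ be such that $\gamma+\zeta\le1$, and let $f\in\mathcal A_\zeta(\Omega)$. Then there exists a positive minimal solution $u$ of the problem $$-\Delta u+(-\Delta)^s u=\frac{f(x)}{u^\gamma},\quad u>0\ \text{ in }\Omega,\qquad u=0\ \text{ in }\mathbb{R}^N\setminus\Omega,$$ in the following sense: (i) $u\in H_0^1(\Omega)$; (ii) for every $\psi\in H_0^1(\Omega)$, $$\int_\Omega\nabla u\cdot\nabla\psi\,dx+\frac{C(N,s)}{2}\int_{\mathbb{R}^N}\int_{\mathbb{R}^N}\frac{(u(x)-u(y))(\psi(x)-\psi(y))}{|x-y|^{N+2s}}\,dx\,dy=\int_\Omega\frac{f(x)}{u^\gamma}\psi\,dx.$$
   Context: $\Omega\subset\mathbb{R}^N$, $N\ge3$, is a bounded domain with $C^{1,1}$ boundary, $\delta(x)=\operatorname{dist}(x,\partial\Omega)$, and $s\in(0,1)$ is fixed. $C(N,s)=\left(\int_{\mathbb{R}^N}\frac{1-\cos(\xi_1)}{|\xi|^{N+2s}}\,d\xi\right)^{-1}$ and $(-\Delta)^su(x)=C(N,s)\,\mathrm{P.V.}\int_{\mathbb{R}^N}\frac{u(x)-u(y)}{|x-y|^{N+2s}}\,dy$. Functions in $H_0^1(\Omega)$ are extended by zero outside $\Omega$. $\mathcal A_\zeta(\Omega)$ is the class of functions $f:\Omega\to[0,\infty)$ with $f\asymp\delta^{-\zeta}$, i.e. $c_1\delta^{-\zeta}\le f\le c_2\delta^{-\zeta}$ in $\Omega$ for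 some constants $c_1,c_2>0$. A solution $u$ is minimal if $u\le v$ a.e. in $\Omega$ for every other positive weak solution $v$ (in the same sense). *)

(* Defs.v *)
From HB Require Import structures.
From mathcomp Require Import all_boot all_order all_algebra.
From mathcomp Require Import all_classical all_reals all_analysis.
Set Implicit Arguments.
Unset Strict Implicit.
Unset Printing Implicit Defensive.
Import Order.TTheory GRing.Theory Num.Theory.
Import numFieldNormedType.Exports.
Local Open Scope classical_set_scope.
Local Open Scope ring_scope.

(** * Lebesgue measure on ['rV[R]_n]

    [prod_leb n] is the [n]-fold product of the one-dimensional Lebesgue
    measure, on the product (Borel) sigma-algebra carried by the copy
    [prodrV R n] of ['rV[R]_n]; it is built by recursion on [n].  ['rV[R]_n]
    itself carries the larger sigma-algebra of Lebesgue measurable sets, and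
    [leb] is the completion of [prod_leb]. *)

Definition prodrV (R : realType) (n : nat) : Type := 'rV[R]_n.

Fact prodrV_display : measure_display. Proof. exact. Qed.

Section prodrV_measurable.
Variables (R : realType) (n : nat).

Let coord (i : 'I_n) (v : prodrV R n) : measurableTypeR R := (v : 'rV_n) 0 i.

Let meas0 : g_sigma_preimage coord set0.
Proof. exact: sigma_algebra0. Qed.

Let measC A : g_sigma_preimage coord A -> g_sigma_preimage coord (~` A).
Proof. exact: sigma_algebraC. Qed.

Let meas_bigcup (F : (set (prodrV R n))^nat) :
  (forall i, g_sigma_preimage coord (F i)) ->
  g_sigma_preimage coord (\bigcup_i (F i)).
Proof. exact: sigma_algebra_bigcup. Qed.

HB.instance Definition _ := Pointed.copy (prodrV R n) 'rV[R]_n.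
HB.instance Definition _ := @isMeasurable.Build prodrV_display
  (prodrV R n) (g_sigma_preimage coord) meas0 measC meas_bigcup.

Lemma measurable_prodrV_coord (i : 'I_n) : measurable_fun setT (coord i).
Proof.
move=> _ Y mY; rewrite setTI; apply: sub_sigma_algebra => /=.
rewrite -bigcup_seq/=; exists i => /=; first by rewrite mem_index_enum.
by exists Y => //; rewrite setTI.
Qed.

Lemma measurable_fun_prodrV d (T : measurableType d) (f : T -> prodrV R n) :
  (forall i, measurable_fun setT (coord i \o f)) -> measurable_fun setT f.
Proof.
move=> mf.
have sub : g_sigma_preimage (fun i => coord i \o f) `<=` measurable.
  apply: smallest_sub; first exact: sigma_algebra_measurable.
  rewrite -bigcup_seq/= => A [i _] [B mB <-]; exact: mf.
by move=> _ A mA; apply: sub; rewrite g_sigma_preimage_comp; exists A.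
Qed.

End prodrV_measurable.

Section prod_leb_step.
Variables (R : realType) (n : nat).
Variable m : {sigma_finite_measure set (prodrV R n) -> \bar R}.

Definition consrV (p : measurableTypeR R * prodrV R n) : prodrV R n.+1 :=
  \row_(i < n.+1) oapp ((p.2 : 'rV[R]_n) 0) p.1 (unlift ord0 i).

Definition unconsrV (v : prodrV R n.+1) : measurableTypeR R * prodrV R n :=
  ((v : 'rV[R]_n.+1) 0 ord0, \row_i (v : 'rV[R]_n.+1) 0 (lift ord0 i)).

Lemma consrVK : cancel consrV unconsrV.
Proof.
move=> [x v]; rewrite /unconsrV /consrV /=; congr pair.
  by rewrite mxE unlift_none.
by apply/rowP => i; rewrite !mxE liftK.
Qed.

Lemma measurable_consrV : measurable_fun setT consrV.
Proof.
apply: measurable_fun_prodrV => i.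
have [j ->|->] := unliftP ord0 i.
  rewrite (_ : _ \o _ = (fun v : prodrV R n => (v : 'rV_n) 0 j) \o snd).
    by apply: measurableT_comp => //; exact: measurable_prodrV_coord.
  by apply/funext => p /=; rewrite mxE liftK.
rewrite (_ : _ \o _ = fst) //.
by apply/funext => p /=; rewrite mxE unlift_none.
Qed.

Lemma measurable_unconsrV : measurable_fun setT unconsrV.
Proof.
apply: measurable_fun_pair; first exact: measurable_prodrV_coord.
apply: measurable_fun_prodrV => i.
rewrite (_ : _ \o _ =
  fun v : prodrV R n.+1 => (v : 'rV_n.+1) 0 (lift ord0 i)).
  exact: measurable_prodrV_coord.
by apply/funext => v /=; rewrite mxE.
Qed.

Definition prod_leb_step : set (prodrV R n.+1) -> \bar R :=
  pushforward (@lebesgue_measure R \x m)%E consrV.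

Let step0 : prod_leb_step set0 = 0%E.
Proof. by rewrite /prod_leb_step /pushforward preimage_set0 measure0. Qed.

Let step_ge0 A : (0 <= prod_leb_step A)%E.
Proof. by rewrite /prod_leb_step /pushforward measure_ge0. Qed.

Let step_sigma_additive : semi_sigma_additive prod_leb_step.
Proof.
move=> F mF tF mUF; rewrite /prod_leb_step /pushforward preimage_bigcup.
apply: measure_semi_sigma_additive.
- by move=> k; rewrite -[X in measurable X]setTI; exact: measurable_consrV.
- apply/trivIsetP => /= i j _ _ ij; rewrite -preimage_setI.
  by move/trivIsetP : tF => /(_ _ _ _ _ ij) ->//; rewrite preimage_set0.
- rewrite -preimage_bigcup -[X in measurable X]setTI.
  exact: measurable_consrV.
Qed.

HB.instance Definition _ := isMeasure.Build _ _ _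
  prod_leb_step step0 step_ge0 step_sigma_additive.

Let step_sigma_finite : sigma_finite setT prod_leb_step.
Proof.
have /sigma_finiteP[F [FT ndF Foo]] := sigma_finiteT (@lebesgue_measure R).
have /sigma_finiteP[G [GT ndG Goo]] := sigma_finiteT m.
exists (fun k => unconsrV @^-1` (F k `*` G k)).
  rewrite -preimage_bigcup (_ : \bigcup_k _ = setT) ?preimage_setT//.
  rewrite -subTset => -[x y] _.
  have [k _ Fkx] : (\bigcup_k F k) x by rewrite -FT.
  have [l _ Gly] : (\bigcup_k G k) y by rewrite -GT.
  exists (maxn k l) => //; split => /=.
    by move: x Fkx; exact/subsetPset/ndF/leq_maxl.
  by move: y Gly; exact/subsetPset/ndG/leq_maxr.
move=> k; have [mF Fk] := Foo k; have [mG Gk] := Goo k.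
have mFG : measurable (F k `*` G k) by exact: measurableX.
split.
  by rewrite -[X in measurable X]setTI; exact: measurable_unconsrV.
rewrite /prod_leb_step /pushforward -comp_preimage.
rewrite (_ : unconsrV \o consrV = id); last first.
  by apply/funext => p; exact: consrVK.
rewrite preimage_id product_measure1E//.
by rewrite lte_mul_pinfty// ge0_fin_numE.
Qed.

HB.instance Definition _ := Measure_isSigmaFinite.Build _ _ _
  prod_leb_step step_sigma_finite.

End prod_leb_step.

Section dirac_sigma_finite.
Variable (R : realType).

Definition prod_leb0 : set (prodrV R 0) -> \bar R := @dirac _ (prodrV R 0) (0 : 'rV[R]_0) R.

HB.instance Definition _ := Measure.on prod_leb0.

Let prod_leb0_sigma_finite : sigma_finite setT prod_leb0.
Proof.
by apply: fin_num_fun_sigma_finite => [|A _]; rewrite /prod_leb0 ?measure0 ?diracE.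
Qed.

HB.instance Definition _ := Measure_isSigmaFinite.Build _ _ _
  prod_leb0 prod_leb0_sigma_finite.

End dirac_sigma_finite.

Fixpoint prod_leb (R : realType) (n : nat) :
    {sigma_finite_measure set (prodrV R n) -> \bar R} :=
  match n with
  | 0 => [the {sigma_finite_measure set _ -> \bar R} of @prod_leb0 R]
  | n.+1 => [the {sigma_finite_measure set _ -> \bar R} of
              prod_leb_step (prod_leb R n)]
  end.

Fact rV_display : measure_display. Proof. exact. Qed.

Section leb.
Variables (R : realType) (n : nat).

HB.instance Definition _ := @isMeasurable.Build rV_display 'rV[R]_n
  (mu_ext (prod_leb R n)).-caratheodory%mu
  (caratheodory_measurable_set0 (mu_ext (prod_leb R n)))
  (@caratheodory_measurable_setC _ _ (mu_ext (prod_leb R n)))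
  (@caratheodory_measurable_bigcup _ _ (mu_ext (prod_leb R n))).

Definition leb : set 'rV[R]_n -> \bar R :=
  @completed_measure_extension _ _ _ (prod_leb R n).

Let leb_semi_sigma_additive : semi_sigma_additive leb.
Proof.
exact: (@measure_semi_sigma_additive _ _ _
  (@completed_measure_extension _ _ _ (prod_leb R n))).
Qed.

HB.instance Definition _ := isMeasure.Build _ _ _ leb
  (measure0 (@completed_measure_extension _ _ _ (prod_leb R n)))
  (measure_ge0 (@completed_measure_extension _ _ _ (prod_leb R n)))
  leb_semi_sigma_additive.

Let leb_sigma_finite : sigma_finite setT leb.
Proof.
exact: completed_measure_extension_sigma_finite (sigma_finiteT (prod_leb R n)).
Qed.

HB.instance Definition _ := Measure_isSigmaFinite.Build _ _ _
  leb leb_sigma_finite.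

End leb.
Arguments leb {R n}.

(** * Euclidean geometry and regularity of the boundary

    The library norm on ['rV[R]_n] is the sup norm, hence [enorm]. *)

Definition dotp (R : realType) (n : nat) (x y : 'rV[R]_n) : R :=
  \sum_(i < n) x 0 i * y 0 i.

Definition enorm (R : realType) (n : nat) (x : 'rV[R]_n) : R :=
  Num.sqrt (dotp x x).

Definition bdry (T : topologicalType) (A : set T) : set T :=
  closure A `\` interior A.

Definition bdist (R : realType) (n : nat) (Omega : set 'rV[R]_n)
    (x : 'rV[R]_n) : R :=
  inf [set enorm (x - y) | y in bdry Omega].

Definition partial (R : realType) (n : nat) (i : 'I_n) (f : 'rV[R]_n -> R)
    (x : 'rV[R]_n) : R :=
  'D_(delta_mx 0 i) f x.

Definition grad (R : realType) (n : nat) (f : 'rV[R]_n -> R)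
    (x : 'rV[R]_n) : 'rV[R]_n :=
  \row_i partial i f x.

Definition C11 (R : realType) (n : nat) (f : 'rV[R]_n -> R) : Prop :=
  (forall x, differentiable f x) /\
  exists L : R, forall x y, enorm (grad f x - grad f y) <= L * enorm (x - y).

(** Near each boundary point, in suitable orthonormal coordinates
    [y *m Q], the set is the region above the graph of a C^{1,1} function of
    all coordinates but the [k]-th. *)
Definition C11_boundary (R : realType) (n : nat) (Omega : set 'rV[R]_n) : Prop :=
  forall x0, bdry Omega x0 ->
  exists (r : R) (Q : 'M[R]_n) (k : 'I_n) (phi : 'rV[R]_n.-1 -> R),
    [/\ 0 < r, Q *m Q^T = 1%:M, C11 phi &
        forall y, enorm (y - x0) < r ->
          (Omega y <-> phi (col' k (y *m Q)) < (y *m Q) 0 k)].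

Definition domain (R : realType) (n : nat) (Omega : set 'rV[R]_n) : Prop :=
  [/\ Omega !=set0, open Omega & connected Omega].

(** * The space H^1_0 *)

Fixpoint Ck (R : realType) (n : nat) (k : nat) (f : 'rV[R]_n -> R) : Prop :=
  match k with
  | 0 => continuous f
  | k.+1 => [/\ continuous f,
                forall i x, derivable f x (delta_mx 0 i : 'rV[R]_n) &
                forall i, Ck k (partial i f)]
  end.

Definition test_function (R : realType) (n : nat) (Omega : set 'rV[R]_n)
    (phi : 'rV[R]_n -> R) : Prop :=
  [/\ forall k, Ck k phi,
      compact (closure [set x | phi x != 0]) &
      closure [set x | phi x != 0] `<=` Omega].

Definition L2 (R : realType) (n : nat) (Omega : set 'rV[R]_n)
    (h : 'rV[R]_n -> R) : Prop :=
  measurable_fun Omega h /\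
  leb.-integrable Omega (fun x => (h x ^+ 2)%:E).

Definition is_wgrad (R : realType) (n : nat) (Omega : set 'rV[R]_n)
    (u : 'rV[R]_n -> R) (G : 'rV[R]_n -> 'rV[R]_n) : Prop :=
  forall i : 'I_n, L2 Omega (fun x => G x 0 i) /\
    forall phi, test_function Omega phi ->
      \int[leb]_(x in Omega) (u x * partial i phi x) =
      - \int[leb]_(x in Omega) (G x 0 i * phi x).

(** The weak gradient, unique up to a null set of [Omega]; it is [0] when
    [u] has no square-integrable weak gradient. *)
Definition wgrad (R : realType) (n : nat) (Omega : set 'rV[R]_n)
    (u : 'rV[R]_n -> R) : 'rV[R]_n -> 'rV[R]_n :=
  xget (fun=> 0) [set G | is_wgrad Omega u G].

Definition H1 (R : realType) (n : nat) (Omega : set 'rV[R]_n)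
    (u : 'rV[R]_n -> R) : Prop :=
  L2 Omega u /\ exists G, is_wgrad Omega u G.

Definition H1norm (R : realType) (n : nat) (Omega : set 'rV[R]_n)
    (u : 'rV[R]_n -> R) : R :=
  Num.sqrt (\int[leb]_(x in Omega) (u x ^+ 2) +
            \int[leb]_(x in Omega) (enorm (wgrad Omega u x) ^+ 2)).

(** Closure of the test functions in H^1; elements are represented by
    functions on the whole space that vanish outside [Omega]. *)
Definition H01 (R : realType) (n : nat) (Omega : set 'rV[R]_n)
    (u : 'rV[R]_n -> R) : Prop :=
  [/\ forall x, ~ Omega x -> u x = 0,
      H1 Omega u &
      exists phi : nat -> 'rV[R]_n -> R,
        (forall k, test_function Omega (phi k)) /\
        H1norm Omega (u \- phi k) @[k --> \oo] --> (0 : R)].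

(** * The mixed local-nonlocal problem *)

(* The default value [0] is reached only in dimension [0]. *)
Definition coord1 (R : realType) (n : nat) (x : 'rV[R]_n) : R :=
  oapp (fun i : 'I_n => x 0 i) 0 (insub 0%N).

Definition fracl_const (R : realType) (n : nat) (s : R) : R :=
  (\int[leb]_xi
     ((1 - cos (coord1 (xi : 'rV[R]_n))) / enorm xi `^ (n%:R + 2 * s)))^-1.

Definition gagliardo (R : realType) (n : nat) (s : R) (u v : 'rV[R]_n -> R)
    (z : 'rV[R]_n * 'rV[R]_n) : R :=
  (u z.1 - u z.2) * (v z.1 - v z.2) / enorm (z.1 - z.2) `^ (n%:R + 2 * s).

Definition Aclass (R : realType) (n : nat) (Omega : set 'rV[R]_n) (zeta : R)
    (f : 'rV[R]_n -> R) : Prop :=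
  [/\ measurable_fun Omega f,
      forall x, Omega x -> 0 <= f x &
      exists c1 c2 : R, [/\ 0 < c1, 0 < c2 &
        forall x, Omega x ->
          c1 * bdist Omega x `^ (- zeta) <= f x <=
          c2 * bdist Omega x `^ (- zeta)]].

(** Absolute convergence of the two possibly singular integrals is part of the
    definition, since [Rintegral] is total. *)
Definition weak_solution (R : realType) (n : nat) (Omega : set 'rV[R]_n)
    (s gamma : R) (f u : 'rV[R]_n -> R) : Prop :=
  [/\ H01 Omega u,
      {ae leb, forall x, Omega x -> 0 < u x} &
      forall psi, H01 Omega psi ->
        [/\ (leb \x leb)%E.-integrable setT (fun z => (gagliardo s u psi z)%:E),
            leb.-integrable Omega (fun x => (f x / u x `^ gamma * psi x)%:E) &
            \int[leb]_(x in Omega)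
               dotp (wgrad Omega u x) (wgrad Omega psi x) +
            fracl_const n s / 2 *
              \int[(leb \x leb)%E]_z gagliardo s u psi z =
            \int[leb]_(x in Omega) (f x / u x `^ gamma * psi x)]].

Definition minimal_weak_solution (R : realType) (n : nat)
    (Omega : set 'rV[R]_n) (s gamma : R) (f u : 'rV[R]_n -> R) : Prop :=
  weak_solution Omega s gamma f u /\
  forall v, weak_solution Omega s gamma f v ->
    {ae leb, forall x, Omega x -> u x <= v x}.

(* Main.v *)
Require Import Defs.
From HB Require Import structures.
From mathcomp Require Import all_boot all_order all_algebra.
From mathcomp Require Import all_classical all_reals all_analysis.
From mathcomp Require Import measurable_realfun ring lra.
Set Implicit Arguments.
Unset Strict Implicit.
Unset Printing Implicit Defensive.
Import Order.TTheory GRing.Theory Num.Def Num.Theory.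
Import numFieldNormedType.Exports.
Local Open Scope classical_set_scope.
Local Open Scope ring_scope.

(** The weak formulation reads [a u psi = \int f * u ^ - gamma * psi], where [a] is
    the sum of the Dirichlet form and of the Gagliardo form. The latter is bounded
    by the former on [H01 Omega] ([dq_H01]): for a test function the squared norm
    of an increment of length [|z|] is at most a multiple of [min (1, |z| ^ 2)]
    times the Dirichlet energy, and that factor makes the kernel integrable
    ([kernel_integrable]). Hence [a] is a complete inner product on [H01 Omega],
    test functions are dense for it, and the Poincare inequality holds.

    The weight [f] is controlled by the energy as well. Since
    [gamma > 0] and [gamma + zeta <= 1], one has [zeta < 1]. Near a boundary point
    the distance to the boundary is comparable with the height above a Lipschitz
    graph; a layer of height [h] has measure of order [h], and on it the squared
    norm of a test function is at most [h ^ 2] times its energy. Summing over dyadic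
    layers, [f] and [f * u ^ 2] are integrable, the latter with integral at most a
    multiple of the energy of [u] ([weight_bound], [weight_H01]).

    The singular nonlinearity is replaced by the bounded nonincreasing one
    [(max (t, 0) + e) ^ - gamma] with [e = 1 / (k + 1)], for which a solution [u_k]
    is obtained by minimising a strongly convex functional
    ([exists_bounded_nonlinearity]). Nonincreasing right-hand sides obey a
    comparison principle ([comparison]), proved by testing with smooth truncations,
    which do not increase the energy ([mixed_sramp]). It shows that [u_k] is
    nonnegative and nondecreasing in [k] while [u_k + 1 / (k + 1)] is nonincreasing.
    Since [gamma <= 1], testing the equation of [u_k] with [u_k] bounds the energies,
    which are also nondecreasing and whose increments dominate the squared distances;
    so [u_k] converges strongly to some [u] ([singular_limit]). The right-hand sides
    tested with [|psi|] have bounded integrals, which yields both the positivity of [u]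
    and, by Fatou's lemma and dominated convergence, the equation of [u].

    Finally, [t ^ - gamma] decreases while [a] is positive definite, so the difference
    of two solutions has no energy ([singular_unique]): the solution is unique up to
    a null set, and in particular minimal. *)

(** * Borel and Lebesgue sets of the space of row vectors *)

Section borel.
Variables (R : realType) (n : nat).
Local Notation V := 'rV[R]_n.
Local Notation B := (Defs.prodrV R n).

Lemma ler_coord (x : V) (i : 'I_n) : `|x 0 i| <= `|x|.
Proof.
rewrite [leRHS]/normr /= mx_normrE; apply/bigmax_geP; right => /=.
by exists (0, i).
Qed.

Lemma norm_rV_le (x : V) (r : R) :
  0 <= r -> (forall i, `|x 0 i| <= r) -> `|x| <= r.
Proof.
move=> r0 xr; rewrite [leLHS]/normr /= mx_normrE; apply/bigmax_leP; split => //.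
by move=> [i j] _ /=; rewrite ord1; exact: xr.
Qed.

Lemma norm_rV_lt (x : V) (r : R) :
  0 < r -> (forall i, `|x 0 i| < r) -> `|x| < r.
Proof.
move=> r0 xr; rewrite [ltLHS]/normr /= mx_normrE; apply/bigmax_ltP; split => //.
by move=> [i j] _ /=; rewrite ord1; exact: xr.
Qed.

Lemma norm_delta_le1 (i : 'I_n) : `|delta_mx 0 i : V| <= 1.
Proof.
by apply: norm_rV_le => // j; rewrite mxE; case: (_ && _); rewrite ?normr1 ?normr0.
Qed.

Lemma enorm_ge0 (z : V) : 0 <= enorm z.
Proof. exact: sqrtr_ge0. Qed.

Lemma sqr_enorm (z : V) : enorm z ^+ 2 = \sum_(i < n) z 0 i ^+ 2.
Proof.
rewrite /enorm sqr_sqrtr /dotp; first by apply: eq_bigr => i _; rewrite expr2.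
by apply: sumr_ge0 => i _; rewrite -expr2 sqr_ge0.
Qed.

Lemma enorm_coord (z : V) i : `|z 0 i| <= enorm z.
Proof.
rewrite -(ler_pXn2r (n := 2)) ?nnegrE ?enorm_ge0// real_normK ?num_real// sqr_enorm.
by rewrite (bigD1 i)//= lerDl; apply: sumr_ge0 => j _; exact: sqr_ge0.
Qed.

Lemma norm_le_enorm (z : V) : `|z| <= enorm z.
Proof. by apply: norm_rV_le; [exact: enorm_ge0|exact: enorm_coord]. Qed.

Lemma enormN (z : V) : enorm (- z) = enorm z.
Proof. by rewrite /enorm /dotp; congr Num.sqrt; apply: eq_bigr => i _; rewrite !mxE mulrNN. Qed.

Lemma measurable_coord_borel (i : 'I_n) (A : set R) :
  measurable A -> measurable ([set x : V | A (x 0 i)] : set B).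
Proof.
move=> mA; have := @measurable_prodrV_coord R n i.
by move=> /(_ measurableT _ mA); rewrite setTI.
Qed.

Lemma measurable_cap_ord d (T : measurableType d) (F : 'I_n -> set T) :
  (forall i, measurable (F i)) -> measurable [set x | forall i, F i x].
Proof.
move=> mF; rewrite (_ : [set x | _] = \bigcap_(i in [set: 'I_n]) F i).
  by apply: fin_bigcap_measurable => //; exact: fin_finset.
by apply/seteqP; split => x /= Fx i => [_|]; exact: Fx.
Qed.

Definition obox (a b : V) : set V := [set x | forall i, a 0 i < x 0 i < b 0 i].

Definition cbox (a b : V) : set V :=
  [set x | forall i, a 0 i <= x 0 i <= b 0 i].

Lemma measurable_obox (a b : V) : measurable (obox a b : set B).
Proof.
apply: measurable_cap_ord => i.
have := @measurable_coord_borel i `]a 0 i, b 0 i[%classic (measurable_itv _).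
rewrite (_ : [set x : V | _ (x 0 i)] = [set x : V | a 0 i < x 0 i < b 0 i])//.
Qed.

(** Cubes with rational centres and radii [1 / (m + 1)] suffice. *)
Lemma box_cover (U : set V) : open U ->
  exists (a b : nat -> V) (D : set nat),
    (forall k, D k -> cbox (a k) (b k) `<=` U) /\
    U = \bigcup_(k in D) obox (a k) (b k).
Proof.
move=> oU.
pose c k : V * R := if @unpickle ('rV[rat]_n * nat)%type k is Some (q, m)
  then (\row_i ratr (q 0 i), m.+1%:R^-1) else (0, 0).
pose a k : V := (c k).1 - const_mx (c k).2.
pose b k : V := (c k).1 + const_mx (c k).2.
exists a, b, [set k | cbox (a k) (b k) `<=` U]; split => //.
apply/seteqP; split=> [x Ux|x [k /= kU xk]]; last first.
  by apply: kU => i; have /andP[/ltW -> /ltW ->] := xk i.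
have [e /= e0 eU] : exists2 e : R, 0 < e & ball x e `<=` U.
  by move: oU; rewrite openE => /(_ _ Ux) /nbhs_ballP [e ? ?]; exists e.
have [m me] := ltr_add_invr (divr_gt0 e0 (ltr0n R 2)); rewrite add0r in me.
have m0 : 0 < m.+1%:R^-1 :> R by rewrite invr_gt0.
have /choice[q hq] : forall i : 'I_n, exists q : rat,
    (x 0 i - m.+1%:R^-1 < ratr q < x 0 i + m.+1%:R^-1)%R.
  move=> i; have : x 0 i - m.+1%:R^-1 < x 0 i + m.+1%:R^-1.
    by rewrite ltrBlDr -addrA ltrDl addr_gt0.
  by move=> /rat_in_itvoo[q]; rewrite in_itv/= => ?; exists q.
have ck : c (pickle (\row_i q i, m)) = (\row_i ratr (q i), m.+1%:R^-1).
  by rewrite /c pickleK; congr pair; apply/rowP => i; rewrite !mxE.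
exists (pickle (\row_i q i, m)); last first.
  move=> i; rewrite /a /b ck !mxE/=.
  move: (hq i) => /andP[]; move: (m.+1%:R^-1) => d *.
  by apply/andP; split; lra.
move=> y yb; apply: eU; rewrite -ball_normE/=.
apply: norm_rV_lt => // i; have := yb i; rewrite /a /b ck !mxE/= => /andP[y1 y2].
have /andP[q1 q2] := hq i.
move: y1 y2 q1 q2 me; rewrite ltr_norml; move: (m.+1%:R^-1) => d.
by move=> *; apply/andP; split; lra.
Qed.

Lemma open_borel (U : set V) : open U -> measurable (U : set B).
Proof.
move=> /box_cover[a [b [D [_ ->]]]].
by apply: bigcup_measurable => k _; exact: measurable_obox.
Qed.

Lemma continuous_borel (f : V -> R) :
  continuous f -> measurable_fun setT (f : B -> R).
Proof.
move=> cf; apply: (measurability _ (RGenOpens.measurableE R)).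
move=> _ [_ [a [b ->] <-]]; rewrite setTI; apply: open_borel.
by move/continuousP : cf; apply; exact: interval_open.
Qed.

Lemma borel_measurable (A : set B) :
  measurable A -> measurable (A : set V).
Proof.
by move=> mA; exact: (@caratheodory_measurable_mu_ext _ _ _ (prod_leb R n)).
Qed.

Lemma lebE (A : set B) : measurable A -> leb (A : set V) = prod_leb R n A.
Proof. by move=> mA; exact: (@measurable_mu_extE _ _ _ (prod_leb R n)). Qed.

Lemma borel_measurable_fun d (T : measurableType d) (f : V -> T) :
  measurable_fun setT (f : B -> T) -> measurable_fun setT f.
Proof.
by move=> mf _ A mA; rewrite setTI; apply: borel_measurable; rewrite -[X in measurable X]setTI; exact: mf.
Qed.

Lemma continuous_leb (f : V -> R) : continuous f -> measurable_fun setT f.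
Proof. by move=> cf; apply: borel_measurable_fun; exact: continuous_borel. Qed.

Lemma open_leb (U : set V) : open U -> measurable U.
Proof. by move=> oU; apply: borel_measurable; exact: open_borel. Qed.

(** The countable covers that define the outer measure have measurable
    unions, so an optimal sequence of them yields the hull. *)
Lemma borel_hull (A : set V) : measurable A -> (leb A < +oo)%E ->
  exists F : set B, [/\ measurable F, A `<=` F & leb ((F : set V) `\` A) = 0%E].
Proof.
move=> mA Afin.
have Afn : mu_ext (prod_leb R n) A \is a fin_num.
  by rewrite ge0_fin_numE//; exact: mu_ext_ge0.
have cov m : exists C : (set B)^nat, @measurable_cover _ B A C /\
    (\sum_(0 <= k <oo) prod_leb R n (C k) < leb A + m.+1%:R^-1%:E)%E.
  have m0 : (0 < m.+1%:R^-1 :> R) by rewrite invr_gt0.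
  have [_ [C AC <-] ltC] := lb_ereal_inf_adherent m0 Afn.
  by exists C; split; [exact: AC|exact: ltC].
pose C m := projT1 (cid (cov m)).
have CA m : @measurable_cover _ B A (C m) by rewrite /C; case: cid => ? [].
have Cl m : (\sum_(0 <= k <oo) prod_leb R n (C m k) < leb A + m.+1%:R^-1%:E)%E.
  by rewrite /C; case: cid => ? [].
pose F : set B := \bigcap_m \bigcup_k (C m k).
have mF : measurable F.
  apply: bigcapT_measurable => m; apply: bigcupT_measurable => k.
  by have [+ _] := CA m; exact.
have AF : A `<=` F by move=> x Ax m _; have [_] := CA m; exact.
exists F; split => //.
have leF : (leb (F : set V) <= leb A)%E.
  apply/lee_addgt0Pr => e e0; rewrite lebE//.
  have [m me] := ltr_add_invr e0; rewrite add0r in me.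
  apply: (@le_trans _ _ (\sum_(0 <= k <oo) prod_leb R n (C m k))%E).
    apply: (@le_trans _ _ (prod_leb R n (\bigcup_k C m k))).
      apply: le_measure; rewrite ?inE//.
        by apply: bigcupT_measurable => k; have [+ _] := CA m; exact.
      by move=> x; exact.
    apply: measure_sigma_subadditive => //.
      by move=> k; have [+ _] := CA m; exact.
    by apply: bigcupT_measurable => k; have [+ _] := CA m; exact.
  by apply: ltW; apply: (lt_le_trans (Cl m)); rewrite leeD2l// lee_fin ltW.
have mF' := borel_measurable mF.
have eqF : leb (F : set V) = leb A.
  by apply/le_anti; rewrite leF/=; apply: le_measure; rewrite ?inE.
rewrite measureD//; last exact: le_lt_trans leF Afin.
rewrite setIidr// -[X in (_ - X)%E]eqF subee// ge0_fin_numE//.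
exact: le_lt_trans leF Afin.
Qed.

End borel.

(** * Translation invariance *)

Section translation.
Variable R : realType.

Lemma measurable_shift_borel n (z : 'rV[R]_n) :
  measurable_fun setT ((fun x => x + z) : Defs.prodrV R n -> Defs.prodrV R n).
Proof.
apply: measurable_fun_prodrV => i.
rewrite (_ : _ \o _ = (fun t : R => t + z 0 i) \o
   (fun v : Defs.prodrV R n => (v : 'rV_n) 0 i)).
  apply: measurableT_comp; last exact: measurable_prodrV_coord.
  exact: measurable_funD.
by apply/funext => x /=; rewrite mxE.
Qed.

(** Translation preserves the length of half-open intervals, and these determine
    the measure. *)
Lemma lebesgue_shift (a : R) (A : set R) : measurable A ->
  @lebesgue_measure R ((fun x => x + a) @^-1` A) = @lebesgue_measure R A.
Proof.
move=> mA.
have mf : measurable_fun setT (fun x : measurableTypeR R => x + a : measurableTypeR R).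
  exact: measurable_funD.
have mu_itv : forall X, ocitv X -> @lebesgue_measure R X = pushforward (@lebesgue_measure R) (fun x : measurableTypeR R => x + a : measurableTypeR R) X.
  move=> X [[b c] _ <-]; rewrite /pushforward.
  rewrite (_ : _ @^-1` _ = `]b - a, c - a]%classic).
    rewrite !lebesgue_measure_itv /= !lte_fin ltrD2r.
    by case: ifP => // _; rewrite -!EFinB; congr (_%:E); lra.
  by apply/seteqP; split => x /=; rewrite !in_itv/= => /andP[? ?]; apply/andP; split; lra.
have := @lebesgue_measure_unique R (measure_function_pushforward__canonical__measure_function_Measure (@lebesgue_measure R) mf) mu_itv A mA.
by move=> ->.
Qed.

Definition shiftX n (z : 'rV[R]_n) (A : set 'rV[R]_n) : set 'rV[R]_n :=
  (fun x => x + z) @^-1` A.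

(** Induction on the dimension: the shift acts on the two factors of
    the product separately. *)
Lemma prod_leb_shift n (z : 'rV[R]_n) (A : set (Defs.prodrV R n)) :
  measurable A -> prod_leb R n (shiftX z A) = prod_leb R n A.
Proof.
elim: n z A => [|n IH] z A mA.
  congr (prod_leb R 0 _).
  by apply/seteqP; split => x; rewrite /shiftX/= (_ : x + z = x)//; apply/rowP => -[].
have mC := @measurable_consrV R n.
pose z' : 'rV[R]_n := \row_i z 0 (lift ord0 i).
pose S (p : measurableTypeR R * Defs.prodrV R n) : measurableTypeR R * Defs.prodrV R n :=
  (p.1 + z 0 ord0, (p.2 : 'rV_n) + z').
have mS : measurable_fun setT S.
  apply: measurable_fun_pair.
    by apply: measurable_funD => //; exact: measurable_fst.
  apply: (measurableT_comp (measurable_shift_borel z')); exact: measurable_snd.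
have CS p : consrV (S p) = (consrV p : 'rV_n.+1) + z.
  apply/rowP => i; have [j ->|->] := unliftP ord0 i.
    by rewrite !mxE liftK /= !mxE.
  by rewrite !mxE unlift_none.
have mCA : measurable (@consrV R n @^-1` A) by rewrite -[X in measurable X]setTI; exact: mC.
change ((@lebesgue_measure R \x prod_leb R n)%E (@consrV R n @^-1` (shiftX z A)) =
  (@lebesgue_measure R \x prod_leb R n)%E (@consrV R n @^-1` A)).
rewrite (_ : _ @^-1` shiftX z A = S @^-1` (@consrV R n @^-1` A)); last first.
  by apply/seteqP; split => p; rewrite /shiftX /= CS.
have := @product_measure_unique _ _ _ _ R (@lebesgue_measure R) (prod_leb R n) (measure_function_pushforward__canonical__measure_function_Measure (@lebesgue_measure R \x prod_leb R n)%E mS).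
move=> uniq; apply/esym; apply: uniq => // X Y mX mY; rewrite /= /pushforward.
have -> : S @^-1` (X `*` Y) = ((fun x => x + z 0 ord0) @^-1` X) `*` shiftX z' Y.
  by [].
rewrite product_measure1E//.
- by congr (_ * _)%E; [exact: lebesgue_shift|exact: IH].
- by rewrite -[X in measurable X]setTI; exact: measurable_funD.
- by rewrite -[X in measurable X]setTI; exact: measurable_shift_borel.
Qed.

Lemma mu_ext_shift n (z : 'rV[R]_n) (A : set 'rV[R]_n) :
  mu_ext (prod_leb R n) (shiftX z A) = mu_ext (prod_leb R n) A.
Proof.
suff le w (C : set 'rV[R]_n) : (mu_ext (prod_leb R n) (shiftX w C) <= mu_ext (prod_leb R n) C)%E.
  apply/le_anti; rewrite le//=.
  rewrite [X in (mu_ext _ X <= _)%E](_ : A = shiftX (- z) (shiftX z A))//.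
  by apply/seteqP; split => x; rewrite /shiftX/= subrK.
apply: le_ereal_inf_tmp => _ [C' [mC' CC'] <-].
apply: ereal_inf_lbound; exists (fun k => shiftX w (C' k)).
  split => [k|x Cx]; last by have [k _ ?] := CC' _ Cx; exists k.
  by rewrite -[X in measurable X]setTI; exact: measurable_shift_borel.
by apply: eq_eseriesr => k _; rewrite prod_leb_shift.
Qed.

(** The sets are those of Caratheodory's criterion, which only mentions
    the outer measure, and the outer measure is shift invariant. *)
Lemma measurable_shiftX n (z : 'rV[R]_n) (A : set 'rV[R]_n) :
  measurable A -> measurable (shiftX z A).
Proof.
move=> mA; change ((mu_ext (prod_leb R n)).-caratheodory%mu (shiftX z A)).
move=> X; have := (mA : (mu_ext (prod_leb R n)).-caratheodory%mu A) (shiftX (- z) X).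
rewrite mu_ext_shift => ->.
congr (_ + _)%E; rewrite -(mu_ext_shift z); congr mu_ext;
  by apply/seteqP; split => x; rewrite /shiftX/= addrK.
Qed.

Lemma measurable_shift n (z : 'rV[R]_n) :
  measurable_fun setT ((fun x => x + z) : 'rV[R]_n -> 'rV[R]_n).
Proof. by move=> _ A mA; rewrite setTI; exact: measurable_shiftX. Qed.

Lemma leb_shift n (z : 'rV[R]_n) (A : set 'rV[R]_n) :
  leb (shiftX z A) = leb A.
Proof. exact: mu_ext_shift. Qed.

Lemma ge0_integral_shift n (z : 'rV[R]_n) (h : 'rV[R]_n -> \bar R) :
  measurable_fun setT h -> (forall x, 0 <= h x)%E ->
  (\int[leb]_x h (x + z)%R = \int[leb]_x h x)%E.
Proof.
move=> mh h0.
transitivity (\int[pushforward leb (fun x : 'rV[R]_n => (x + z)%R)]_(y in setT) h y)%E.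
  by rewrite (ge0_integral_pushforward (measurable_shift z)).
apply: eq_measure_integral => [|mf A mA _]; first exact: measurable_shift.
exact: leb_shift.
Qed.

Lemma integrable_shift n (z : 'rV[R]_n) (h : 'rV[R]_n -> R) :
  leb.-integrable setT (EFin \o h) -> leb.-integrable setT (fun x => (h (x + z))%:E).
Proof.
move=> /integrableP[mh ih]; apply/integrableP; split.
  exact: (measurableT_comp mh (measurable_shift z)).
rewrite (@ge0_integral_shift n z (fun x => `|(h x)%:E|%E))//.
exact: measurableT_comp.
Qed.

Lemma Rintegral_shift n (z : 'rV[R]_n) (h : 'rV[R]_n -> R) :
  measurable_fun setT h ->
  \int[leb]_x h (x + z)%R = \int[leb]_x h x.
Proof.
move=> /measurable_EFinP mh; congr fine; rewrite [LHS]integralE [RHS]integralE.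
congr (_ - _)%E.
  rewrite -[RHS](@ge0_integral_shift n z (fun x => (h x)%:E)^\+%E)//;
    last exact: measurable_funepos.
  by apply: eq_integral => x _; rewrite !funeposE.
rewrite -[RHS](@ge0_integral_shift n z (fun x => (h x)%:E)^\-%E)//;
  last exact: measurable_funeneg.
by apply: eq_integral => x _; rewrite !funenegE.
Qed.

End translation.

(** * Cubes *)

Section cube.
Variable R : realType.

Definition cube n (r : R) : set 'rV[R]_n := [set x | forall i, `|x 0 i| <= r].

Lemma measurable_cube n r : measurable (@cube n r : set (Defs.prodrV R n)).
Proof.
apply: measurable_cap_ord => i.
apply: (@measurable_coord_borel R n i [set t | `|t| <= r]).
rewrite (_ : [set t | _] = `[- r, r]%classic) //.
by apply/seteqP; split => t /=; rewrite in_itv/= ler_norml.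
Qed.

Lemma prod_leb_cube n (r : R) : 0 <= r ->
  prod_leb R n (@cube n r) = ((2 * r) ^+ n)%:E.
Proof.
move=> r0; elim: n => [|n IH].
  rewrite expr0 /= /prod_leb0 diracE mem_set//.
  by move=> [].
change ((@lebesgue_measure R \x prod_leb R n)%E (@consrV R n @^-1` (@cube n.+1 r)) = ((2 * r) ^+ n.+1)%:E).
have -> : @consrV R n @^-1` (@cube n.+1 r) = `[- r, r]%classic `*` @cube n r.
  apply/seteqP; split => [[x v] /= h|[x v] [/=]].
    split => [|i] /=.
      by have := h ord0; rewrite mxE unlift_none/= in_itv/= ler_norml.
    by have := h (lift ord0 i); rewrite mxE liftK/=.
  rewrite in_itv/= => hx hv i; rewrite mxE.
  by case: unliftP => [j _|_] /=; [exact: hv|rewrite ler_norml].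
rewrite product_measure1E//; last exact: measurable_cube.
rewrite IH.
rewrite (_ : (_ * _)%E = ((2 * r)%:E * ((2 * r) ^+ n)%:E)%E).
  by rewrite -EFinM exprS.
congr (_ * _)%E.
rewrite [LHS]lebesgue_measure_itv/= lte_fin.
case: ltP => [rr|].
  by rewrite -EFinB; congr (_%:E); lra.
by move=> rr; congr (_%:E); lra.
Qed.

Lemma leb_norm_le n (r : R) (A : set 'rV[R]_n) : measurable A ->
  0 <= r -> (forall x, A x -> `|x| <= r) -> (leb A <= ((2 * r) ^+ n)%:E)%E.
Proof.
move=> mA r0 Ar; rewrite -prod_leb_cube// -lebE; last exact: measurable_cube.
apply: le_measure; rewrite ?inE//.
  by apply: borel_measurable; exact: measurable_cube.
by move=> x Ax i; apply: le_trans (Ar _ Ax); exact: ler_coord.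
Qed.

Lemma bounded_norm (V : normedModType R) (A : set V) : bounded_set A ->
  exists2 M : R, 0 < M & forall x, A x -> `|x| <= M.
Proof.
move=> [M [_ bA]]; exists (`|M| + 1); first by rewrite ltr_wpDl.
by move=> x Ax; apply: (bA (`|M| + 1)) => //; rewrite (le_lt_trans (ler_norm M))// ltrDl.
Qed.

Lemma bounded_leb_fin n (A : set 'rV[R]_n) : measurable A -> bounded_set A ->
  (leb A < +oo)%E.
Proof.
move=> mA /bounded_norm[M M0 bA].
exact: le_lt_trans (leb_norm_le mA (ltW M0) bA) (ltry _).
Qed.

End cube.

(** * Smooth functions built from [exp (- 1 / t)] *)

Section flat_function.
Variable R : realType.

(** The functions [p (1 / t) exp (- 1 / t)], extended by [0] to [t <= 0], form
    a family closed under differentiation. *)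
Definition flat (p : {poly R}) (t : R) : R :=
  if 0 < t then p.[t^-1] * expR (- t^-1) else 0.

(** With [s = 1 / t] the derivative along [t] is [- s ^ 2] times the derivative
    along [s]. *)
Definition dflat (p : {poly R}) : {poly R} := 'X^2 * (p - p^`()).

(** The exponential dominates every power of [1 / t]; two powers of [t] to spare
    make the derivative at [0] vanish. *)
Lemma flat_bound (p : {poly R}) :
  exists2 K : R, 0 <= K & forall t, `|flat p t| <= K * t ^+ 2.
Proof.
pose K := \sum_(i < size p) `|p`_i| * (i.+2)`!%:R.
have K0 : 0 <= K by apply: sumr_ge0 => i _; rewrite mulr_ge0.
exists K => // t; rewrite /flat; case: ifPn => [t0|_]; last first.
  by rewrite normr0 mulr_ge0 ?sqr_ge0.
rewrite horner_coef mulr_suml (le_trans (ler_norm_sum _ _ _))// mulr_suml.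
apply: ler_sum => i _; rewrite normrM normrM -!mulrA ler_wpM2l//.
have ti0 : 0 <= t^-1 by rewrite invr_ge0 ltW.
rewrite ger0_norm ?exprn_ge0// ger0_norm ?expR_ge0//.
rewrite expRN ler_pdivrMr ?expR_gt0//.
have := expR_ge1Dxn i.+1 ti0.
move=> h; have {}h : t^-1 ^+ i.+2 / (i.+2)`!%:R <= expR t^-1.
  by apply: le_trans h; rewrite lerDr.
rewrite ler_pdivrMr ?ltr0n ?fact_gt0// in h.
have -> : t^-1 ^+ i = t ^+ 2 * t^-1 ^+ i.+2.
  by rewrite (exprD _ 2 i) mulrA -exprMn mulfV ?gt_eqF// expr1n mul1r.
by rewrite (mulrC _`!%:R) -[leRHS]mulrA ler_wpM2l ?sqr_ge0// mulrC.
Qed.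

Lemma is_derive_flat (p : {poly R}) (t : R) :
  is_derive t (1 : R) (flat p) (flat (dflat p) t).
Proof.
have [t0|t0|->] := ltgtP t 0.
- apply: (@near_eq_is_derive _ _ _ (cst 0)).
    near=> x; rewrite /flat ifF//=; apply/negbTE; rewrite -leNgt ltW//.
    by near: x; exact: lt_nbhsl.
  by rewrite /flat ifF; [exact: is_derive_cst|apply/negbTE; rewrite -leNgt ltW].
- apply: (@near_eq_is_derive _ _ _ ((horner p \o GRing.inv) * (expR \o (fun x => - x^-1)))).
    near=> x; rewrite /flat ifT//=.
    by near: x; exact: lt_nbhsr.
  have dV : is_derive t (1 : R) (GRing.inv : R -> R) (- t ^- 2).
    have := @is_deriveV R id t 1 1 _ _.
    by move=> /(_ (lt0r_neq0 t0) (is_derive_id _ _)); rewrite [_ *: _]mulr1.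
  have dp : is_derive t (1 : R) (horner p \o GRing.inv) (p^`().[t^-1] * - t ^- 2).
    exact: is_derive1_comp.
  have dN : is_derive t (1 : R) (fun x : R => - x^-1) (- - t ^- 2).
    exact: is_deriveN.
  have de : is_derive t (1 : R) (expR \o (fun x : R => - x^-1)) (expR (- t^-1) * - - t ^- 2).
    exact: is_derive1_comp.
  apply: is_derive_eq.
  rewrite /flat t0 /dflat !hornerE /= /GRing.scale/= opprK.
  by rewrite -exprVn; ring.
- rewrite {2}/flat ltxx.
  have [K K0 hK] := flat_bound p.
  have lim0 : (h^-1 *: ((flat p \o shift (0 : R)) (h *: (1 : R)) - flat p 0)) @[h --> (0 : R)^'] --> (0 : R).
    apply/cvgr0Pnorm_lt => e e0; near=> h.
    have h0 : h != 0 by near: h; exact: nbhs_dnbhs_neq.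
    rewrite /= /shift /= addr0 {2}/flat ltxx subr0 [_ *: 1]mulr1 normrZ.
    rewrite normfV ltr_pdivrMl ?normr_gt0//.
    apply: le_lt_trans (hK h) _.
    rewrite -(real_normK (num_real h)) expr2 mulrCA ltr_pM2l ?normr_gt0//.
    apply: (@le_lt_trans _ _ ((K + 1) * `|h|)); first by rewrite ler_wpM2r// lerDl.
    rewrite -ltr_pdivlMl ?ltr_wpDl//.
    near: h; apply: dnbhs0_lt; rewrite mulr_gt0// invr_gt0 ltr_wpDl//.
  apply: DeriveDef.
    by apply/cvg_ex; exists 0.
  exact: cvg_lim lim0.
Unshelve. all: by end_near.
Qed.

Lemma continuous_flat (p : {poly R}) : continuous (flat p).
Proof.
move=> t; apply: differentiable_continuous; apply/derivable1_diffP.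
by case: (is_derive_flat p t).
Qed.

End flat_function.

(** * Smooth functions of several variables *)

Section smooth.
Variables (R : realType) (n : nat).
Local Notation V := 'rV[R]_n.
Local Notation e_ i := (delta_mx 0 i : V).

(** Closing under partial derivatives by construction makes smoothness of an
    explicit function a matter of exhibiting its syntax. *)
Inductive smooth : (V -> R) -> Prop :=
| smooth_Ck f : (forall k, Ck k f) -> smooth f
| smooth_cst c : smooth (fun=> c)
| smooth_coord i : smooth (fun x => x 0 i)
| smoothD f g : smooth f -> smooth g -> smooth (fun x => f x + g x)
| smoothM f g : smooth f -> smooth g -> smooth (fun x => f x * g x)
| smooth_flat p f : smooth f -> smooth (fun x => flat p (f x)).

Lemma continuous_coord (i : 'I_n) : continuous (fun x : V => x 0 i).
Proof. by move=> x; exact: coord_continuous. Qed.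

Lemma is_derive_coord (i j : 'I_n) (x : V) :
  is_derive x (e_ j) (fun y : V => y 0 i) ((i == j)%:R : R).
Proof.
have lim0 : (h^-1 *: (((fun y : V => y 0 i) \o shift x) (h *: e_ j) - x 0 i)) @[h --> (0 : R)^'] --> ((i == j)%:R : R).
  apply: cvg_near_cst; near=> h.
  have h0 : h != 0 by near: h; exact: nbhs_dnbhs_neq.
  by rewrite /= !mxE addrK eqxx /= [_ *: _]mulrA mulVf// mul1r.
by apply: DeriveDef; [apply/cvg_ex; eexists; exact: lim0|exact: cvg_lim lim0].
Unshelve. all: by end_near.
Qed.

(** Restriction of the direction of differentiation to a line reduces the
    chain rule to the one-dimensional one. *)
Lemma is_derive_line (f : V -> R) (v x : V) (df : R) :
  is_derive (0 : R) (1 : R) (fun t : R => f (x + t *: v)) df <-> is_derive x v f df.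
Proof.
have E : (fun h : R => h^-1 *: ((f \o shift x) (h *: v) - f x)) =
   (fun h : R => h^-1 *: (((fun t : R => f (x + t *: v)) \o shift 0) (h *: 1) - f (x + 0 *: v))).
  apply/funext => h /=; rewrite /shift /= addr0 scale0r addr0 [x + _]addrC.
  by rewrite [h *: 1]mulr1.
by split => -[d1 d2]; apply: DeriveDef; rewrite /derivable /derive ?E// -?E.
Qed.

Lemma is_derive_along (f : V -> R) (v x : V) (t df : R) :
  is_derive (x + t *: v) v f df ->
  is_derive t (1 : R) (fun t : R => f (x + t *: v)) df.
Proof.
move=> /is_derive_line h.
have h2 : is_derive (t - t) (1 : R) (fun r : R => f (x + t *: v + r *: v)) df by rewrite subrr.
have h3 : is_derive t (1 : R) (fun r : R => r - t) 1.
  have hh := is_deriveB (is_derive_id t (1 : R)) (is_derive_cst t t (1 : R)).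
  by apply: (is_derive_eq hh); rewrite subr0.
have := @is_derive1_comp _ (fun r : R => f (x + t *: v + r *: v)) (fun r : R => r - t) t _ _ h2 h3.
rewrite mulr1 /comp; congr is_derive; apply/funext => r.
by rewrite -addrA -scalerDl [t + _]addrC subrK.
Qed.

Lemma is_derive_flat_comp (p : {poly R}) (f : V -> R) (v x : V) (df : R) :
  is_derive x v f df ->
  is_derive x v (fun y => flat p (f y)) (flat (dflat p) (f x) * df).
Proof.
move=> /is_derive_line h; apply/is_derive_line.
apply: (@is_derive1_comp _ (flat p)) => //.
by rewrite scale0r addr0; exact: is_derive_flat.
Qed.

(** A derivative is exhibited for each constructor together with the proof that
    it stays in the class; smoothness of every order is then an induction. *)
Lemma smooth_partial f : smooth f ->
  [/\ continuous f, forall i x, derivable f x (e_ i) &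
      forall i, smooth (partial i f)].
Proof.
suff H : smooth f -> continuous f /\ forall i, exists2 df, smooth df &
    forall x, is_derive x (e_ i) f (df x).
  move=> /H[cf hf]; split => // i.
    by move=> x; have [df _ /(_ x)[]] := hf i.
  have [df sdf hdf] := hf i; rewrite (_ : partial i f = df)//.
  by apply/funext => x; rewrite /partial derive_val.
elim=> {f} [f sf|c|j|f g _ [cf hf] _ [cg hg]|f g sf [cf hf] sg [cg hg]|p f sf [cf hf]].
- split; first exact: (sf 0%N).
  move=> i; exists (partial i f).
    by apply: smooth_Ck => k; have [_ _] := sf k.+1; exact.
  by move=> x; have [_ + _] := sf 1%N => /(_ i x); exact: derivableP.
- split; first by move=> x; exact: cst_continuous.
  by move=> i; exists (fun=> 0); [exact: smooth_cst|move=> x; exact: is_derive_cst].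
- split; first exact: continuous_coord.
  move=> i; exists (fun=> (j == i)%:R); first exact: smooth_cst.
  by move=> x; exact: is_derive_coord.
- split; first by move=> x; exact: (continuousD (cf x) (cg x)).
  move=> i; have [df sdf hdf] := hf i; have [dg sdg hdg] := hg i.
  exists (fun x => df x + dg x); first exact: smoothD.
  by move=> x; exact: is_deriveD.
- split; first by move=> x; exact: (continuousM (cf x) (cg x)).
  move=> i; have [df sdf hdf] := hf i; have [dg sdg hdg] := hg i.
  exists (fun x => f x * dg x + g x * df x).
    by apply: smoothD; exact: smoothM.
  by move=> x; exact: is_deriveM.
- split.
    by move=> x; apply: (continuous_comp (cf x)); exact: continuous_flat.
  move=> i; have [df sdf hdf] := hf i.
  exists (fun x => flat (dflat p) (f x) * df x).
    by apply: smoothM => //; exact: smooth_flat.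
  by move=> x; exact: is_derive_flat_comp.
Qed.

Lemma smooth_all_Ck f : smooth f -> forall k, Ck k f.
Proof.
move=> sf k; elim: k f sf => [|k IH] f /smooth_partial[cf df pf] //.
by split => // i; exact: IH.
Qed.

Lemma smooth_prod (I : Type) (r : seq I) (F : I -> V -> R) :
  (forall i, smooth (F i)) -> smooth (fun x => \prod_(i <- r) F i x).
Proof.
move=> sF; elim: r => [|i r IH].
  by under eq_fun do rewrite big_nil; exact: smooth_cst.
by under eq_fun do rewrite big_cons; exact: smoothM.
Qed.

End smooth.

(** * A smooth ramp and smooth bumps *)

Section ramp.
Variable R : realType.

Lemma mean_value (f df : R -> R) : (forall x, is_derive x (1 : R) f (df x)) ->
  forall a b, exists c, f b - f a = df c * (b - a).
Proof.
move=> hf.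
have cf : continuous f.
  move=> t; apply: differentiable_continuous; apply/derivable1_diffP.
  by case: (hf t).
have H a b : a <= b -> exists c, f b - f a = df c * (b - a).
  move=> ab; have [|c _ ->] := @MVT_segment _ f df a b ab (fun x _ => hf x).
    exact: continuous_subspaceT.
  by exists c.
move=> a b; have [/H//|/ltW/H[c hc]] := leP a b.
by exists c; rewrite -opprB hc -mulrN opprB.
Qed.

(** A smooth substitute for the positive part, vanishing on the negative half
    line. *)
Definition ramp (t : R) : R := t * flat 1 t.

Definition dramp (t : R) : R := flat 1 t + t * flat (dflat 1) t.

Lemma flat1E (t : R) : flat 1 t = if 0 < t then expR (- t^-1) else 0.
Proof. by rewrite /flat hornerE mul1r. Qed.

Lemma flat1_ge0 (t : R) : 0 <= flat 1 t.
Proof. by rewrite flat1E; case: ifP => // _; exact: expR_ge0. Qed.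

Lemma flat1_le1 (t : R) : flat 1 t <= 1.
Proof.
rewrite flat1E; case: ifP => // t0.
by rewrite -[leRHS]expR0 ler_expR oppr_le0 invr_ge0 ltW.
Qed.

Lemma flat1_gt0 (t : R) : (0 < flat 1 t) = (0 < t).
Proof. by rewrite flat1E; case: ifP => t0; rewrite ?expR_gt0 ?ltxx. Qed.

Lemma flat1_eq0 (t : R) : t <= 0 -> flat 1 t = 0.
Proof. by move=> t0; rewrite flat1E ltNge t0. Qed.

Lemma is_derive_ramp (t : R) : is_derive t (1 : R) ramp (dramp t).
Proof.
have H1 := is_derive_flat 1 t.
have H := is_deriveM (is_derive_id t (1 : R)) H1.
apply: (is_derive_eq H).
by rewrite /dramp /GRing.scale /= mulr1 addrC.
Qed.

(** Since [1 + x <= exp x] at [x = 1 / t], the slope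
    [(1 + 1 / t) exp (- 1 / t)] of the ramp never exceeds [1]. *)
Lemma dramp_itv (t : R) : 0 <= dramp t <= 1.
Proof.
rewrite /dramp flat1E /flat; case: ifP => t0; last by rewrite mulr0 addr0 lexx ler01.
have ti0 : 0 < t^-1 by rewrite invr_gt0.
have -> : (dflat 1).[t^-1] = t^-1 ^+ 2.
  by rewrite /dflat -polyC1 derivC subr0 mulr1 !hornerE.
have -> : expR (- t^-1) + t * (t^-1 ^+ 2 * expR (- t^-1)) = (1 + t^-1) * expR (- t^-1).
  by rewrite mulrA expr2 mulrA mulfV ?gt_eqF// mul1r mulrDl mul1r.
apply/andP; split; first by rewrite mulr_ge0 ?expR_ge0// addr_ge0// ltW.
by rewrite expRN ler_pdivrMr ?expR_gt0// mul1r expR_ge1Dx.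
Qed.

Lemma ramp_ge0 (t : R) : 0 <= ramp t.
Proof.
rewrite /ramp; have [t0|t0] := leP t 0; first by rewrite flat1_eq0// mulr0.
by rewrite mulr_ge0 ?flat1_ge0// ltW.
Qed.

Lemma ramp_eq0 (t : R) : t <= 0 -> ramp t = 0.
Proof. by move=> t0; rewrite /ramp flat1_eq0// mulr0. Qed.

Lemma ramp_gt0 (t : R) : 0 < t -> 0 < ramp t.
Proof. by move=> t0; rewrite /ramp mulr_gt0// flat1_gt0. Qed.

(** For [t > 0] the defect is [t * (1 - exp (- 1 / t)) <= t * (1 / t)]. *)
Lemma ramp_ge (t : R) : t - 1 <= ramp t.
Proof.
have [t0|t0] := leP t 0; first by rewrite ramp_eq0//; lra.
rewrite /ramp flat1E t0 expRN.
have h : 1 - t^-1 <= (expR t^-1)^-1.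
  by rewrite -expRN; have := expR_ge1Dx (- t^-1).
have : t * (1 - t^-1) <= t * (expR t^-1)^-1 by rewrite ler_wpM2l// ltW.
by rewrite mulrBr mulr1 mulfV ?gt_eqF.
Qed.

(** The ramp of slope at most [1] that starts at [c], sharpened by [k]. *)
Definition sramp (k c t : R) : R := k^-1 * ramp (k * (t - c)).

Definition dsramp (k c t : R) : R := dramp (k * (t - c)).

Lemma is_derive_sramp (k c t : R) : k != 0 ->
  is_derive t (1 : R) (sramp k c) (dsramp k c t).
Proof.
move=> k0.
have H0 : is_derive t (1 : R) (fun t => k * (t - c)) k.
  have H := is_deriveZ k (is_deriveB (is_derive_id t (1 : R)) (is_derive_cst c t (1 : R))).
  by apply: (is_derive_eq H); rewrite subr0 [_ *: _]mulr1.
have H1 := @is_derive1_comp _ ramp _ _ _ _ (is_derive_ramp _) H0.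
have H := is_deriveZ k^-1 H1.
by apply: (is_derive_eq H); rewrite /GRing.scale /= mulrCA mulVf// mulr1.
Qed.

Lemma dsramp_itv (k c t : R) : 0 <= dsramp k c t <= 1.
Proof. exact: dramp_itv. Qed.

(** The normal contraction property: nondecreasing with slope at most [1]. *)
Lemma sramp_contract (k c a b : R) : k != 0 ->
  (sramp k c a - sramp k c b) ^+ 2 <= (a - b) * (sramp k c a - sramp k c b).
Proof.
move=> k0; have [d ->] := mean_value (fun t => is_derive_sramp c t k0) b a.
have /andP[d0 d1] := dsramp_itv k c d.
rewrite mulrCA -expr2 exprMn expr2; apply: ler_wpM2r; first exact: sqr_ge0.
by rewrite ler_piMr.
Qed.

Lemma sramp_lip (k c a b : R) : k != 0 ->
  `|sramp k c a - sramp k c b| <= `|a - b|.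
Proof.
move=> k0; have [d ->] := mean_value (fun t => is_derive_sramp c t k0) b a.
have /andP[d0 d1] := dsramp_itv k c d.
by rewrite normrM ger0_norm// ler_piMl.
Qed.

Lemma sramp_ge0 (k c t : R) : 0 < k -> 0 <= sramp k c t.
Proof. by move=> k0; rewrite mulr_ge0 ?ramp_ge0// invr_ge0 ltW. Qed.

Lemma sramp_eq0 (k c t : R) : 0 < k -> t <= c -> sramp k c t = 0.
Proof.
by move=> k0 tc; rewrite /sramp ramp_eq0 ?mulr0// pmulr_rle0// subr_le0.
Qed.

Lemma sramp_gt0 (k c t : R) : 0 < k -> c < t -> 0 < sramp k c t.
Proof.
by move=> k0 tc; rewrite mulr_gt0 ?invr_gt0// ramp_gt0// mulr_gt0// subr_gt0.
Qed.

Lemma sramp_ge (k c t : R) : 0 < k -> t - c - k^-1 <= sramp k c t.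
Proof.
move=> k0; rewrite /sramp -(ler_pM2l k0) [leRHS]mulrA mulfV ?gt_eqF// mul1r.
by rewrite mulrBr mulfV ?gt_eqF// ramp_ge.
Qed.

Lemma smooth_sramp n (k c : R) (f : 'rV[R]_n -> R) :
  smooth f -> smooth (fun x => sramp k c (f x)).
Proof.
move=> sf; rewrite /sramp /ramp.
have sk : smooth (fun x => k * (f x - c)).
  apply: smoothM; first exact: smooth_cst.
  by apply: smoothD => //; exact: smooth_cst.
apply: smoothM; first exact: smooth_cst.
by apply: smoothM => //; exact: smooth_flat.
Qed.

Lemma partial_comp n (i : 'I_n) (F dF : R -> R) (f : 'rV[R]_n -> R) (x : 'rV[R]_n) :
  (forall t, is_derive t (1 : R) F (dF t)) -> derivable f x (delta_mx 0 i) ->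
  partial i (F \o f) x = dF (f x) * partial i f x.
Proof.
move=> dFP /derivableP /is_derive_line h.
rewrite /partial; apply: derive_val; apply/is_derive_line.
apply: (@is_derive1_comp _ F) => //.
by rewrite scale0r addr0.
Qed.

End ramp.

Section boxbump.
Variables (R : realType) (n : nat).
Implicit Types a b x : 'rV[R]_n.

Definition boxbump (k : R) a b x : R :=
  \prod_(i < n) (flat 1 (k * (x 0 i - a 0 i)) * flat 1 (k * (b 0 i - x 0 i))).

Lemma smooth_boxbump k a b : smooth (boxbump k a b).
Proof.
apply: smooth_prod => i; apply: smoothM; apply: smooth_flat.
  apply: smoothM; first exact: smooth_cst.
  by apply: smoothD; [exact: smooth_coord|exact: smooth_cst].
apply: smoothM; first exact: smooth_cst.
apply: smoothD; first exact: smooth_cst.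
rewrite (_ : (fun x => - x 0 i) = (fun x => -1 * x 0 i)).
  by apply: smoothM; [exact: smooth_cst|exact: smooth_coord].
by apply/funext => x; rewrite mulN1r.
Qed.

Lemma boxbump_ge0 k a b x : 0 <= boxbump k a b x.
Proof. by apply: prodr_ge0 => i _; rewrite mulr_ge0 ?flat1_ge0. Qed.

Lemma boxbump_le1 k a b x : boxbump k a b x <= 1.
Proof.
apply: (@le_trans _ _ (\prod_(i < n) 1)); last by rewrite big1.
apply: ler_prod => i _.
by rewrite mulr_ge0 ?flat1_ge0//= mulr_ile1 ?flat1_ge0 ?flat1_le1.
Qed.

Lemma boxbump_gt0 k a b x : 0 < k -> obox a b x -> 0 < boxbump k a b x.
Proof.
move=> k0 xab; apply: prodr_gt0 => i _; have /andP[ax xb] := xab i.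
by rewrite mulr_gt0 // flat1_gt0 mulr_gt0 ?subr_gt0.
Qed.

Lemma boxbump_eq0 k a b x : 0 < k -> ~ obox a b x -> boxbump k a b x = 0.
Proof.
move=> k0 /existsNP[i /negP]; rewrite negb_and -!leNgt => h.
apply/eqP/prodf_eq0; exists i => //; rewrite mulf_eq0; apply/orP.
case/orP: h => h; [left|right]; apply/eqP/flat1_eq0;
  by rewrite pmulr_rle0// subr_le0.
Qed.

Lemma closed_cbox a b : closed (cbox a b).
Proof.
rewrite (_ : cbox a b = \bigcap_(i in [set: 'I_n])
   ((fun x => x 0 i) @^-1` `[a 0 i, b 0 i]%classic)).
  apply: closed_bigI => i _; apply: closed_comp => [x _|]; first exact: coord_continuous.
  exact: interval_closed.
by apply/seteqP; split => [x xab i _|x xab i]; [|have := xab i Logic.I];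
  rewrite /= in_itv/=; [exact: xab|].
Qed.

Lemma compact_cbox a b : compact (cbox a b).
Proof.
apply: bounded_closed_compact; last exact: closed_cbox.
exists (`|a| + `|b|); split; first by rewrite num_real.
move=> M hM x xab; apply: le_trans (ltW hM); apply: norm_rV_le => // i.
have /andP[h1 h2] := xab i.
have := ler_coord a i; have := ler_coord b i.
rewrite !ler_norml => /andP[b1 b2] /andP[a1 a2].
by apply/andP; split; lra.
Qed.

Lemma test_function_boxbump (Omega : set 'rV[R]_n) k a b : 0 < k ->
  cbox a b `<=` Omega -> test_function Omega (boxbump k a b).
Proof.
move=> k0 abO.
have sub : closure [set x | boxbump k a b x != 0] `<=` cbox a b.
  rewrite [X in _ `<=` X]((closure_id _).1 (@closed_cbox a b)).
  apply: closure_subset => x /= xn0 i.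
  have : obox a b x by apply: contrapT => /(boxbump_eq0 k0)/eqP; rewrite (negbTE xn0).
  by move=> /(_ i)/andP[/ltW -> /ltW ->].
split; first exact: (smooth_all_Ck (smooth_boxbump k a b)).
  apply: subclosed_compact (@compact_cbox a b) sub.
  exact: closed_closure.
exact: subset_trans sub abO.
Qed.

(** Each factor is [exp (- 1 / (k * t))] with [t > 0] inside the box. *)
Lemma cvg_boxbump a b x : boxbump m.+1%:R a b x @[m --> \oo] --> (\1_(obox a b) x : R).
Proof.
rewrite indicE; have [xab|xab] := boolP (x \in obox a b); last first.
  rewrite notin_setE in xab.
  rewrite (_ : (fun m : nat => _) = cst 0); first exact: cvg_cst.
  by apply/funext => m; rewrite boxbump_eq0.
rewrite inE in xab.
have one (t : R) : 0 < t -> flat 1 (m.+1%:R * t) @[m --> \oo] --> (1 : R).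
  move=> t0.
  rewrite (_ : (fun m : nat => _) = (fun m : nat => expR (- (m.+1%:R^-1 * t^-1)))); last first.
    by apply/funext => m; rewrite flat1E mulr_gt0// invfM.
  rewrite -[X in _ --> X]expR0; apply: continuous_cvg; first exact: continuous_expR.
  rewrite -[X in _ --> X]oppr0; apply: cvgN; rewrite -[X in _ --> X](mul0r t^-1).
  by apply: cvgM; [exact: cvg_harmonic|exact: cvg_cst].
rewrite (_ : true%:R = \prod_(i < n) (1 * 1) :> R); last by rewrite big1// => i _; rewrite mulr1.
rewrite /boxbump; elim: (index_enum _) => [|i r IH].
  by under eq_fun do rewrite big_nil; rewrite big_nil; exact: cvg_cst.
under eq_fun do rewrite big_cons; rewrite big_cons; apply: cvgM => //.
have /andP[ax xb] := xab i.
by apply: cvgM; apply: one; rewrite subr_gt0.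
Qed.

End boxbump.

(** * Real sequences and powers *)

Section sequences.
Variable R : realType.
Implicit Types (u v : nat -> R) (l c : R).

Lemma cvg_cst_eq u (a l : R) :
  (forall m, u m = a) -> u m @[m --> \oo] --> l -> l = a.
Proof.
move=> ua; rewrite (_ : u = fun=> a); last exact/funext.
by move=> /(cvg_lim (@Rhausdorff R)) <-; exact: lim_cst.
Qed.

Lemma cvgM0 c u : u k @[k --> \oo] --> (0 : R) -> c * u k @[k --> \oo] --> (0 : R).
Proof. by move=> u0; rewrite -(mulr0 c); apply: cvgM => //; exact: cvg_cst. Qed.

Lemma cvgD0 u v : u k @[k --> \oo] --> (0 : R) -> v k @[k --> \oo] --> (0 : R) ->
  u k + v k @[k --> \oo] --> (0 : R).
Proof. by move=> u0 v0; rewrite -[X in _ --> X]addr0; exact: cvgD. Qed.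

Lemma cvgDl0 c u : u k @[k --> \oo] --> (0 : R) -> c + u k @[k --> \oo] --> c.
Proof. by move=> u0; rewrite -[X in _ --> X]addr0; apply: cvgD => //; exact: cvg_cst. Qed.

Lemma cvg_sqr u l : u k @[k --> \oo] --> l -> u k ^+ 2 @[k --> \oo] --> l ^+ 2.
Proof. by move=> ul; rewrite expr2; under eq_fun do rewrite expr2; exact: cvgM. Qed.

Lemma cvg_harmonicMr c : k.+1%:R^-1 * c @[k --> \oo] --> (0 : R).
Proof. by under eq_fun do rewrite mulrC; exact: cvgM0 (@cvg_harmonic R). Qed.

Lemma cvg_sum n (u_ : 'I_n -> nat -> R) (l_ : 'I_n -> R) :
  (forall i, u_ i k @[k --> \oo] --> l_ i) ->
  \sum_(i < n) u_ i k @[k --> \oo] --> \sum_(i < n) l_ i.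
Proof. by move=> ul; apply: cvg_big => //; exact: add_continuous. Qed.

Lemma cvg_sum0 n (u_ : 'I_n -> nat -> R) : (forall i, u_ i k @[k --> \oo] --> (0 : R)) ->
  \sum_(i < n) u_ i k @[k --> \oo] --> (0 : R).
Proof. by move=> /cvg_sum; rewrite big1. Qed.

Lemma cvg_subseq (T : topologicalType) (x_ : nat -> T) (x : T) (phi : nat -> nat) :
  (forall k, (k <= phi k)%N) -> x_ k @[k --> \oo] --> x ->
  x_ (phi k) @[k --> \oo] --> x.
Proof.
move=> hphi c A /c[m _ hm]; exists m => // k /= mk; apply: hm.
exact: leq_trans mk (hphi k).
Qed.

Lemma squeeze0 u v : (forall k, 0 <= u k <= v k) ->
  v k @[k --> \oo] --> (0 : R) -> u k @[k --> \oo] --> (0 : R).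
Proof.
move=> uv v0; apply: (squeeze_cvgr _ (cvg_cst 0) v0).
by apply: nearW => k; exact: uv.
Qed.

Lemma cvg0_eps u : (forall k, 0 <= u k) ->
  u k @[k --> \oo] --> (0 : R) <->
  forall e : R, 0 < e -> exists m, forall k, (m <= k)%N -> u k < e.
Proof.
move=> u0; split => [c e e0|H].
  have /cvgr0Pnorm_lt/(_ _ e0)[m _ hm] := c.
  by exists m => k mk; have := hm k mk; rewrite ger0_norm.
apply/cvgr0Pnorm_lt => e e0; have [m hm] := H e e0.
by exists m => // k /= mk; rewrite ger0_norm// hm.
Qed.

Lemma dist_cvg (r_ x_ : nat -> R) l : (forall k, `|x_ k - l| <= r_ k) ->
  r_ k @[k --> \oo] --> (0 : R) -> x_ k @[k --> \oo] --> l.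
Proof.
move=> xr c; apply/subr_cvg0; apply/cvgr0Pnorm_le => e e0.
have /cvgr0Pnorm_lt/(_ _ e0) := c; apply: filterS => k /ltW.
by apply: le_trans; apply: le_trans (xr k) (ler_norm _).
Qed.

Lemma powRV_le (p x y : R) : 0 <= p -> 0 < x -> x <= y ->
  (y `^ p)^-1 <= (x `^ p)^-1.
Proof.
move=> p0 x0 xy; have y0 := lt_le_trans x0 xy.
rewrite lef_pV2 ?posrE ?powR_gt0//.
by apply: (ge0_ler_powR p0); rewrite ?nnegrE ?(ltW x0) ?(ltW y0).
Qed.

End sequences.

(** * Symmetric forms *)

(** The polarisation of a form at a difference, that is, a squared distance. *)
Notation dist2 B u v := (B (fun x => u x - v x) (fun x => u x - v x)).

Section forms.
Variables (T : Type) (R : realType).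
Implicit Types (P : (T -> R) -> Prop) (B : (T -> R) -> (T -> R) -> R).

(** Members of [H01] are plain functions, so a symmetric nonnegative bilinear form
    is a functional on functions with a domain [P] closed under combinations
    [u + c * v]. *)
Definition is_form P B := [/\
  forall u v c, P u -> P v -> P (fun x => u x + c * v x),
  forall u v, B u v = B v u,
  forall u v w c, P u -> P v -> P w ->
    B (fun x => u x + c * v x) w = B u w + c * B v w &
  forall u, P u -> 0 <= B u u].

Variables (P : (T -> R) -> Prop) (B : (T -> R) -> (T -> R) -> R).
Hypothesis hB : is_form P B.
Implicit Types (u v w : T -> R).

Let subE u v : (fun x => u x - v x) = (fun x => u x + (-1) * v x).
Proof. by apply/funext => x; rewrite mulN1r. Qed.

Lemma form_sub u v : P u -> P v -> P (fun x => u x - v x).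
Proof. by move=> Pu Pv; rewrite subE; have [h _ _ _] := hB; exact: h. Qed.

Lemma form_sym u v : B u v = B v u.
Proof. by have [_ h _ _] := hB. Qed.

Lemma form_ge0 u : P u -> 0 <= B u u.
Proof. by have [_ _ _ h] := hB; exact: h. Qed.

Lemma form_linl u v w c : P u -> P v -> P w ->
  B (fun x => u x + c * v x) w = B u w + c * B v w.
Proof. by have [_ _ h _] := hB; exact: h. Qed.

Lemma form_zerol u : P u -> B (fun=> 0) u = 0.
Proof.
move=> Pu; have -> : (fun=> 0) = (fun x => u x - u x) by apply/funext => x; rewrite subrr.
by rewrite subE form_linl// mulN1r subrr.
Qed.

Lemma form_lin2 u v c : P u -> P v ->
  B (fun x => u x + c * v x) (fun x => u x + c * v x) =
  B u u + 2 * c * B u v + c ^+ 2 * B v v.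
Proof.
move=> Pu Pv; have [h _ _ _] := hB; have Puv := h u v c Pu Pv.
rewrite form_linl// ![B _ (fun x => u x + c * v x)]form_sym !form_linl//.
by rewrite [B v u]form_sym; ring.
Qed.

Lemma form_subl u v w : P u -> P v -> P w -> B (fun x => u x - v x) w = B u w - B v w.
Proof. by move=> Pu Pv Pw; rewrite subE form_linl// mulN1r. Qed.

Lemma form_sub2 u v : P u -> P v ->
  dist2 B u v = B u u - 2 * B u v + B v v.
Proof. by move=> Pu Pv; rewrite subE form_lin2//; ring. Qed.

Lemma form_sub_swap u v : P u -> P v ->
  dist2 B u v = dist2 B v u.
Proof. by move=> Pu Pv; rewrite !form_sub2// [B v u]form_sym; ring. Qed.

(** Nonnegativity at [u + v / t] and [u - v / t]; this replaces the Cauchy-Schwarz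
    inequality and avoids square roots. *)
Lemma form_young u v (t : R) : 0 < t -> P u -> P v ->
  2 * `|B u v| <= t * B u u + t^-1 * B v v.
Proof.
move=> t0 Pu Pv; have [h _ _ _] := hB.
have H c : 0 <= t * B u u + 2 * c * B u v + c ^+ 2 * (t^-1 * B v v).
  have := form_ge0 (h u v (c / t) Pu Pv); rewrite form_lin2// => H.
  have := mulr_ge0 (ltW t0) H; congr (_ <= _); field; exact: lt0r_neq0.
have := H 1; have := H (-1); rewrite expr1n sqrrN expr1n.
by case: (ger0P (B u v)) => _; lra.
Qed.

Lemma form_lin_le u v c : P u -> P v ->
  B (fun x => u x + c * v x) (fun x => u x + c * v x) <= 2 * B u u + 2 * (c ^+ 2 * B v v).
Proof.
move=> Pu Pv; have [h _ _ _] := hB; have := form_ge0 (h u v (- c) Pu Pv).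
by rewrite !form_lin2// sqrrN; lra.
Qed.

Lemma form_triangle u v w : P u -> P v -> P w ->
  dist2 B u w <=
  2 * dist2 B u v +
  2 * dist2 B v w.
Proof.
move=> Pu Pv Pw; have Puv := form_sub Pu Pv; have Pvw := form_sub Pv Pw.
have -> : (fun x => u x - w x) = (fun x => (u x - v x) + 1 * (v x - w x)).
  by apply/funext => x; rewrite mul1r addrA subrK.
by have := form_lin_le 1 Puv Pvw; rewrite expr1n mul1r.
Qed.

Lemma form_cvg (u_ : nat -> T -> R) u v : (forall k, P (u_ k)) -> P u -> P v ->
  dist2 B (u_ k) u @[k --> \oo] --> (0 : R) ->
  B (u_ k) v @[k --> \oo] --> B u v.
Proof.
move=> Pu_ Pu Pv c; apply/cvgrPdist_lt => e e0.
have B0 := form_ge0 Pv.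
(* With this weight in Young's inequality the share of [v] is less than [e],
   and the share of the difference tends to [0]. *)
have t0 : 0 < (B v v + 1) / e by rewrite divr_gt0// ltr_wpDl.
have u0 : 0 < e / ((B v v + 1) / e) by rewrite divr_gt0.
have [m hm] := (cvg0_eps (fun k => form_ge0 (form_sub (Pu_ k) Pu))).1 c _ u0.
exists m => // k mk /=.
rewrite distrC -form_subl//.
have := form_young t0 (form_sub (Pu_ k) Pu) Pv => H.
have := hm k mk; rewrite -(ltr_pM2l t0) [ltRHS]mulrCA mulfV ?gt_eqF// mulr1 => H2.
have H3 : ((B v v + 1) / e)^-1 * B v v < e.
  rewrite invf_div mulrAC ltr_pdivrMr ?ltr_wpDl//.
  by rewrite ltr_pM2l// ltrDl.
by lra.
Qed.

Lemma form_cvg2 (u_ : nat -> T -> R) u : (forall k, P (u_ k)) -> P u ->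
  dist2 B (u_ k) u @[k --> \oo] --> (0 : R) ->
  B (u_ k) (u_ k) @[k --> \oo] --> B u u.
Proof.
move=> Pu_ Pu c.
have E k : B (u_ k) (u_ k) = dist2 B (u_ k) u + 2 * (B (u_ k) u - B u u) + B u u.
  by rewrite form_sub2//; ring.
rewrite (funext E) -[X in _ --> X]add0r; apply: cvgD; last exact: cvg_cst.
apply: cvgD0 => //; apply: cvgM0; apply/subr_cvg0; exact: form_cvg.
Qed.

Lemma form_cvg_lin (u_ v_ : nat -> T -> R) u v c :
  (forall k, P (u_ k)) -> (forall k, P (v_ k)) -> P u -> P v ->
  dist2 B (u_ k) u @[k --> \oo] --> (0 : R) ->
  dist2 B (v_ k) v @[k --> \oo] --> (0 : R) ->
  let w k x := u_ k x + c * v_ k x - (u x + c * v x) in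
  B (w k) (w k) @[k --> \oo] --> (0 : R).
Proof.
move=> Pu_ Pv_ Pu Pv cu cv w.
have wE k : w k = (fun x => (u_ k x - u x) + c * (v_ k x - v x)).
  by apply/funext => x; rewrite /w; ring.
have Puk k := form_sub (Pu_ k) Pu; have Pvk k := form_sub (Pv_ k) Pv.
have [h _ _ _] := hB.
apply: squeeze0 (cvgD0 (cvgM0 2 cu) (cvgM0 2 (cvgM0 (c ^+ 2) cv))) => k.
by rewrite wE form_ge0 ?form_lin_le//; exact: h.
Qed.

End forms.

(** * Square-integrable functions *)

Section square_integrable.
Context d (T : measurableType d) (R : realType).
Variables (mu : {measure set T -> \bar R}) (D : set T).
Hypothesis mD : measurable D.
Implicit Types f g h : T -> R.

Definition sqint f := measurable_fun D f /\ mu.-integrable D (fun x => (f x ^+ 2)%:E).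

Definition ip f g : R := \int[mu]_(x in D) (f x * g x).

Definition nrm2 f : R := \int[mu]_(x in D) (f x ^+ 2).

Lemma integrable_mfun f : mu.-integrable D (EFin \o f) -> measurable_fun D f.
Proof. by move=> /measurable_int /measurable_EFinP. Qed.

Lemma integrable_dom f g : measurable_fun D f ->
  (forall x, D x -> `|f x| <= g x) -> mu.-integrable D (EFin \o g) ->
  mu.-integrable D (EFin \o f).
Proof.
move=> mf fg; apply: le_integrable => //; first exact/measurable_EFinP.
by move=> x Dx /=; rewrite lee_fin (le_trans (fg x Dx))// ler_norm.
Qed.

Lemma integral_Rintegral f : mu.-integrable D (EFin \o f) ->
  (\int[mu]_(x in D) (f x)%:E = (\int[mu]_(x in D) f x)%:E)%E.
Proof. by move=> fi; rewrite fineK//; exact: integrable_fin_num. Qed.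

Lemma integrable_indicZ (A : set T) (K : R) : measurable A -> (mu A < +oo)%E ->
  mu.-integrable D (EFin \o (fun x => K * \1_A x)).
Proof.
move=> mA Afin; have h : mu.-integrable D (fun x => (\1_A x)%:E).
  apply/integrableP; split; first exact/measurable_EFinP/measurable_indic.
  under eq_integral do rewrite gee0_abs ?lee_fin//.
  rewrite integral_indic//; apply: le_lt_trans Afin.
  by apply: le_measure; rewrite ?inE//; exact: measurableI.
exact: (integrableZl mD K h).
Qed.

Lemma Rintegral0 : \int[mu]_(x in D) 0 = 0 :> R.
Proof. by rewrite /Rintegral integral0. Qed.

Lemma Rintegral_sum (I : Type) (r : seq I) (F : I -> T -> R) :
  (forall i, mu.-integrable D (EFin \o F i)) ->
  mu.-integrable D (EFin \o (fun x => \sum_(i <- r) F i x)) /\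
  \int[mu]_(x in D) (\sum_(i <- r) F i x) = \sum_(i <- r) \int[mu]_(x in D) F i x.
Proof.
move=> iF; elim: r => [|i r [IH1 IH2]].
  rewrite big_nil; under eq_Rintegral do rewrite big_nil.
  split; last exact: Rintegral0.
  apply: eq_integrable (integrable0 mu D) => // x _.
  by rewrite /= big_nil.
rewrite big_cons -IH2 -RintegralD//; split; last first.
  by apply: eq_Rintegral => x _; rewrite big_cons.
by apply: eq_integrable (integrableD mD (iF i) IH1) => // x _; rewrite /= big_cons.
Qed.

Lemma dominated_Rintegral_ae (f_ : nat -> T -> R) f g :
  (forall m, measurable_fun D (f_ m)) -> measurable_fun D f ->
  {ae mu, forall x, D x -> f_ m x @[m --> \oo] --> f x} ->
  mu.-integrable D (EFin \o g) ->
  {ae mu, forall x, D x -> forall m, `|f_ m x| <= g x} ->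
  mu.-integrable D (EFin \o f) /\
  \int[mu]_(x in D) f_ m x @[m --> \oo] --> \int[mu]_(x in D) f x.
Proof.
move=> mf_ mf cf gi fg.
have [] := @dominated_convergence _ _ _ mu D mD (fun m x => (f_ m x)%:E)
  (EFin \o f) (EFin \o g).
- by move=> m; exact/measurable_EFinP.
- exact/measurable_EFinP.
- apply: filterS cf => x h Dx; apply: cvg_EFin; first exact: nearW.
  exact: h.
- exact: gi.
- by apply: filterS fg => x h m Dx; rewrite lee_fin h.
move=> fi _ c; split => //.
have e : (\int[mu]_(x in D) (EFin \o f) x = (\int[mu]_(x in D) f x)%:E)%E.
  exact: integral_Rintegral.
by rewrite e in c; exact: (fine_cvg c).
Qed.

Lemma dominated_Rintegral (f_ : nat -> T -> R) f g :
  (forall m, measurable_fun D (f_ m)) -> measurable_fun D f ->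
  {ae mu, forall x, D x -> f_ m x @[m --> \oo] --> f x} ->
  mu.-integrable D (EFin \o g) ->
  (forall m x, D x -> `|f_ m x| <= g x) ->
  mu.-integrable D (EFin \o f) /\
  \int[mu]_(x in D) f_ m x @[m --> \oo] --> \int[mu]_(x in D) f x.
Proof.
move=> mf_ mf cf gi fg; apply: dominated_Rintegral_ae gi _ => //.
by apply: aeW => x Dx m; exact: fg.
Qed.

Lemma sqintM f g : sqint f -> sqint g ->
  mu.-integrable D (EFin \o (fun x => f x * g x)).
Proof.
move=> [mf fi] [mg gi].
apply: (@integrable_dom _ (fun x => f x ^+ 2 + g x ^+ 2)).
- exact: measurable_funM.
- move=> x _; rewrite normrM.
  rewrite -(real_normK (num_real (f x))) -(real_normK (num_real (g x))).
  by have := sqr_ge0 (`|f x| - `|g x|); have := sqr_ge0 (`|f x| + `|g x|); nra.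
- exact: (integrableD mD fi gi).
Qed.

Lemma sqintD f g : sqint f -> sqint g -> sqint (fun x => f x + g x).
Proof.
move=> sf sg; have [mf fi] := sf; have [mg gi] := sg; split.
  exact: measurable_funD.
have fg := sqintM sf sg.
have -> : (fun x => ((f x + g x) ^+ 2)%:E) =
   ((fun x => (f x ^+ 2)%:E + (2%:E * (f x * g x)%:E) + (g x ^+ 2)%:E))%E.
  by apply/funext => x; rewrite -EFinM -!EFinD; congr (_%:E); ring.
apply: (integrableD mD (integrableD mD fi _) gi).
exact: (integrableZl mD 2 fg).
Qed.

Lemma sqintZ c f : sqint f -> sqint (fun x => c * f x).
Proof.
move=> [mf fi]; split; first exact: measurable_funM.
rewrite (_ : (fun x => _) = (fun x => (c ^+ 2)%:E * (f x ^+ 2)%:E)%E).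
  exact: integrableZl.
by apply/funext => x; rewrite exprMn EFinM.
Qed.

Lemma sqintB f g : sqint f -> sqint g -> sqint (fun x => f x - g x).
Proof.
move=> sf sg; rewrite (_ : (fun x => _) = (fun x => f x + (-1) * g x)).
  by apply: sqintD => //; exact: sqintZ.
by apply/funext => x; rewrite mulN1r.
Qed.

Lemma sqint_bound f g : measurable_fun D f -> sqint g ->
  (forall x, D x -> `|f x| <= `|g x|) -> sqint f.
Proof.
move=> mf [mg gi] fg; split => //.
apply: (@integrable_dom (fun x => f x ^+ 2) (fun x => g x ^+ 2)) => //.
  exact: measurable_funX.
move=> x Dx; rewrite normrX -[leRHS](real_normK (num_real (g x))).
by rewrite lerXn2r ?nnegrE// fg.
Qed.

Lemma ipC f g : ip f g = ip g f.
Proof. by apply: eq_Rintegral => x _; rewrite mulrC. Qed.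

Lemma nrm2_ge0 f : 0 <= nrm2 f.
Proof. by apply: Rintegral_ge0 => x _; exact: sqr_ge0. Qed.

Lemma ip_form : is_form sqint ip.
Proof.
split => [f g c sf sg|||f sf]; [|exact: ipC| |exact: nrm2_ge0].
  by apply: sqintD => //; exact: sqintZ.
move=> f g h c sf sg sh; rewrite /ip -RintegralZl//; last exact: sqintM.
rewrite -RintegralD//; try exact: sqintM.
  by apply: eq_Rintegral => x _; rewrite mulrDl mulrA.
exact: (integrableZl mD c (sqintM sg sh)).
Qed.

Lemma nrm2Z c f : sqint f -> nrm2 (fun x => c * f x) = c ^+ 2 * nrm2 f.
Proof.
move=> [mf fi]; rewrite /nrm2 -RintegralZl//.
by apply: eq_Rintegral => x _; rewrite exprMn.
Qed.

Lemma nrm2_sub f g : nrm2 (fun x => f x - g x) = nrm2 (fun x => g x - f x).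
Proof. by apply: eq_Rintegral => x _; rewrite -sqrrN opprB. Qed.

Lemma nrm2_le f g : sqint f -> sqint g ->
  (forall x, D x -> `|f x| <= `|g x|) -> nrm2 f <= nrm2 g.
Proof.
move=> [mf fi] [mg gi] fg; apply: le_Rintegral => // x Dx.
rewrite -[leLHS](real_normK (num_real (f x))) -[leRHS](real_normK (num_real (g x))).
by rewrite lerXn2r ?nnegrE// fg.
Qed.

Lemma Rintegral_le0_ae f : mu.-integrable D (EFin \o f) ->
  (forall x, D x -> 0 <= f x) -> \int[mu]_(x in D) f x <= 0 ->
  {ae mu, forall x, D x -> f x = 0}.
Proof.
move=> fi f0 I0; have mf := measurable_int _ fi.
have : (\int[mu]_(x in D) `|(EFin \o f) x| = 0)%E.
  rewrite (eq_integral (EFin \o f)); last first.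
    by move=> x; rewrite inE => Dx /=; rewrite ger0_norm ?f0.
  rewrite (integral_Rintegral fi); congr (_%:E); apply/le_anti; rewrite I0 andTb.
  exact: Rintegral_ge0.
move=> /(ae_eq_integral_abs mu mD mf); apply: filterS => x h Dx.
by have := h Dx => -[].
Qed.

Lemma nrm2_le0_ae f : sqint f -> nrm2 f <= 0 -> {ae mu, forall x, D x -> f x = 0}.
Proof.
move=> [_ fi] /(Rintegral_le0_ae fi (fun x _ => sqr_ge0 _)); apply: filterS => x h Dx.
by apply/eqP; rewrite -sqrf_eq0 h.
Qed.

(** The bounds may depend on the index as long as they converge: an estimate
    by the energies of approximations passes to the energy of the limit. *)
Lemma fatou_le (g_ : nat -> T -> R) (g : T -> R)
    (c_ : nat -> R) (C : R) :
  (forall k, measurable_fun D (g_ k)) -> measurable_fun D g ->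
  (forall k x, D x -> 0 <= g_ k x) -> (forall x, D x -> 0 <= g x) ->
  {ae mu, forall x, D x -> g_ k x @[k --> \oo] --> g x} ->
  (forall k, (\int[mu]_(x in D) (g_ k x)%:E <= (c_ k)%:E)%E) ->
  c_ k @[k --> \oo] --> C ->
  (\int[mu]_(x in D) (g x)%:E <= C%:E)%E.
Proof.
move=> mg_ mg g_0 g0 [N [mN N0 subN]] gC cC.
have mDN : measurable (D `\` N) by exact: measurableD.
have DND : D `\` N `<=` D by exact: subDsetl.
have mg' : measurable_fun D (EFin \o g) by exact/measurable_EFinP.
rewrite (ge0_negligible_integral mN mD mg')//.
have mgk k : measurable_fun (D `\` N) (EFin \o g_ k).
  by apply: measurable_funS (mD) DND _; exact/measurable_EFinP.
have := fatou mu mDN mgk.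
have h0 : (forall (n : nat) (x : T), (D `\` N) x -> (0%R <= (EFin \o g_ n) x)%E).
  by move=> k x [Dx _] /=; rewrite lee_fin g_0.
move=> /(_ h0) h.
rewrite (eq_integral (fun x => limn_einf (fun n => (EFin \o g_ n) x))); last first.
  move=> x; rewrite inE => -[Dx Nx].
  have cx : g_ k x @[k --> \oo] --> g x.
    by apply: contrapT => cx; apply: Nx; apply: subN => /= /(_ Dx).
  have /cvg_limn_einf_sup[-> _] // : (EFin \o g_ k) x @[k --> \oo] --> (g x)%:E.
  exact: cvg_comp cx _.
apply: le_trans h _; rewrite limn_einf_lim.
have cC' : (c_ k)%:E @[k --> \oo] --> C%:E by exact: cvg_comp cC _.
rewrite -(cvg_lim _ cC')//; apply: lee_lim; [exact: is_cvg_einfs|by apply/cvg_ex; eexists; exact: cC'|].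
apply: nearW => k; apply: le_trans (gC k).
apply: ereal_inf_le; exists (\int[mu]_(x in D `\` N) (g_ k x)%:E)%E.
  by exists k => //=.
rewrite -(ge0_negligible_integral mN mD)//.
- exact/measurable_EFinP.
- by move=> x Dx; rewrite lee_fin g_0.
Qed.

Lemma bounded_integrable f (C : R) : measurable_fun D f ->
  (forall x, D x -> 0 <= f x) -> (\int[mu]_(x in D) (f x)%:E <= C%:E)%E ->
  mu.-integrable D (EFin \o f) /\ \int[mu]_(x in D) f x <= C.
Proof.
move=> mf f0 fC.
have fi : mu.-integrable D (EFin \o f).
  apply/integrableP; split; first exact/measurable_EFinP.
  under eq_integral => x do [rewrite inE => Dx; rewrite gee0_abs ?lee_fin ?f0//].
  exact: le_lt_trans fC (ltry _).
by split => //; rewrite -lee_fin -integral_Rintegral.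
Qed.

Lemma fatou_sqint (f_ : nat -> T -> R) f (c_ : nat -> R) (C : R) :
  (forall k, sqint (f_ k)) -> measurable_fun D f ->
  {ae mu, forall x, D x -> f_ k x @[k --> \oo] --> f x} ->
  (forall k, nrm2 (f_ k) <= c_ k) -> c_ k @[k --> \oo] --> C ->
  sqint f /\ nrm2 f <= C.
Proof.
move=> sf_ mf cf fC cC.
have mf2 : measurable_fun D (fun x => f x ^+ 2) by exact: measurable_funX.
have h : (\int[mu]_(x in D) (f x ^+ 2)%:E <= C%:E)%E.
  apply: (@fatou_le (fun k x => f_ k x ^+ 2) _ c_) cC => //.
  - by move=> k; have [mk _] := sf_ k; exact: measurable_funX.
  - by move=> *; exact: sqr_ge0.
  - by move=> *; exact: sqr_ge0.
  - by apply: filterS cf => x cf Dx; apply: cvg_sqr; exact: cf.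
  - by move=> k; rewrite (integral_Rintegral (sf_ k).2) lee_fin; exact: fC.
have [fi fle] := bounded_integrable mf2 (fun x _ => sqr_ge0 _) h.
by split; [split|].
Qed.

(** Summability of the weighted norms makes the pointwise series finite almost
    everywhere, hence forces a geometric decay. *)
Lemma fast_ae (g : nat -> T -> R) : (forall k, sqint (g k)) ->
  (forall k, 4 ^+ k * nrm2 (g k) <= (2 ^+ k.+1)^-1) ->
  {ae mu, forall x, D x -> exists C : R, forall k, `|g k x| <= C * (2 ^+ k)^-1}.
Proof.
move=> sg gk.
(* A bound on [4 ^ k * g_k ^ 2] is a bound of order [2 ^ - k] on [g_k]. *)
pose h k x := ((4 ^+ k * g k x ^+ 2)%:E : \bar R).
have mh k : measurable_fun D (h k).
  have [mk _] := sg k; apply/measurable_EFinP; apply: measurable_funM => //.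
  exact: measurable_funX.
have h0 k x : D x -> (0 <= h k x)%E.
  by move=> _; rewrite /h lee_fin; apply: mulr_ge0; [exact: exprn_ge0|exact: sqr_ge0].
have hi : (\int[mu]_(x in D) (\sum_(0 <= k <oo) h k x) <= 1%:E)%E.
  rewrite integral_nneseries//.
  apply: (@le_trans _ _ (\sum_(0 <= k <oo) ((1 / (2 ^ (k + 1))%:R)%:E : \bar R))%E).
    apply: lee_nneseries => [k _ _|k _]; first by apply: integral_ge0 => x Dx; exact: h0.
    rewrite /h; have [mk ik] := sg k.
    rewrite (@integral_Rintegral (fun x => 4 ^+ k * g k x ^+ 2)); last exact: (integrableZl mD (4 ^+ k) ik).
    by rewrite lee_fin RintegralZl// div1r natrX addn1; exact: gk.
  have := @cvg_geometric_eseries_half R 1 0; rewrite expr0 divr1 => c.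
  by rewrite (cvg_lim _ c).
have S0 x : D x -> (0 <= \sum_(0 <= k <oo) h k x)%E.
  by move=> Dx; apply: nneseries_ge0 => k _ _; exact: h0.
have mS : measurable_fun D (fun x => \sum_(0 <= k <oo) h k x)%E.
  apply: (@ge0_emeasurable_sum _ _ _ D h xpredT) => // k x Dx _; exact: h0.
have iS : mu.-integrable D (fun x => \sum_(0 <= k <oo) h k x)%E.
  apply/integrableP; split => //.
  under eq_integral => x do [rewrite inE => Dx; rewrite gee0_abs ?S0//].
  exact: le_lt_trans hi (ltry _).
have := integrable_ae mD iS; apply: filterS => x fx Dx.
have {}fx := fx Dx.
pose S := fine (\sum_(0 <= k <oo) h k x)%E.
exists (S + 1) => k.
have hk : 4 ^+ k * g k x ^+ 2 <= S.
  rewrite -lee_fin fineK//.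
  have := @nneseries_lim_ge R (fun k => h k x) xpredT 0 k.+1.
  move=> /(_ (fun j _ _ => h0 j x Dx)); apply: le_trans.
  rewrite big_nat_recr//= leeDr//.
  by apply: sume_ge0 => j _; exact: h0.
have S0' : 0 <= S by apply: fine_ge0; exact: S0.
rewrite ler_pdivlMr ?exprn_gt0//.
rewrite -(ler_pXn2r (n := 2))// ?nnegrE ?mulr_ge0 ?exprn_ge0 ?addr_ge0//.
rewrite exprMn real_normK ?num_real//.
have -> : (2 ^+ k) ^+ 2 = 4 ^+ k :> R by rewrite -exprM mulnC exprM; congr (_ ^+ _); ring.
by rewrite mulrC; apply: le_trans hk _; nra.
Qed.

End square_integrable.

Section completeness.
Context d (T : measurableType d) (R : realType).
Variables (mu : {measure set T -> \bar R}) (D : set T).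
Hypothesis mD : measurable D.
Implicit Types f g h : T -> R.
Local Notation sqint := (sqint mu D).
Local Notation nrm2 := (nrm2 mu D).

(** [P k m] will express that from the index [m] on the error is below
    a rate summable in [k]. *)
Lemma fast_subseq (P : nat -> nat -> Prop) :
  (forall k, exists m0, forall m, (m0 <= m)%N -> P k m) ->
  exists2 phi : nat -> nat, (forall k, (phi k < phi k.+1)%N) &
    forall k m, (phi k <= m)%N -> P k m.
Proof.
move=> /choice[m0 hm0].
pose phi := fix phi k := if k is k'.+1 then maxn (m0 k) (phi k').+1 else m0 0%N.
exists phi => [k|k m km]; first by rewrite /= leq_max leqnn orbT.
apply: hm0; apply: leq_trans km.
by case: k => //= k; exact: leq_maxl.
Qed.

Lemma subseq_ge (phi : nat -> nat) : (forall k, (phi k < phi k.+1)%N) ->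
  forall k, (k <= phi k)%N.
Proof. by move=> h; elim=> // k IH; exact: leq_ltn_trans IH (h k). Qed.

Lemma nrm2_cvg_ae (f_ : nat -> T -> R) f :
  (forall k, sqint (f_ k)) -> sqint f ->
  nrm2 (fun x => f_ k x - f x) @[k --> \oo] --> (0 : R) ->
  exists2 phi : nat -> nat, (forall k, (k <= phi k)%N) &
    {ae mu, forall x, D x -> f_ (phi k) x @[k --> \oo] --> f x}.
Proof.
move=> sf_ sf cf.
have [|phi hphi rate] := @fast_subseq (fun k m => 4 ^+ k * nrm2 (fun x => f_ m x - f x) <= (2 ^+ k.+1)^-1).
  move=> k.
  have e0 : 0 < (4 ^+ k)^-1 * (2 ^+ k.+1)^-1 :> R by rewrite mulr_gt0 ?invr_gt0 ?exprn_gt0.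
  have [m0 hm0] := (cvg0_eps (fun k => nrm2_ge0 mu D _)).1 cf _ e0.
  exists m0 => m /hm0 /ltW.
  by rewrite ler_pdivlMl// exprn_gt0.
exists phi; first exact: subseq_ge.
have := fast_ae mD (fun k => sqintB mD (sf_ (phi k)) sf) (fun k => rate k _ (leqnn _)).
apply: filterS => x h Dx; have [C hC] := h Dx.
apply: dist_cvg hC _; apply: cvgM0.
by under eq_fun do rewrite -exprVn; apply: cvg_expr; rewrite ger0_norm ?invf_lt1 ?invr_ge0// ltr1n.
Qed.

(** The Riesz-Fischer argument. Along a fast subsequence the increments decay
    geometrically almost everywhere, so that the subsequence converges there;
    Fatou's lemma then turns the Cauchy bound into a bound on the distance to
    the limit. *)
Lemma nrm2_complete (f_ : nat -> T -> R) : (forall k, sqint (f_ k)) ->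
  (forall e : R, 0 < e -> exists m0, forall m n, (m0 <= m)%N -> (m0 <= n)%N ->
     nrm2 (fun x => f_ m x - f_ n x) < e) ->
  exists2 f, sqint f & nrm2 (fun x => f_ k x - f x) @[k --> \oo] --> (0 : R).
Proof.
move=> sf_ cau.
have [|phi hphi rate] := @fast_subseq (fun k m => forall n, (m <= n)%N -> 4 ^+ k * nrm2 (fun x => f_ n x - f_ m x) <= (2 ^+ k.+1)^-1).
  move=> k.
  have e0 : 0 < (4 ^+ k)^-1 * (2 ^+ k.+1)^-1 :> R by rewrite mulr_gt0 ?invr_gt0 ?exprn_gt0.
  have [m0 hm0] := cau _ e0.
  exists m0 => m mm0 n mn; have /ltW := hm0 n m (leq_trans mm0 mn) mm0.
  by rewrite ler_pdivlMl// exprn_gt0.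
have [N [mN N0 subN]] := fast_ae mD (fun k => sqintB mD (sf_ (phi k.+1)) (sf_ (phi k)))
   (fun k => rate k _ (leqnn _) _ (ltnW (hphi k))).
pose F k x := \1_(~` N) x * f_ (phi k) x.
have cF x : D x -> cvgn (F ^~ x).
  move=> Dx; rewrite /F indicE; have [xN|xN] := boolP (x \in ~` N); last first.
    by under eq_fun do rewrite mul0r; exact: is_cvg_cst.
  under eq_fun do rewrite mul1r; rewrite inE/= in xN.
  have [C hC] : exists C : R, forall k, `|f_ (phi k.+1) x - f_ (phi k) x| <= C * (2 ^+ k)^-1.
    apply: contrapT => cx; apply: xN; apply: subN => /=.
    by move=> /(_ Dx).
  have C0 : 0 <= C by have := hC 0%N; rewrite expr0 invr1 mulr1; apply: le_trans.
  have : cvgn (series (telescope (fun k => f_ (phi k) x))).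
    apply: normed_cvg; apply: (@series_le_cvg _ _ (geometric C 2^-1)).
    - by move=> k /=.
    - by move=> k; rewrite /= mulr_ge0// exprn_ge0// invr_ge0.
    - by move=> k; rewrite /= exprVn; exact: hC.
    - by apply: is_cvg_geometric_series; rewrite ger0_norm ?invf_lt1 ?invr_ge0// ltr1n.
  rewrite telescopeK => c.
  rewrite (_ : (fun k => f_ (phi k) x) = (fun k => (f_ (phi k) x - f_ (phi 0%N) x) + f_ (phi 0%N) x)).
    by apply: is_cvgD => //; exact: is_cvg_cst.
  by apply/funext => k; rewrite subrK.
have mF k : measurable_fun D (F k).
  apply: measurable_funM; last by have [] := sf_ (phi k).
  by apply: measurable_indic; exact: measurableC.
pose f x := limn (F ^~ x).
have mf : measurable_fun D f.
  by apply: (measurable_fun_cvg mF) => x Dx; exact: cF.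
have aeF : {ae mu, forall x, D x -> f_ (phi k) x @[k --> \oo] --> f x}.
  exists N; split => // x /= /not_implyP[Dx nc]; apply: contrapT => Nx; apply: nc.
  have := cF x Dx; rewrite -/(f x) /f /F indicE mem_set//.
  by under eq_fun do rewrite mul1r.
have lim2 n e : 0 < e -> (forall m, (n <= m)%N -> nrm2 (fun x => f_ n x - f_ m x) <= e) ->
    sqint (fun x => f_ n x - f x) /\ nrm2 (fun x => f_ n x - f x) <= e.
  move=> e0 he.
  apply: (@fatou_sqint _ _ _ mu D mD (fun k x => f_ n x - f_ (phi (n + k)%N) x) _ (fun=> e)); last exact: cvg_cst.
  - by move=> k; exact: sqintB.
  - by apply: measurable_funB => //; have [] := sf_ n.
  - apply: filterS aeF => x cx Dx; apply: cvgB; first exact: cvg_cst.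
    by have := cx Dx; rewrite -(cvg_shiftn n); under eq_fun do rewrite addnC.
  - by move=> k; apply: he; apply: leq_trans (subseq_ge hphi _); exact: leq_addr.
have sf : sqint f.
  have [m0 hm0] := cau 1 ltr01.
  have [|sB _] := lim2 m0 1 ltr01.
    by move=> m m0m; apply: ltW; exact: hm0.
  rewrite (_ : f = (fun x => f_ m0 x - (f_ m0 x - f x))); first exact: sqintB.
  by apply/funext => x; rewrite opprB addrC subrK.
exists f => //.
apply/(cvg0_eps (fun k => nrm2_ge0 mu D _)) => e e0.
have [m0 hm0] := cau _ (divr_gt0 e0 (ltr0n R 2)).
exists m0 => n m0n; apply: (@le_lt_trans _ _ (e / 2)); last by rewrite ltr_pdivrMr// ltr_pMr// ltr1n.
apply: (lim2 n _ (divr_gt0 e0 (ltr0n R 2)) _).2 => m nm; apply: ltW; apply: hm0 => //.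
exact: leq_trans nm.
Qed.

End completeness.

(** * Test functions *)

Section test_functions.
Variables (R : realType) (n : nat) (Omega : set 'rV[R]_n).
Local Notation V := 'rV[R]_n.
Local Notation e_ i := (delta_mx 0 i : V).
Implicit Types (phi psi f g : V -> R) (x z : V).

Lemma test_smooth phi : test_function Omega phi -> smooth phi.
Proof. by case=> ck _ _; exact: smooth_Ck. Qed.

Lemma test_supp f phi : smooth f ->
  (forall x, f x != 0 -> closure [set y | phi y != 0] x) ->
  test_function Omega phi -> test_function Omega f.
Proof.
move=> sf fphi [_ cphi sphi].
have sub : closure [set x | f x != 0] `<=` closure [set y | phi y != 0].
  rewrite [X in _ `<=` X]((closure_id _).1 (@closed_closure _ _)).
  by apply: closure_subset => x; exact: fphi.
split; first exact: smooth_all_Ck.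
  by apply: subclosed_compact cphi sub; exact: closed_closure.
exact: subset_trans sub sphi.
Qed.

Lemma test_out phi x : test_function Omega phi -> ~ Omega x -> phi x = 0.
Proof.
move=> [_ _ sphi] nx; apply/eqP/negPn/negP => phix; apply: nx; apply: sphi.
exact: subset_closure.
Qed.

Lemma partial_supp phi i x : partial i phi x != 0 ->
  closure [set y | phi y != 0] x.
Proof.
move=> h; apply: contrapT => nx; move/negP: h; apply; apply/eqP.
have oC : open (~` closure [set y | phi y != 0]).
  by rewrite openC; exact: closed_closure.
have dx : is_derive x (e_ i) phi (0 : R).
  apply: (@near_eq_is_derive _ _ _ (cst (0 : R))).
    have : nbhs x (~` closure [set y | phi y != 0]) by apply: open_nbhs_nbhs.
    apply: filterS => y ny /=; apply/eqP; rewrite eq_sym; apply/negPn/negP => phiy.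
    by apply: ny; exact: subset_closure.
by rewrite /partial derive_val.
Qed.

Lemma test_partial phi i : test_function Omega phi ->
  test_function Omega (partial i phi).
Proof.
move=> tphi; apply: (test_supp _ _ tphi); last by move=> x; exact: partial_supp.
by have [_ _] := smooth_partial (test_smooth tphi); exact.
Qed.

Lemma testM phi psi : test_function Omega phi -> smooth psi ->
  test_function Omega (fun x => phi x * psi x).
Proof.
move=> tphi spsi; apply: (test_supp _ _ tphi).
  by apply: smoothM => //; exact: test_smooth tphi.
by move=> x; rewrite mulf_eq0 negb_or => /andP[h _]; exact: subset_closure.
Qed.

Lemma testD phi psi : test_function Omega phi -> test_function Omega psi ->
  test_function Omega (fun x => phi x + psi x).
Proof.
move=> tphi tpsi; have sphi := test_smooth tphi; have spsi := test_smooth tpsi.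
case: tphi tpsi => [_ cphi ophi] [_ cpsi opsi].
have sub : closure [set x | phi x + psi x != 0] `<=`
    closure [set x | phi x != 0] `|` closure [set x | psi x != 0].
  rewrite -closureU; apply: closure_subset => x /= h.
  have [p0|] := eqVneq (phi x) 0; last by left.
  by right; move: h; rewrite p0 add0r.
split; first exact: smooth_all_Ck (smoothD sphi spsi).
  by apply: subclosed_compact (compactU cphi cpsi) sub; exact: closed_closure.
by apply: subset_trans sub _ => x [/ophi|/opsi].
Qed.

Lemma testZ c phi : test_function Omega phi ->
  test_function Omega (fun x => c * phi x).
Proof.
move=> tphi; apply: (test_supp _ _ tphi).
  by apply: smoothM; [exact: smooth_cst|exact: test_smooth tphi].
by move=> x; rewrite mulf_eq0 negb_or => /andP[_ h]; exact: subset_closure.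
Qed.

Lemma testB phi psi : test_function Omega phi -> test_function Omega psi ->
  test_function Omega (fun x => phi x - psi x).
Proof.
move=> tphi tpsi; rewrite (_ : (fun x => _) = (fun x => phi x + (-1) * psi x)).
  by apply: testD => //; exact: testZ.
by apply/funext => x; rewrite mulN1r.
Qed.

Lemma test0 : test_function Omega (fun=> 0).
Proof.
have E : [set x : V | (0 : R) != 0] = set0 by apply/seteqP; split => x //=; rewrite eqxx.
split; first exact: smooth_all_Ck (smooth_cst _ _).
  by rewrite E closure0; exact: compact0.
by rewrite E closure0.
Qed.

Lemma test_sramp k c phi : 0 < k -> 0 <= c -> test_function Omega phi ->
  test_function Omega (sramp k c \o phi).
Proof.
move=> k0 c0 tphi; apply: (test_supp _ _ tphi).
  exact: smooth_sramp (test_smooth tphi).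
move=> x; apply: contraNP => /= nx; apply/eqP/sramp_eq0 => //.
apply: contrapT => /negP; rewrite -ltNge => h; apply: nx; apply: subset_closure => /=.
by rewrite gt_eqF// (le_lt_trans c0).
Qed.

Lemma test_continuous phi : test_function Omega phi -> continuous phi.
Proof. by move=> /test_smooth /smooth_partial[]. Qed.

Lemma test_measurable phi : test_function Omega phi -> measurable_fun setT phi.
Proof. by move=> /test_continuous; exact: continuous_leb. Qed.

Lemma test_is_derive phi i x : test_function Omega phi ->
  is_derive x (e_ i) phi (partial i phi x).
Proof. by move=> /test_smooth /smooth_partial[_ h _]; exact: derivableP. Qed.

Lemma test_bounded phi : test_function Omega phi ->
  exists2 K : R, 0 < K & (forall x, `|phi x| <= K) /\
    (forall x, phi x != 0 -> `|x| <= K).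
Proof.
move=> tphi; have cphi := test_continuous tphi.
case: (tphi) => _ cS _.
have [M M0 hM] := bounded_norm (compact_bounded cS).
have [M' M'0 hM'] := bounded_norm (compact_bounded (continuous_compact (continuous_subspaceT cphi) cS)).
exists (M + M'); first exact: addr_gt0.
split => x; last first.
  by move=> phix; apply: le_trans (hM x _) _; [exact: subset_closure|rewrite lerDl ltW].
have [->|phix] := eqVneq (phi x) 0; first by rewrite normr0 addr_ge0// ltW.
apply: le_trans (hM' (phi x) _) _; last by rewrite lerDr ltW.
by exists x => //; exact: subset_closure.
Qed.

Lemma integrable_ball (r K : R) :
  leb.-integrable setT (EFin \o (fun x : V => K * \1_(@cube R n r) x)).
Proof.
have mC : measurable (@cube R n r) by apply: borel_measurable; exact: measurable_cube.
apply: integrable_indicZ => //; apply: bounded_leb_fin => //.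
exists `|r|; split => // M rM x xr.
apply: le_trans (ltW rM); apply: norm_rV_le => // i.
by apply: le_trans (xr i) _; exact: ler_norm.
Qed.

Lemma test_integrable phi : test_function Omega phi ->
  leb.-integrable setT (EFin \o phi).
Proof.
move=> tphi; have [K K0 [hK sK]] := test_bounded tphi.
apply: (@integrable_dom _ _ _ _ _ measurableT _ (fun x => K * \1_(@cube R n K) x)).
- exact: test_measurable.
- move=> x _; rewrite indicE; have [_|] := boolP (x \in _); first by rewrite mulr1.
  rewrite notin_setE mulr0 => nx; rewrite normr_le0; apply/eqP.
  apply/eqP/negPn/negP => /sK xK; apply: nx => i; apply: le_trans xK; exact: ler_coord.
- exact: integrable_ball.
Qed.

Lemma test_sqint phi : test_function Omega phi -> sqint leb setT phi.
Proof.
move=> tphi; split; first exact: test_measurable.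
have := test_integrable (testM tphi (test_smooth tphi)).
by apply: eq_integrable => // x _; rewrite /= expr2.
Qed.

Lemma test_partial_bounded phi i x : test_function Omega phi ->
  forall K, (forall x, `|partial i phi x| <= K) ->
  forall t, `|phi (x + t *: e_ i) - phi x| <= K * `|t|.
Proof.
move=> tphi K hK t.
have H s : is_derive s (1 : R) (fun t => phi (x + t *: e_ i)) (partial i phi (x + s *: e_ i)).
  by apply: is_derive_along; exact: test_is_derive.
have [d] := mean_value H 0 t.
by rewrite scale0r addr0 subr0 => ->; rewrite normrM ler_wpM2r.
Qed.

Lemma cvg_diff_quot phi i x (t : R) : test_function Omega phi ->
  m.+1%:R * (phi (x + (t / m.+1%:R) *: e_ i) - phi x) @[m --> \oo]
    --> t * partial i phi x.
Proof.
move=> tphi; have [->|t0] := eqVneq t 0.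
  rewrite mul0r (_ : (fun m : nat => _) = cst 0); first exact: cvg_cst.
  by apply/funext => m; rewrite mul0r scale0r addr0 subrr mulr0.
have [dx d2] := test_is_derive i x tphi.
have := (cvgr_dnbhsP (fun h : R => h^-1 * (phi (x + h *: e_ i) - phi x)) 0 (partial i phi x)).1.
have c0 : (fun h : R => h^-1 * (phi (x + h *: e_ i) - phi x)) h @[h --> (0 : R)^'] --> partial i phi x.
  move: dx; rewrite /derivable /partial /derive => dx.
  by under eq_fun do rewrite [x + _]addrC; exact: dx.
move=> /(_ c0 (fun m => t / m.+1%:R)) c1.
rewrite (_ : (fun m : nat => _) = (fun m : nat => t * ((t / m.+1%:R)^-1 * (phi (x + (t / m.+1%:R) *: e_ i) - phi x)))); last first.
  by apply/funext => m; rewrite invf_div mulrA (mulrCA t) mulfV// mulr1.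
apply: cvgM; first exact: cvg_cst.
apply: c1; split=> [m|]; first by rewrite mulf_neq0// invr_eq0.
exact: cvgM0 (@cvg_harmonic R).
Qed.

Local Notation D2 z f := (nrm2 leb setT (fun x : V => f (x + z) - f x)).

(** One domination serves the limits of the difference quotients and of their
    squares. *)
Lemma diff_quot_dominated phi i (t : R) : test_function Omega phi ->
  exists (K r : R), 0 <= K /\ forall (m : nat) x,
    `|m.+1%:R * (phi (x + (t / m.+1%:R) *: e_ i) - phi x)| <= K * \1_(@cube R n r) x.
Proof.
move=> tphi; have [K1 K10 [_ sK]] := test_bounded tphi.
have [K2 K20 [hK _]] := test_bounded (test_partial i tphi).
exists (K2 * `|t|), (K1 + `|t|); split; first by rewrite mulr_ge0// ltW.
move=> m x.
have tm : `|t / m.+1%:R| <= `|t|.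
  by rewrite normrM normfV normr_nat ler_piMr// invf_le1// ler1n.
have := test_partial_bounded x tphi hK (t / m.+1%:R) => H.
rewrite indicE; have [_|] := boolP (x \in _).
  rewrite mulr1 normrM normr_nat; apply: le_trans (ler_wpM2l _ H) _ => //.
  by rewrite mulrCA normrM normfV normr_nat (mulrCA _ `|t|) mulfV// mulr1.
rewrite notin_setE => nx.
have p1 : phi x = 0.
  apply/eqP/negPn/negP => /sK xK; apply: nx => j.
  by apply: le_trans (ler_coord x j) _; rewrite (le_trans xK)// lerDl.
have p2 : phi (x + (t / m.+1%:R) *: e_ i) = 0.
  apply/eqP/negPn/negP => /sK xK; apply: nx => j.
  apply: le_trans (ler_coord x j) _.
  rewrite -[x in `|x|](addrK ((t / m.+1%:R) *: e_ i)).
  apply: le_trans (ler_normB _ _) _; apply: lerD => //.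
  rewrite normrZ; apply: le_trans (ler_pM _ _ tm (_ : _ <= 1)) _ => //; last by rewrite mulr1.
  exact: norm_delta_le1.
by rewrite p1 p2 subrr mulr0 normr0 mulr0.
Qed.

Lemma measurable_shift_fun f z : measurable_fun setT f ->
  measurable_fun setT (fun x : V => f (x + z)).
Proof. by move=> mf; exact: (measurableT_comp mf (measurable_shift z)). Qed.

Lemma sqint_shift f z : sqint leb setT f -> sqint leb setT (fun x : V => f (x + z)).
Proof.
move=> [mf fi]; split; first exact: measurable_shift_fun.
exact: (@integrable_shift R n z (fun x => f x ^+ 2)).
Qed.

Lemma nrm2_shift f z : measurable_fun setT f ->
  nrm2 leb setT (fun x : V => f (x + z)) = nrm2 leb setT f.
Proof.
move=> mf; apply: (@Rintegral_shift R n z (fun x => f x ^+ 2)).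
exact: measurable_funX.
Qed.

Lemma measurable_diff_quot phi z (c : R) : test_function Omega phi ->
  measurable_fun setT (fun x : V => c * (phi (x + z) - phi x)).
Proof.
move=> /test_measurable mphi; apply: measurable_funM => //.
by apply: measurable_funB => //; exact: measurable_shift_fun.
Qed.

(** The integral of every difference quotient vanishes by translation
    invariance. *)
Lemma Rintegral_partial phi i : test_function Omega phi ->
  \int[leb]_x partial i phi x = 0.
Proof.
move=> tphi.
have [K [r [K0 hK]]] := diff_quot_dominated i 1 tphi.
pose q (m : nat) x := m.+1%:R * (phi (x + (1 / m.+1%:R) *: e_ i) - phi x).
have mq m : measurable_fun setT (q m) by exact: measurable_diff_quot.
have [_ c] := dominated_Rintegral measurableT mq (measurable_funM (measurable_cst (1 : R)) (test_measurable (test_partial i tphi)))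
  (aeW _ (fun x _ => @cvg_diff_quot phi i x 1 tphi)) (integrable_ball r K) (fun m x _ => hK m x).
have mphi := test_measurable tphi.
have z0 m : \int[leb]_x q m x = 0.
  rewrite /q.
  have iphi := test_integrable tphi; have iphis := integrable_shift ((1 / m.+1%:R) *: e_ i) iphi.
  rewrite RintegralZl//; last exact: (integrableB measurableT iphis iphi).
  by rewrite RintegralB// Rintegral_shift// subrr mulr0.
rewrite -[RHS](cvg_cst_eq z0 c).
by apply: eq_Rintegral => x _ /=; rewrite mul1r.
Qed.

Lemma Rintegral_by_parts phi psi i : test_function Omega phi -> smooth psi ->
  \int[leb]_x (phi x * partial i psi x) = - \int[leb]_x (partial i phi x * psi x).
Proof.
move=> tphi spsi; apply/eqP; rewrite -subr_eq0 opprK; apply/eqP.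
have sp := smooth_partial spsi; have [_ dpsi spd] := sp.
rewrite -RintegralD//; last 2 first.
- exact: (test_integrable (testM tphi (spd i))).
- exact: (test_integrable (testM (test_partial i tphi) spsi)).
rewrite -[RHS](Rintegral_partial i (testM tphi spsi)).
apply: eq_Rintegral => x _; rewrite /partial; apply/esym; apply: derive_val.
have d1 := test_is_derive i x tphi.
have d2 := derivableP (dpsi i x).
have H := is_deriveM d1 d2; apply: (is_derive_eq H).
by rewrite /GRing.scale /= addrC [psi x * _]mulrC addrC.
Qed.

Lemma sqr_sum_le (M : nat) (a : nat -> R) :
  (\sum_(0 <= j < M) a j) ^+ 2 <= M%:R * \sum_(0 <= j < M) a j ^+ 2.
Proof.
elim: M => [|M IH]; first by rewrite !big_geq// expr0n mul0r.
rewrite !big_nat_recr//=; set s := \sum_(_ <= _ < _) a _ in IH *.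
set S := \sum_(_ <= _ < _) _ ^+ 2 in IH *.
have [M0|M0] := posnP M.
  rewrite /s /S M0 !big_geq// !add0r mulr1n mul1r//.
have MR : 0 < M%:R :> R by rewrite ltr0n.
rewrite -(ler_pM2l MR) -natr1; have := sqr_ge0 (s - M%:R * a M).
set y := a M; set mm := M%:R in MR IH *; nra.
Qed.

(** Splitting the shift into [m + 1] equal steps and letting [m] grow turns the
    difference quotients into the derivative. *)
Lemma nrm2_diff_axis phi i (t : R) : test_function Omega phi ->
  D2 (t *: e_ i) phi <= t ^+ 2 * nrm2 leb setT (partial i phi).
Proof.
move=> tphi; have sphi := test_sqint tphi; have [mphi _] := sphi.
have [K [r [K0 hK]]] := diff_quot_dominated i t tphi.
pose q (m : nat) x := m.+1%:R * (phi (x + (t / m.+1%:R) *: e_ i) - phi x).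
have mq m : measurable_fun setT (q m) by exact: measurable_diff_quot.
have mp := test_measurable (test_partial i tphi).
have sdif z : sqint leb setT (fun x : V => phi (x + z) - phi x).
  by apply: sqintB => //; exact: sqint_shift.
have qb m x : setT x -> `|q m x ^+ 2| <= K ^+ 2 * \1_(@cube R n r) x.
  move=> _; rewrite normrX.
  apply: (@le_trans _ _ ((K * \1_(@cube R n r) x) ^+ 2)).
    by rewrite lerXn2r ?nnegrE// ?mulr_ge0//; exact: hK.
  by rewrite exprMn indicE; case: (_ \in _); rewrite ?expr1n ?expr0n.
have [_ c] := @dominated_Rintegral _ _ _ leb setT measurableT
   (fun m x => q m x ^+ 2) (fun x => (t * partial i phi x) ^+ 2)
   (fun x => K ^+ 2 * \1_(@cube R n r) x)
   (fun m => measurable_funX 2 (mq m)) (measurable_funX 2 (measurable_funM (measurable_cst _) mp))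
   (aeW _ (fun x _ => cvg_sqr (@cvg_diff_quot phi i x t tphi))) (integrable_ball r (K ^+ 2)) qb.
have E : t ^+ 2 * nrm2 leb setT (partial i phi) = \int[leb]_x ((t * partial i phi x) ^+ 2).
  by rewrite -[LHS]nrm2Z//; exact: test_sqint (test_partial i tphi).
rewrite E; apply: (cvgr_to_ge c); apply: nearW => m.
pose h : V := (t / m.+1%:R) *: e_ i.
pose a (j : nat) x := phi (x + j%:R *: h + h) - phi (x + j%:R *: h).
have tel x : phi (x + t *: e_ i) - phi x = \sum_(0 <= j < m.+1) a j x.
  have -> : \sum_(0 <= j < m.+1) a j x = \sum_(0 <= j < m.+1) (phi (x + j.+1%:R *: h) - phi (x + j%:R *: h)).
    by apply: eq_bigr => j _; rewrite /a -addrA -{2}[h]scale1r -scalerDl natr1.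
  rewrite (telescope_sumr (fun j => phi (x + j%:R *: h)))// scale0r addr0.
  by rewrite /h scalerA mulrCA mulfV// mulr1.
have sa j : sqint leb setT (a j) by exact: (sqint_shift (j%:R *: h) (sdif h)).
have na j : nrm2 leb setT (a j) = D2 h phi.
  by rewrite -(nrm2_shift (j%:R *: h) (sdif h).1).
have : D2 (t *: e_ i) phi <= m.+1%:R * \sum_(0 <= j < m.+1) nrm2 leb setT (a j).
  have [isum <-] := Rintegral_sum measurableT (index_iota 0 m.+1) (fun j => (sa j).2).
  rewrite -RintegralZl//; apply: le_Rintegral => //.
  - exact: (sdif _).2.
  - exact: (integrableZl measurableT m.+1%:R isum).
  - by move=> x _; rewrite tel; exact: sqr_sum_le.
rewrite (eq_bigr (fun _ => D2 h phi))//; move=> H; apply: le_trans H _.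
rewrite sumr_const_nat subn0 -(mulr_natl (nrm2 _ _ _)) mulrA -expr2.
by rewrite -(nrm2Z measurableT _ (sdif h)).
Qed.

Definition energy phi : R := \sum_(i < n) nrm2 leb setT (partial i phi).

Lemma energy_ge0 phi : 0 <= energy phi.
Proof. by apply: sumr_ge0 => i _; exact: nrm2_ge0. Qed.

(** Shifting one coordinate at a time, so that only partial derivatives enter. *)
Lemma nrm2_diff phi z : test_function Omega phi ->
  D2 z phi <= n%:R * `|z| ^+ 2 * energy phi.
Proof.
move=> tphi; have sphi := test_sqint tphi; have [mphi _] := sphi.
have sdif y : sqint leb setT (fun x : V => phi (x + y) - phi x).
  by apply: sqintB => //; exact: sqint_shift.
pose zk (k : nat) : V := \row_i (if (i < k)%N then z 0 i else 0).
pose a (k : nat) x := phi (x + zk k.+1) - phi (x + zk k).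
have zkS (i : 'I_n) : zk i.+1 = zk i + z 0 i *: e_ i.
  apply/rowP => j; rewrite !mxE eqxx /= ltnS leq_eqVlt.
  have [->|ji] := eqVneq j i; first by rewrite eqxx ltnn mulr1 add0r.
  by rewrite (_ : (j == i :> nat) = false) ?mulr0 ?addr0//; apply/negbTE.
have aE (i : 'I_n) : a i = fun x => (phi (x + zk i + z 0 i *: e_ i) - phi (x + zk i)).
  by apply/funext => x; rewrite /a zkS addrA.
have sa (k : nat) : sqint leb setT (a k).
  by apply: sqintB => //; exact: sqint_shift.
have na (i : 'I_n) : nrm2 leb setT (a i) <= `|z| ^+ 2 * nrm2 leb setT (partial i phi).
  rewrite aE (nrm2_shift (zk i) (sdif (z 0 i *: e_ i)).1).
  apply: le_trans (nrm2_diff_axis i (z 0 i) tphi) _.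
  rewrite ler_wpM2r ?nrm2_ge0// -[leLHS](real_normK (num_real (z 0 i))).
  by rewrite lerXn2r ?nnegrE// ler_coord.
have tel x : phi (x + z) - phi x = \sum_(0 <= k < n) a k x.
  rewrite (telescope_sumr (fun k => phi (x + zk k)))//.
  have -> : zk n = z by apply/rowP => j; rewrite mxE ltn_ord.
  have -> : zk 0%N = 0 by apply/rowP => j; rewrite !mxE.
  by rewrite addr0.
have [isum sumE] := Rintegral_sum measurableT (index_iota 0 n) (fun k => (sa k).2).
apply: (@le_trans _ _ (n%:R * \sum_(0 <= k < n) nrm2 leb setT (a k))).
  rewrite -sumE -RintegralZl//; apply: le_Rintegral => //.
  - exact: (sdif z).2.
  - exact: (integrableZl measurableT n%:R isum).
  - by move=> x _; rewrite tel; exact: sqr_sum_le.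
rewrite -mulrA ler_wpM2l// big_mkord /energy mulr_sumr.
by apply: ler_sum => i _; exact: na.
Qed.

(** A shift by more than the diameter leaves the support. *)
Lemma poincare_test : (0 < n)%N -> bounded_set Omega ->
  exists2 K : R, 0 < K & forall phi, test_function Omega phi ->
    nrm2 leb setT phi <= K * energy phi.
Proof.
move=> n0 /bounded_norm[r r0 Or]; pose z : V := const_mx (2 * r + 1).
have c0 : 0 < 2 * r + 1 by rewrite addr_gt0// mulr_gt0.
exists (n%:R * (2 * r + 1) ^+ 2); first by rewrite mulr_gt0 ?ltr0n// exprn_gt0.
move=> phi tphi; have sphi := test_sqint tphi.
have zn : `|z| <= 2 * r + 1.
  by apply: norm_rV_le => [|i]; [exact: ltW|rewrite mxE gtr0_norm].
apply: le_trans (_ : D2 z phi <= _); last first.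
  apply: le_trans (nrm2_diff z tphi) _.
  by rewrite ler_wpM2r ?energy_ge0// ler_wpM2l// lerXn2r ?nnegrE// ltW.
apply: nrm2_le => //; first by apply: sqintB => //; exact: sqint_shift.
move=> x _; have [Ox|nx] := pselect (Omega x); last by rewrite (test_out tphi nx) normr0.
rewrite (test_out (x := x + z) tphi) ?sub0r ?normrN// => /Or xz.
have := le_trans (ler_coord x (Ordinal n0)) (Or _ Ox).
have := le_trans (ler_coord (x + z) (Ordinal n0)) xz.
by rewrite !mxE !ler_norml => /andP[? ?] /andP[? ?]; lra.
Qed.

End test_functions.

(** * The fundamental lemma of the calculus of variations *)

Section du_bois_reymond.
Variables (R : realType) (n : nat) (Omega : set 'rV[R]_n).
Local Notation V := 'rV[R]_n.
Hypothesis oOmega : open Omega.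
Variable g : V -> R.
Hypothesis ig : leb.-integrable Omega (EFin \o g).
Hypothesis g0 : forall phi, test_function Omega phi ->
  \int[leb]_(x in Omega) (g x * phi x) = 0.

Let mO : measurable Omega. Proof. exact: open_leb. Qed.

(** The smooth bumps of the box converge to its indicator and are bounded
    by [1]. *)
Lemma integral_obox_eq0 a b : cbox a b `<=` Omega ->
  \int[leb]_(x in obox a b) g x = 0.
Proof.
move=> abO.
have mB : measurable (obox a b) by apply: borel_measurable; exact: measurable_obox.
have BO : obox a b `<=` Omega.
  by move=> x xab; apply: abO => i; have /andP[/ltW -> /ltW ->] := xab i.
have mg := integrable_mfun ig.
have tb m := @test_function_boxbump R n Omega m.+1%:R a b (ltr0n _ _) abO.
have mf m : measurable_fun Omega (fun x => g x * boxbump m.+1%:R a b x).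
  by apply: measurable_funM => //; apply: measurable_funTS; exact: test_measurable (tb m).
have gb (m : nat) x : Omega x -> `|g x * boxbump m.+1%:R a b x| <= `|g x|.
  by move=> _; rewrite normrM ler_piMr// ger0_norm ?boxbump_ge0 ?boxbump_le1.
have [_ c] := @dominated_Rintegral _ _ _ leb Omega mO
  (fun m x => g x * boxbump m.+1%:R a b x) (fun x => g x * \1_(obox a b) x)
  (fun x => `|g x|) mf (measurable_funM mg (measurable_indic mB))
  (aeW _ (fun x _ => cvgM (cvg_cst (g x)) (@cvg_boxbump R n a b x)))
  (integrable_norm ig) gb.
have z0 m : \int[leb]_(x in Omega) (g x * boxbump m.+1%:R a b x) = 0 by exact: g0.
rewrite -(cvg_cst_eq z0 c).
rewrite -[in LHS](setIidr BO) Rintegral_mkcondr; apply: eq_Rintegral => x _.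
by rewrite patchE indicE; case: ifP => _; rewrite ?mulr1 ?mulr0.
Qed.

Let orthant (c : V) : set (Defs.prodrV R n) := [set x | forall i, c 0 i < (x : V) 0 i].

(** Open orthants are stable under intersection, and they cut a box into
    a box. *)
Lemma prodrV_measurable_orthant :
  @measurable _ (Defs.prodrV R n) = <<s range orthant >>.
Proof.
apply/seteqP; split; last first.
  apply: smallest_sub; first exact: sigma_algebra_measurable.
  move=> _ [c _ <-]; apply: measurable_cap_ord => i.
  have := @measurable_coord_borel R n i `]c 0 i, +oo[%classic (measurable_itv _).
  by rewrite (_ : [set x : V | _ (x 0 i)] = [set x : V | c 0 i < x 0 i])//;
    apply/seteqP; split => x /=; rewrite in_itv/= andbT.
pose G := g_sigma_algebraType (range orthant).
apply: smallest_sub; first exact: (@sigma_algebra_measurable _ G).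
rewrite -bigcup_seq/= => A [i _] [Y mY <-]; rewrite setTI.
have mc : measurable_fun (setT : set G) ((fun x : G => (x : V) 0 i) : G -> measurableTypeR R).
  apply: (measurability _ (RGenOInfty.measurableE R)).
  move=> _ [_ [c ->] <-]; rewrite setTI.
  rewrite (_ : _ @^-1` _ = \bigcup_m (orthant (\row_j (if j == i then c else - m%:R)) : set G)).
    by apply: bigcupT_measurable => m; apply: sub_sigma_algebra; exists (\row_j (if j == i then c else - m%:R)).
  apply/seteqP; split => x /=; rewrite in_itv/= andbT; last first.
    by move=> [m _ /(_ i)]; rewrite mxE eqxx.
  move=> cx; have [m hm] : exists m : nat, `|(x : V)| < m%:R.
    by exists (Num.bound `|(x : V)|); rewrite archi_boundP.
  exists m => // j; rewrite mxE; case: eqVneq => [->//|_].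
  have := ler_coord (x : V) j; rewrite ler_norml => /andP[h _].
  by apply: lt_le_trans h; rewrite ltrN2.
by have := mc measurableT _ mY; rewrite setTI.
Qed.

(** Dynkin's lemma inside one box, where complements correspond to differences
    of finite integrals. *)
Lemma integral_borel_obox_eq0 a b (A : set (Defs.prodrV R n)) :
  cbox a b `<=` Omega -> measurable A ->
  \int[leb]_(x in (A : set V) `&` obox a b) g x = 0.
Proof.
move=> abO mA.
have mB : measurable (obox a b) by apply: borel_measurable; exact: measurable_obox.
have BO : obox a b `<=` Omega.
  by move=> x xab; apply: abO => i; have /andP[/ltW -> /ltW ->] := xab i.
have iB : leb.-integrable (obox a b) (EFin \o g) by exact: integrableS ig.
have iAB (S : set V) : measurable S -> leb.-integrable (S `&` obox a b) (EFin \o g).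
  move=> mS; apply: (integrableS mB) iB => //; exact: measurableI.
have meas := prodrV_measurable_orthant.
apply: (@dynkin_induction _ (Defs.prodrV R n) (range orthant)
   (fun A => \int[leb]_(x in (A : set V) `&` obox a b) g x = 0)) => //.
- move=> _ _ [c _ <-] [c' _ <-]; exists (\row_i Num.max (c 0 i) (c' 0 i)) => //.
  apply/seteqP; split => x /=.
    by move=> h; split => i; have := h i; rewrite mxE gt_max => /andP[].
  by move=> [h h'] i; rewrite mxE gt_max h h'.
- by rewrite setTI; exact: integral_obox_eq0.
- move=> _ [c _ <-].
  rewrite (_ : _ `&` _ = obox (\row_i Num.max (c 0 i) (a 0 i)) b).
    apply: integral_obox_eq0 => x xab; apply: abO => i; have := xab i.
    by rewrite mxE ge_max => /andP[/andP[_ ->] ->].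
  apply/seteqP; split => x /=.
    by move=> [h h'] i; rewrite mxE gt_max h; have /andP[-> ->] := h' i.
  move=> h; split => i; have := h i; rewrite mxE gt_max => /andP[/andP[]] //.
  by move=> _ -> ->.
- move=> S mS S0; have mS' := borel_measurable mS.
  have := integral_obox_eq0 abO.
  have E : obox a b = ((S : set V) `&` obox a b) `|` ((~` S : set V) `&` obox a b).
    by rewrite -setIUl setUv setTI.
  rewrite [X in \int[leb]_(x in X) g x]E Rintegral_setU.
  + by rewrite S0 add0r.
  + exact: measurableI.
  + by apply: measurableI => //; exact: measurableC.
  + by rewrite -E.
  + by apply/disj_setPS => x [[? _] [? _]].
- move=> F mF tF F0; rewrite setI_bigcupl /Rintegral integral_bigcup.
  + rewrite eseries0// => k _ _; have := F0 k; rewrite /Rintegral => h.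
    rewrite -[LHS]fineK ?h//; apply: integrable_fin_num; last first.
      exact: iAB (borel_measurable (mF k)).
    by apply: measurableI => //; exact: borel_measurable.
  + exact: trivIset_setIr.
  + by move=> k; apply: measurableI => //; exact: borel_measurable.
  + rewrite -setI_bigcupl; apply: iAB; apply: bigcupT_measurable => k.
    exact: borel_measurable.
- by rewrite -meas.
Qed.

(** The integrals over measurable subsets of a box coincide with those over
    their Borel hulls, hence vanish; countably many boxes cover [Omega]. *)
Lemma du_bois_reymond : {ae leb, forall x, Omega x -> g x = 0}.
Proof.
have [a [b [D [abO OE]]]] := box_cover oOmega.
have aek k : {ae leb, forall x, D k -> obox (a k) (b k) x -> g x = 0}.
  have [Dk|nDk] := pselect (D k); last by apply: aeW => x /nDk.
  have {}abO := abO k Dk.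
  have mB : measurable (obox (a k) (b k)) by apply: borel_measurable; exact: measurable_obox.
  have BO : obox (a k) (b k) `<=` Omega by rewrite OE => x xb; exists k.
  have iB : leb.-integrable (obox (a k) (b k)) (EFin \o g) by exact: integrableS ig.
  have h E : E `<=` obox (a k) (b k) -> measurable E ->
      (\int[leb]_(x in E) (EFin \o g) x = \int[leb]_(x in E) (cst 0%E) x)%E.
    move=> EB mE; rewrite integral0.
    have iE : leb.-integrable E (EFin \o g) by exact: integrableS iB.
    have Efin : (leb E < +oo)%E.
      apply: bounded_leb_fin => //; have [M [Mr hM]] := compact_bounded (@compact_cbox R n (a k) (b k)).
      exists M; split => // M' MM' x Ex; apply: (hM _ MM').
      by move=> i; have /andP[/ltW -> /ltW ->] := EB _ Ex i.
    have [F [mF EF F0]] := borel_hull mE Efin.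
    have mF' := borel_measurable mF.
    rewrite integral_Rintegral//; congr (_%:E).
    rewrite -(integral_borel_obox_eq0 abO mF).
    have EFB : E `<=` (F : set V) `&` obox (a k) (b k) by move=> x Ex; split; [exact: EF|exact: EB].
    rewrite -(setDUK EFB) Rintegral_setU.
    + have N0 : leb (((F : set V) `&` obox (a k) (b k)) `\` E) = 0%E.
        apply: (subset_measure0 _ _ _ F0).
        - by apply: measurableD => //; exact: measurableI.
        - exact: measurableD.
        - by apply: setSD; exact: subIsetl.
      rewrite [X in _ + X](_ : _ = 0) ?addr0// /Rintegral.
      have mN : measurable (((F : set V) `&` obox (a k) (b k)) `\` E).
        by apply: measurableD => //; exact: measurableI.
      rewrite null_set_integral//; apply: (@measurable_int _ _ _ leb).
      by apply: (integrableS mB) iB => // x [[]].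
    + by [].
    + by apply: measurableD => //; exact: measurableI.
    + rewrite setDUK//; apply: (integrableS mB) iB; [exact: measurableI|exact: subIsetr].
    + by apply/disj_setPS => x [? [_ ?]].
  have := integral_ae_eq mB iB (measurable_cst 0%E) h.
  by apply: filterS => x hx _ xb; have := hx xb => -[].
have := ae_foralln aek; apply: filterS => x h.
by rewrite OE => -[k Dk xk]; exact: (h k).
Qed.

End du_bois_reymond.

(** * Square-integrable functions on subsets and up to null sets *)

Section sq_limits.
Context d (T : measurableType d) (R : realType).
Variables (mu : {measure set T -> \bar R}) (D : set T).
Hypothesis mD : measurable D.
Implicit Types f g h : T -> R.
Local Notation sqint := (sqint mu D).
Local Notation nrm2 := (nrm2 mu D).
Local Notation ip := (ip mu D).

Lemma Rintegral_ae f g : measurable_fun D f -> measurable_fun D g ->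
  {ae mu, forall x, D x -> f x = g x} ->
  \int[mu]_(x in D) f x = \int[mu]_(x in D) g x.
Proof.
move=> mf mg fg; congr fine; apply: ae_eq_integral => //; try exact/measurable_EFinP.
by apply: filterS fg => x h Dx /=; rewrite h.
Qed.

Lemma nrm2_ae f g : sqint f -> sqint g ->
  {ae mu, forall x, D x -> f x = g x} -> nrm2 f = nrm2 g.
Proof.
move=> [mf _] [mg _] fg; apply: Rintegral_ae; try exact: measurable_funX.
by apply: filterS fg => x h Dx; rewrite h.
Qed.

Lemma ip_ae f g h : sqint f -> sqint g -> sqint h ->
  {ae mu, forall x, D x -> f x = g x} -> ip f h = ip g h.
Proof.
move=> [mf _] [mg _] [mh _] fg; apply: Rintegral_ae; try exact: measurable_funM.
by apply: filterS fg => x e Dx; rewrite e.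
Qed.

Lemma sqint_finite c : (mu D < +oo)%E -> sqint (fun=> c).
Proof.
move=> Dfin; split; first exact: measurable_cst.
apply/integrableP; split; first exact: measurable_cst.
rewrite (eq_integral (cst (c ^+ 2)%:E)); last first.
  by move=> x _; rewrite gee0_abs// lee_fin sqr_ge0.
by rewrite integral_cst// lte_mul_pinfty// lee_fin sqr_ge0.
Qed.

Lemma sqint_integrable f : (mu D < +oo)%E -> sqint f ->
  mu.-integrable D (EFin \o f).
Proof.
move=> Dfin sf; have := sqintM mD sf (sqint_finite 1 Dfin).
by apply: eq_integrable => // x _; rewrite /= mulr1.
Qed.

End sq_limits.

Section sq_subset.
Context d (T : measurableType d) (R : realType).
Variables (mu : {measure set T -> \bar R}).

Lemma sqintS (D E : set T) (f : T -> R) : measurable D -> measurable E ->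
  D `<=` E -> sqint mu E f -> sqint mu D f.
Proof.
move=> mD mE DE [mf fi]; split; first exact: measurable_funS mf.
exact: integrableS fi.
Qed.

Lemma sqint_out (D : set T) (f : T -> R) : measurable D ->
  (forall x, ~ D x -> f x = 0) -> sqint mu D f -> sqint mu setT f.
Proof.
move=> mD f0 [mf fi].
have fE : f = f \_ D.
  by apply/funext => x; rewrite patchE; case: ifPn => // /negP; rewrite inE => /f0.
split; first by rewrite fE; apply/(measurable_restrictT _ mD).
have := (integrable_mkcond (fun x => (f x ^+ 2)%:E) mD).1 fi.
apply: eq_integrable => // x _; rewrite patchE; case: ifPn => // /negP; rewrite inE => /f0 ->.
by rewrite expr0n.
Qed.

Lemma Rintegral_out (D : set T) (f : T -> R) :
  (forall x, ~ D x -> f x = 0) -> \int[mu]_(x in D) f x = \int[mu]_x f x.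
Proof.
move=> f0; rewrite Rintegral_mkcond; apply: eq_Rintegral => x _.
by rewrite patchE; case: ifPn => // /negP; rewrite inE => /f0.
Qed.

End sq_subset.

(** * Weak gradients and the space [H01] *)

Section weak_gradient.
Variables (R : realType) (n : nat) (Omega : set 'rV[R]_n).
Local Notation V := 'rV[R]_n.
Hypothesis n0 : (0 < n)%N.
Hypothesis oOmega : open Omega.
Hypothesis bOmega : bounded_set Omega.
Implicit Types (u v phi psi : V -> R) (G H : V -> V).
Local Notation test := (test_function Omega).
Local Notation nrm := (nrm2 leb Omega).
Local Notation sq := (sqint leb Omega).

Let mO : measurable Omega. Proof. exact: open_leb. Qed.

Let Ofin : (leb Omega < +oo)%E. Proof. exact: bounded_leb_fin. Qed.

Let oform : is_form sq (ip leb Omega). Proof. exact: ip_form. Qed.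

Lemma test_sq phi : test phi -> sq phi.
Proof. by move=> /test_sqint; exact: sqintS. Qed.

Lemma nrm_test phi : test phi -> nrm phi = nrm2 leb setT phi.
Proof.
by move=> tphi; apply: Rintegral_out => x nx; rewrite (test_out tphi nx) expr0n.
Qed.

Lemma is_wgrad_test phi : test phi -> is_wgrad Omega phi (grad phi).
Proof.
move=> tphi i; have E : (fun x => grad phi x 0 i) = partial i phi.
  by apply/funext => x; rewrite mxE.
rewrite E; split; first exact: test_sq (test_partial i tphi).
move=> psi tpsi.
rewrite (@Rintegral_out _ _ _ leb Omega (fun x => phi x * partial i psi x)); last first.
  by move=> x nx; rewrite (test_out tphi nx) mul0r.
rewrite (@Rintegral_out _ _ _ leb Omega (fun x => grad phi x 0 i * psi x)); last first.
  by move=> x nx; rewrite (test_out tpsi nx) mulr0.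
rewrite (Rintegral_by_parts i tphi (test_smooth tpsi)); congr (- _).
by apply: eq_Rintegral => x _; rewrite mxE.
Qed.

(** The difference of two weak gradients is orthogonal to all test functions. *)
Lemma wgrad_unique u G H : is_wgrad Omega u G -> is_wgrad Omega u H ->
  forall i, {ae leb, forall x, Omega x -> G x 0 i = H x 0 i}.
Proof.
move=> uG uH i; have [sG hG] := uG i; have [sH hH] := uH i.
have sd := sqintB mO sG sH.
have id := sqint_integrable mO Ofin sd.
have := @du_bois_reymond R n Omega oOmega (fun x => G x 0 i - H x 0 i) id.
have h phi : test phi -> \int[leb]_(x in Omega) ((G x 0 i - H x 0 i) * phi x) = 0.
  move=> tphi; have sphi := test_sq tphi.
  have := form_subl oform sG sH sphi; rewrite /ip => ->.
  apply/eqP; rewrite subr_eq0; apply/eqP.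
  by apply: oppr_inj; rewrite -(hG _ tphi) -(hH _ tphi).
move=> /(_ h); apply: filterS => x e Ox.
by apply/eqP; rewrite -subr_eq0 e.
Qed.

Lemma wgradP u G : is_wgrad Omega u G -> is_wgrad Omega u (wgrad Omega u).
Proof. by move=> uG; apply: (@xgetPex _ (fun=> 0) [set G | is_wgrad Omega u G]); exists G. Qed.

Lemma wgrad_ae u G : is_wgrad Omega u G ->
  forall i, {ae leb, forall x, Omega x -> wgrad Omega u x 0 i = G x 0 i}.
Proof. by move=> uG; exact: (wgrad_unique (wgradP uG) uG). Qed.

Lemma is_wgrad_lin u v G H (c : R) : sq u -> sq v ->
  is_wgrad Omega u G -> is_wgrad Omega v H ->
  is_wgrad Omega (fun x => u x + c * v x) (fun x => G x + c *: H x).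
Proof.
move=> su sv uG vH i; have [sG hG] := uG i; have [sH hH] := vH i.
have E : (fun x => (G x + c *: H x) 0 i) = (fun x => G x 0 i + c * H x 0 i).
  by apply/funext => x; rewrite !mxE.
rewrite E; split; first exact: (sqintD mO sG (sqintZ mO c sH)).
move=> phi tphi.
have sp := test_sq (test_partial i tphi); have sphi := test_sq tphi.
have e1 := form_linl oform c su sv sp; rewrite /ip in e1.
have e2 : \int[leb]_(x in Omega) ((G x + c *: H x) 0 i * phi x) =
    ip leb Omega (fun x => G x 0 i) phi + c * ip leb Omega (fun x => H x 0 i) phi.
  rewrite -(form_linl oform c sG sH sphi).
  by apply: eq_Rintegral => x _; rewrite !mxE.
rewrite e1 e2 opprD -mulrN; congr (_ + _ * _); first exact: hG.
exact: hH.
Qed.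

Lemma is_wgrad_sub_test u G phi : sq u -> is_wgrad Omega u G -> test phi ->
  is_wgrad Omega (u \- phi) (fun x => G x + (-1) *: grad phi x).
Proof.
move=> su uG tphi; rewrite (_ : u \- phi = (fun x => u x + (-1) * phi x)).
  exact: (is_wgrad_lin (-1) su (test_sq tphi) uG (is_wgrad_test tphi)).
by apply/funext => x; rewrite mulN1r.
Qed.

(** The norm that defines [H01] involves an arbitrarily chosen weak gradient of
    the difference; here it is expressed through a known one. *)
Lemma H1norm_sub_test u G phi : sq u -> is_wgrad Omega u G -> test phi ->
  H1norm Omega (u \- phi) = Num.sqrt (nrm (fun x => phi x - u x) +
    \sum_(i < n) nrm (fun x => partial i phi x - G x 0 i)).
Proof.
move=> su uG tphi; have wk := is_wgrad_sub_test su uG tphi; have wkp := wgradP wk.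
rewrite /H1norm -[\int[leb]_(x in _) ((u \- phi) x ^+ 2)]/(nrm (u \- phi)) nrm2_sub.
congr (Num.sqrt (_ + _)).
transitivity (\sum_(i < n) nrm (fun x => wgrad Omega (u \- phi) x 0 i)).
  have [_ <-] := Rintegral_sum mO (index_enum 'I_n) (fun i => (wkp i).1.2).
  by apply: eq_Rintegral => x _; exact: sqr_enorm.
apply: eq_bigr => i _; rewrite [RHS]nrm2_sub.
apply: (nrm2_ae mO (wkp i).1 (sqintB mO (uG i).1 (test_sq (test_partial i tphi)))).
by apply: filterS (wgrad_ae wk i) => x h Ox; rewrite h// !mxE mulN1r.
Qed.

Definition wg u (i : 'I_n) (x : V) : R := wgrad Omega u x 0 i.

Definition gE u v : R := \sum_(i < n) ip leb Omega (wg u i) (wg v i).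

(** The working form of membership in [H01]: approximation by test functions
    componentwise in the norm of square-integrable functions. *)
Lemma H01_approx u : H01 Omega u -> sq u /\ (forall i, sq (wg u i)) /\
  exists phi : nat -> V -> R, [/\ forall k, test (phi k),
    nrm (fun x => phi k x - u x) @[k --> \oo] --> (0 : R) &
    forall i, nrm (fun x => partial i (phi k) x - wg u i x) @[k --> \oo] --> (0 : R)].
Proof.
move=> [u0 [su [G uG]] [phi [tphi c]]].
have uw := wgradP uG.
split; first exact: su; split; first by move=> i; have [] := uw i.
have c2 : H1norm Omega (u \- phi k) ^+ 2 @[k --> \oo] --> (0 : R).
  by have := cvg_sqr c; rewrite expr0n.
have S0 k : 0 <= \sum_(i < n) nrm (fun x => partial i (phi k) x - wg u i x).
  by apply: sumr_ge0 => i _; exact: nrm2_ge0.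
have E k : H1norm Omega (u \- phi k) ^+ 2 = nrm (fun x => phi k x - u x) +
    \sum_(i < n) nrm (fun x => partial i (phi k) x - wg u i x).
  by rewrite (H1norm_sub_test su uw (tphi k)) sqr_sqrtr// addr_ge0 ?nrm2_ge0 ?S0.
exists phi; split => //; first by apply: squeeze0 c2 => k; rewrite E nrm2_ge0 lerDl S0.
move=> i; apply: squeeze0 c2 => k; rewrite E nrm2_ge0/= (bigD1 i)//= addrCA lerDl.
by rewrite addr_ge0 ?nrm2_ge0//; apply: sumr_ge0 => j _; exact: nrm2_ge0.
Qed.

(** Integration by parts against a test function passes to the limit, so the limit
    of the gradients is a weak gradient of the limit. *)
Lemma H01_intro u G (phi : nat -> V -> R) :
  (forall x, ~ Omega x -> u x = 0) -> sq u -> (forall i, sq (fun x => G x 0 i)) ->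
  (forall k, test (phi k)) ->
  nrm (fun x => phi k x - u x) @[k --> \oo] --> (0 : R) ->
  (forall i, nrm (fun x => partial i (phi k) x - G x 0 i) @[k --> \oo] --> (0 : R)) ->
  H01 Omega u /\ forall i, {ae leb, forall x, Omega x -> wg u i x = G x 0 i}.
Proof.
move=> u0 su sG tphi cu cG.
have uG : is_wgrad Omega u G.
  move=> i; split; first exact: sG.
  move=> psi tpsi; have sp := test_sq (test_partial i tpsi); have spsi := test_sq tpsi.
  have c1 := form_cvg oform (fun k => test_sq (tphi k)) su sp cu.
  have c2 := form_cvg oform (fun k => test_sq (test_partial i (tphi k))) (sG i) spsi (cG i).
  have e k : ip leb Omega (phi k) (partial i psi) = - ip leb Omega (partial i (phi k)) psi.
    have [_ /(_ _ tpsi) h] := is_wgrad_test (tphi k) i.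
    rewrite -[LHS]/(\int[leb]_(x in Omega) (phi k x * partial i psi x)) h; congr (- _).
    by apply: eq_Rintegral => x _; rewrite mxE.
  have c3 : - ip leb Omega (partial i (phi k)) psi @[k --> \oo] --> ip leb Omega u (partial i psi).
    by under eq_fun do rewrite -e.
  exact: (cvg_unique (@Rhausdorff R) c3 (cvgN c2)).
have uw := wgradP uG; have wE := wgrad_ae uG.
split; last exact: wE.
split => //; first by split => //; exists G.
exists phi; split => //; rewrite (funext (fun k => H1norm_sub_test su uG (tphi k))).
rewrite -[X in _ --> X]sqrtr0; apply: continuous_cvg; first exact: sqrt_continuous.
apply: cvgD0 cu _.
exact: cvg_sum0 cG.
Qed.

Lemma gE_dotp u v : H01 Omega u -> H01 Omega v ->
  \int[leb]_(x in Omega) dotp (wgrad Omega u x) (wgrad Omega v x) = gE u v.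
Proof.
move=> /H01_approx[_ [su _]] /H01_approx[_ [sv _]].
have [_ h] := Rintegral_sum mO (index_enum 'I_n) (fun i => sqintM mO (su i) (sv i)).
by rewrite -[RHS]h; apply: eq_Rintegral.
Qed.

Lemma H01_out u x : H01 Omega u -> ~ Omega x -> u x = 0.
Proof. by case=> + _ _ => /[apply]. Qed.

Lemma H01_wgrad u : H01 Omega u -> is_wgrad Omega u (wgrad Omega u).
Proof. by move=> [_ [_ [G uG]] _]; exact: wgradP uG. Qed.

Lemma H01_sq u : H01 Omega u -> sq u.
Proof. by move=> /H01_approx[]. Qed.

Lemma H01_wg u i : H01 Omega u -> sq (wg u i).
Proof. by move=> /H01_approx[_ []]. Qed.

Lemma H01_test phi : test phi ->
  H01 Omega phi /\ forall i, {ae leb, forall x, Omega x -> wg phi i x = partial i phi x}.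
Proof.
move=> tphi.
have c0 : (fun _ : nat => 0) @ \oo --> (0 : R) by exact: cvg_cst.
have [||||||h1 h2] := @H01_intro phi (grad phi) (fun=> phi).
- by move=> x; exact: test_out.
- exact: test_sq.
- by move=> i; exact: (is_wgrad_test tphi i).1.
- by [].
- rewrite (_ : nrm _ = 0)// /nrm2 -[RHS](Rintegral0 leb Omega).
  by apply: eq_Rintegral => x _; rewrite subrr expr0n.
- move=> i; rewrite (_ : nrm _ = 0)// /nrm2 -[RHS](Rintegral0 leb Omega).
  by apply: eq_Rintegral => x _; rewrite mxE subrr expr0n.
split => // i; apply: filterS (h2 i) => x + Ox => -> //; by rewrite mxE.
Qed.

(** Combinations of the approximating sequences approximate the combination.
    The chosen weak gradients are additive only up to a null set. *)
Lemma H01_lin u v c : H01 Omega u -> H01 Omega v ->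
  H01 Omega (fun x => u x + c * v x) /\
  forall i, {ae leb, forall x, Omega x -> wg (fun x => u x + c * v x) i x = wg u i x + c * wg v i x}.
Proof.
move=> hu hv; have [su [sgu [p [tp cp cgp]]]] := H01_approx hu.
have [sv [sgv [q [tq cq cgq]]]] := H01_approx hv.
have tpq k := testD (tp k) (testZ c (tq k)).
have pE k i x : partial i (fun x => p k x + c * q k x) x = partial i (p k) x + c * partial i (q k) x.
  have d1 := test_is_derive i x (tp k); have d2 := test_is_derive i x (tq k).
  have d3 := is_deriveZ c d2.
  have d := is_deriveD d1 d3; exact: (@derive_val _ _ _ _ _ _ _ d).
have [||||||h1 h2] := @H01_intro (fun x => u x + c * v x)
   (fun x => wgrad Omega u x + c *: wgrad Omega v x) (fun k x => p k x + c * q k x).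
- by move=> x nx; rewrite (H01_out hu nx) (H01_out hv nx) mulr0 addr0.
- exact: (sqintD mO su (sqintZ mO c sv)).
- move=> i; exact: ((is_wgrad_lin c su sv (H01_wgrad hu) (H01_wgrad hv)) i).1.
- exact: tpq.
- exact: (form_cvg_lin oform c (fun k => test_sq (tp k)) (fun k => test_sq (tq k)) su sv cp cq).
- move=> i.
  have h := form_cvg_lin oform c (fun k => test_sq (test_partial i (tp k))) (fun k => test_sq (test_partial i (tq k))) (sgu i) (sgv i) (cgp i) (cgq i).
  rewrite (_ : (fun k => _) = (fun k => nrm (fun x => partial i (p k) x + c * partial i (q k) x - (wg u i x + c * wg v i x)))); first exact: h.
  by apply/funext => k; apply: eq_Rintegral => x _; rewrite pE !mxE.
by split => // i; apply: filterS (h2 i) => x + Ox => -> //; rewrite !mxE.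
Qed.

Lemma gE_form : is_form (H01 Omega) gE.
Proof.
split.
- by move=> u v c hu hv; exact: (H01_lin c hu hv).1.
- by move=> u v; apply: eq_bigr => i _; exact: ipC.
- move=> u v w c hu hv hw; rewrite /gE mulr_sumr -big_split; apply: eq_bigr => i _ /=.
  have [huv aeuv] := H01_lin c hu hv.
  rewrite -(form_linl oform c (H01_wg i hu) (H01_wg i hv) (H01_wg i hw)).
  have sZ := sqintD mO (H01_wg i hu) (sqintZ mO c (H01_wg i hv)).
  exact: (ip_ae mO (H01_wg i huv) sZ (H01_wg i hw) (aeuv i)).
- by move=> u hu; apply: sumr_ge0 => i _; exact: nrm2_ge0.
Qed.

Let Hsub u v : H01 Omega u -> H01 Omega v -> H01 Omega (fun x => u x - v x).
Proof. exact: (form_sub gE_form). Qed.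

Lemma gE_test_sub u phi : H01 Omega u -> test phi ->
  dist2 gE phi u =
  \sum_(i < n) nrm (fun x => partial i phi x - wg u i x).
Proof.
move=> hu tphi; have [hphi aphi] := H01_test tphi.
have [] := H01_lin (-1) hphi hu.
rewrite (_ : (fun x => phi x + -1 * u x) = (fun x => phi x - u x)); last first.
  by apply/funext => x; rewrite mulN1r.
move=> hd ad; apply: eq_bigr => i _.
rewrite -[LHS]/(nrm (wg (fun x => phi x - u x) i)); apply: (nrm2_ae mO (H01_wg i hd)).
  exact: (sqintB mO (test_sq (test_partial i tphi)) (H01_wg i hu)).
by apply: filterS2 (aphi i) (ad i) => x h1 h2 Ox; rewrite h2// h1// mulN1r.
Qed.

Lemma gE_test phi : test phi -> gE phi phi = energy phi.
Proof.
move=> tphi; have [hphi aphi] := H01_test tphi.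
apply: eq_bigr => i _; rewrite -(nrm_test (test_partial i tphi)).
exact: (nrm2_ae mO (H01_wg i hphi) (test_sq (test_partial i tphi)) (aphi i)).
Qed.

Lemma H01_measurable u : H01 Omega u -> measurable_fun setT u.
Proof. by move=> hu; have [] := sqint_out mO (fun x => H01_out hu (x := x)) (H01_sq hu). Qed.

(** One sequence of test functions serves the density arguments, the passage to
    the limit in energy estimates, and Fatou's lemma. Outside [Omega] everything
    vanishes, so that the pointwise convergence holds on the whole space. *)
Lemma H01_seq u : H01 Omega u -> exists phi : nat -> V -> R,
  [/\ forall k, test (phi k), nrm (fun x => phi k x - u x) @[k --> \oo] --> (0 : R),
    dist2 gE (phi k) u @[k --> \oo] --> (0 : R),
    energy (phi k) @[k --> \oo] --> gE u u &
    {ae leb, forall x, phi k x @[k --> \oo] --> u x}].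
Proof.
move=> hu; have [su [sgu [p [tp cp cgp]]]] := H01_approx hu.
have [th hth ae] := nrm2_cvg_ae mO (fun k => test_sq (tp k)) su cp.
have cs : dist2 gE (p k) u @[k --> \oo] --> (0 : R).
  rewrite (funext (fun k => gE_test_sub hu (tp k))).
    exact: cvg_sum0 cgp.
exists (fun k => p (th k)); split; first by move=> k; exact: tp.
- exact: cvg_subseq hth cp.
- exact: cvg_subseq hth cs.
- have ce := form_cvg2 gE_form (fun k => (H01_test (tp k)).1) hu cs.
  by have := cvg_subseq hth ce; under eq_fun do rewrite gE_test//.
apply: filterS ae => x h; have [Ox|nx] := pselect (Omega x); first exact: h.
rewrite (H01_out hu nx) (_ : (fun k => _) = cst 0); first exact: cvg_cst.
by apply/funext => k; rewrite (test_out (tp _) nx).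
Qed.

Lemma H01_poincare : exists2 C : R, 0 < C &
  forall u, H01 Omega u -> nrm u <= C * gE u u.
Proof.
have [C C0 hC] := poincare_test n0 bOmega; exists C => // u hu.
have [p [tp cp _ ce _]] := H01_seq hu.
have c1 := form_cvg2 oform (fun k => test_sq (tp k)) (H01_sq hu) cp.
have c2 : C * energy (p k) @[k --> \oo] --> C * gE u u by apply: cvgM => //; exact: cvg_cst.
apply: (ler_cvg_to c1 c2); apply: nearW => k.
by rewrite -[ip _ _ _ _]/(nrm (p k)) (nrm_test (tp k)); exact: hC.
Qed.

(** Test functions [p_k] close to [u_k] form a Cauchy sequence of square-integrable
    functions by the Poincare inequality, and so do their partial derivatives. *)
Lemma H01_complete (u_ : nat -> V -> R) : (forall k, H01 Omega (u_ k)) ->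
  (forall e : R, 0 < e -> exists m0, forall m k, (m0 <= m)%N -> (m0 <= k)%N ->
     dist2 gE (u_ m) (u_ k) < e) ->
  exists2 u, H01 Omega u &
    dist2 gE (u_ k) u @[k --> \oo] --> (0 : R).
Proof.
move=> hu cau.
have den k : exists phi, test phi /\ dist2 gE phi (u_ k) < k.+1%:R^-1.
  have [phi [tphi _ cE _ _]] := H01_seq (hu k).
  have gE0 j := form_ge0 gE_form (Hsub (H01_test (tphi j)).1 (hu k)).
  have k0 : 0 < k.+1%:R^-1 :> R by rewrite invr_gt0.
  by have [m hm] := (cvg0_eps gE0).1 cE _ k0; exists (phi m); split => //; exact: hm.
move/choice: den => [p tp].
have hp k := (H01_test (tp k).1).1.
have cp : dist2 gE (p k) (u_ k) @[k --> \oo] --> (0 : R).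
  apply: squeeze0 (@cvg_harmonic R) => k; rewrite (form_ge0 gE_form); last exact: Hsub.
  by rewrite ltW//; exact: (tp k).2.
have aux (x y z w e : R) : x < e / 10 -> y < e / 10 -> z < e / 10 ->
    w <= 2 * x + 2 * z -> 2 * y + 2 * w < e by lra.
have cau2 e : 0 < e -> exists m0, forall m k, (m0 <= m)%N -> (m0 <= k)%N ->
    energy (fun x => p m x - p k x) < e.
  move=> e0; have e8 : 0 < e / 10 by rewrite divr_gt0.
  have [m1 h1] := cau _ e8.
  have [m2 h2] := (cvg0_eps (fun k => form_ge0 gE_form (Hsub (hp k) (hu k)))).1 cp _ e8.
  exists (maxn m1 m2) => m k; rewrite !geq_max => /andP[a1 a2] /andP[b1 b2].
  rewrite -gE_test; last exact: (testB (tp m).1 (tp k).1).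
  apply: le_lt_trans (form_triangle gE_form (hp m) (hu m) (hp k)) _.
  have H := form_triangle gE_form (hu m) (hu k) (hp k).
  rewrite (form_sub_swap gE_form (hu k) (hp k)) in H.
  exact: (aux _ _ _ _ _ (h1 m k a1 b1) (h2 m a2) (h2 k b2) H).
have [K K0 hK] := poincare_test n0 bOmega.
have [v sv cv] : exists2 v, sq v & nrm (fun x => p k x - v x) @[k --> \oo] --> (0 : R).
  apply: (nrm2_complete mO) => [k|e e0]; first exact: test_sq (tp k).1.
  have [|m0 h] := cau2 (e / K); first by rewrite divr_gt0.
  exists m0 => m k m0m m0k; have tpp := testB (tp m).1 (tp k).1.
  rewrite (nrm_test tpp); apply: le_lt_trans (hK _ tpp) _.
  by rewrite mulrC -ltr_pdivlMr//; exact: h.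
have exG (i : 'I_n) : exists g : V -> R, sq g /\ nrm (fun x => partial i (p k) x - g x) @[k --> \oo] --> (0 : R).
  have [||g sg cg] := @nrm2_complete _ _ _ leb Omega mO (fun k => partial i (p k)).
  - by move=> k; exact: test_sq (test_partial i (tp k).1).
  - move=> e e0; have [m0 h] := cau2 _ e0; exists m0 => m k m0m m0k.
    apply: le_lt_trans (h m k m0m m0k).
    have tpp := testB (tp m).1 (tp k).1.
    have pE : (fun x => partial i (p m) x - partial i (p k) x) = partial i (fun x => p m x - p k x).
      apply/funext => x.
      have d := is_deriveB (test_is_derive i x (tp m).1) (test_is_derive i x (tp k).1).
      by apply/esym; exact: (@derive_val _ _ _ _ _ _ _ d).
    rewrite pE (nrm_test (test_partial i tpp)) /energy (bigD1 i)//= lerDl.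
    by apply: sumr_ge0 => j _; exact: nrm2_ge0.
  by exists g.
move/choice: exG => [G sG].
pose u x := if x \in Omega then v x else 0.
have uv x : Omega x -> u x = v x by move=> Ox; rewrite /u mem_set.
have u0 x : ~ Omega x -> u x = 0 by move=> nx; rewrite /u memNset.
have su : sq u.
  apply: (sqint_bound mO _ sv); last by move=> x Ox; rewrite uv.
  by have [mv _] := sv; apply: eq_measurable_fun mv => x; rewrite inE => Ox; rewrite uv.
have [||||||h1 h2] := @H01_intro u (fun x => \row_i G i x) p.
- exact: u0.
- exact: su.
- by move=> i; have [+ _] := sG i; congr (sq _); apply/funext => x; rewrite mxE.
- by move=> k; exact: (tp k).1.
- rewrite (_ : (fun k => _) = (fun k => nrm (fun x => p k x - v x)))//.
  by apply/funext => k; apply: eq_Rintegral => x; rewrite inE => Ox; rewrite uv.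
- move=> i; have [_] := sG i; rewrite (_ : (fun k => nrm _) = (fun k => nrm (fun x => partial i (p k) x - (\row_j G j x) 0 i)))//.
  by apply/funext => k; apply: eq_Rintegral => x _; rewrite mxE.
exists u; first exact: h1.
have cpu : dist2 gE (p k) u @[k --> \oo] --> (0 : R).
  rewrite (_ : (fun k => _) = (fun k => \sum_(i < n) nrm (fun x => partial i (p k) x - G i x))); last first.
    apply/funext => k; rewrite gE_test_sub//; last exact: (tp k).1.
    have stp i := test_sq (test_partial i (tp k).1).
    apply: eq_bigr => i _; apply: (nrm2_ae mO (sqintB mO (stp i) (H01_wg i h1)) (sqintB mO (stp i) (sG i).1)).
    by apply: filterS (h2 i) => x h Ox; rewrite h// mxE.
    by apply: cvg_sum0 => i; exact: (sG i).2.
apply: squeeze0 (cvgD0 (cvgM0 2 cp) (cvgM0 2 cpu)) => k.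
rewrite (form_ge0 gE_form (Hsub (hu k) h1)) andTb.
rewrite -(form_sub_swap gE_form (hu k) (hp k)); exact: (form_triangle gE_form (hu k) (hp k) h1).
Qed.

End weak_gradient.

(** * Dyadic summation *)

Section dyadic.
Variables (R : realType).

Lemma dyadic_ge1 (t : R) : 1 <= t -> exists j : nat, 2 ^+ j <= t < 2 ^+ j.+1.
Proof.
move=> t1; have t0 : 0 <= t by exact: le_trans t1.
have /andP[h1 h2] := truncn_itv t0.
have m0 : (0 < truncn t)%N.
  by rewrite lt0n; apply: contraL t1 => /eqP m0; rewrite -ltNge; move: h2; rewrite m0.
have /andP[a b] := @trunc_log_bounds 2 (truncn t) isT m0.
exists (trunc_log 2 (truncn t)); rewrite -!natrX.
rewrite (le_trans _ h1) ?ler_nat//=.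
by apply: lt_le_trans h2 _; rewrite ler_nat.
Qed.

Lemma dyadic_le1 (t : R) : 0 < t <= 1 -> exists j : nat, 2^-1 ^+ j.+1 < t <= 2^-1 ^+ j.
Proof.
move=> /andP[t0 t1]; have [|j /andP[h1 h2]] := @dyadic_ge1 t^-1; first by rewrite invf_ge1.
exists j; rewrite !exprVn; apply/andP; split.
  by rewrite -[ltRHS]invrK ltf_pV2 ?posrE ?exprn_gt0 ?invr_gt0.
by rewrite -[leLHS]invrK lef_pV2 ?posrE ?exprn_gt0 ?invr_gt0.
Qed.

(** At each point the function is at most the sum of the series of the [h_ j],
    which is integrated term by term. *)
Lemma integral_le_geometric d (T : measurableType d)
    (mu : {measure set T -> \bar R}) (D : set T) (g : T -> R)
    (h_ : nat -> T -> R) (C q : R) : measurable D -> measurable_fun D g ->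
  (forall j, measurable_fun D (h_ j)) -> (forall j x, D x -> 0 <= h_ j x) ->
  (forall x, D x -> 0 <= g x) ->
  (forall x, D x -> exists j, g x <= h_ j x) -> 0 <= q < 1 -> 0 <= C ->
  (forall j, (\int[mu]_(x in D) (h_ j x)%:E <= (C * q ^+ j)%:E)%E) ->
  (\int[mu]_(x in D) (g x)%:E <= (C / (1 - q))%:E)%E.
Proof.
move=> mD mg mh h0 g0 gh /andP[q0 q1] C0 hC.
have mS : measurable_fun D (fun x => \sum_(0 <= k <oo) (h_ k x)%:E)%E.
  apply: (@ge0_emeasurable_sum _ _ _ D (fun k x => (h_ k x)%:E) xpredT).
    by move=> k x Dx _; rewrite lee_fin h0.
  by move=> k _; exact/measurable_EFinP.
apply: (@le_trans _ _ (\int[mu]_(x in D) \sum_(0 <= j <oo) (h_ j x)%:E)%E).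
  apply: ge0_le_integral => //.
  - exact/measurable_EFinP.
  move=> x Dx; have [j gj] := gh x Dx.
  have := @nneseries_lim_ge R (fun k => (h_ k x)%:E) xpredT 0 j.+1.
  have hx k : (0 <= (h_ k x)%:E)%E by rewrite lee_fin h0.
  move=> /(_ (fun k _ _ => hx k)); apply: le_trans.
  rewrite big_nat_recr//=; apply: (@le_trans _ _ (h_ j x)%:E); first by rewrite lee_fin.
  by rewrite leeDr//; apply: sume_ge0 => k _.
have mh' k : measurable_fun D (fun x => (h_ k x)%:E) by exact/measurable_EFinP.
have h0' k x : D x -> (0 <= (h_ k x)%:E)%E by move=> Dx; rewrite lee_fin h0.
rewrite (integral_nneseries mu mD mh' h0').
apply: (@le_trans _ _ (\sum_(0 <= j <oo) (C * q ^+ j)%:E)%E).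
  apply: lee_nneseries => [k _ _|k _]; last exact: hC.
  by apply: integral_ge0 => x Dx; rewrite lee_fin h0.
have c : (series (geometric C q)) @ \oo --> C / (1 - q).
  by apply: cvg_geometric_series; rewrite ger0_norm.
rewrite (_ : (\sum_(0 <= j <oo) _)%E = (C / (1 - q))%:E)//.
apply: (@cvg_lim) => //.
have : EFin \o series (geometric C q) @ \oo --> (C / (1 - q))%:E by exact: cvg_comp c _.
apply: cvg_trans; apply: near_eq_cvg; apply: nearW => k /=.
by rewrite /series /= -sumEFin.
Qed.

End dyadic.

(** * The Gagliardo form *)

Section kernel.
Variables (R : realType) (n : nat).
Local Notation V := 'rV[R]_n.
Variable s : R.
Hypothesis n0 : (0 < n)%N.
Hypothesis s01 : 0 < s < 1.
Local Notation p := (n%:R + 2 * s).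

Let s0 : 0 < s. Proof. by case/andP: s01. Qed.
Let s1 : s < 1. Proof. by case/andP: s01. Qed.
Let p0 : 0 < p. Proof. by rewrite ltr_wpDl// mulr_gt0. Qed.

Lemma measurable_enorm d (T : measurableType d) (D : set T) (g : T -> V) :
  (forall i, measurable_fun D (fun t => g t 0 i)) ->
  measurable_fun D (fun t => enorm (g t)).
Proof.
move=> mg; apply: (@measurableT_comp _ _ _ _ _ _ (Num.sqrt : R -> R)); first exact: continuous_measurable_fun (@sqrt_continuous R).
apply: measurable_sum => i; exact: measurable_funM.
Qed.

(** The half power of the kernel, so that the form is an inner product of
    difference quotients. *)
Definition dq (u : V -> R) (z : V * V) : R :=
  (u z.1 - u z.2) / enorm (z.1 - z.2) `^ (p / 2).

Lemma gagliardoE (u v : V -> R) z : gagliardo s u v z = dq u z * dq v z.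
Proof.
rewrite /gagliardo /dq mulf_div -powRD; last first.
  by apply/implyP => /eqP h; move: p0; lra.
congr (_ / _ `^ _); lra.
Qed.

Lemma dq_lin u v c z : dq (fun x => u x + c * v x) z = dq u z + c * dq v z.
Proof. by rewrite /dq mulrA -mulrDl; congr (_ / _); ring. Qed.

Lemma measurable_fst_coord (i : 'I_n) : measurable_fun setT (fun z : V * V => z.1 0 i).
Proof.
have mc : measurable_fun setT (fun x : V => x 0 i).
  by apply: borel_measurable_fun; exact: measurable_prodrV_coord.
exact: measurableT_comp mc measurable_fst.
Qed.

Lemma measurable_snd_coord (i : 'I_n) : measurable_fun setT (fun z : V * V => z.2 0 i).
Proof.
have mc : measurable_fun setT (fun x : V => x 0 i).
  by apply: borel_measurable_fun; exact: measurable_prodrV_coord.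
exact: measurableT_comp mc measurable_snd.
Qed.

Lemma measurable_kernel (q : R) : measurable_fun setT (fun z : V * V => enorm (z.1 - z.2) `^ q).
Proof.
apply: (measurableT_comp (measurable_powR q)); apply: measurable_enorm => i.
under eq_fun do rewrite !mxE.
by apply: measurable_funB; [exact: measurable_fst_coord|exact: measurable_snd_coord].
Qed.

Lemma measurable_dq u : measurable_fun setT u -> measurable_fun setT (dq u).
Proof.
move=> mu; apply: measurable_funM.
  by apply: measurable_funB; [exact: measurableT_comp mu measurable_fst|exact: measurableT_comp mu measurable_snd].
under eq_fun do rewrite -powRN.
exact: measurable_kernel.
Qed.

Lemma measurable_min_kernel :
  measurable_fun setT (fun z : V => Num.min 1 (`|z| ^+ 2) / enorm z `^ p).
Proof.
apply: measurable_funM.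
  apply: measurable_minr; first exact: measurable_cst.
  apply: measurable_funX.
  by apply: continuous_leb; exact: norm_continuous.
under eq_fun do rewrite -powRN.
apply: (measurableT_comp (measurable_powR _)); apply: measurable_enorm => i.
by apply: borel_measurable_fun; exact: measurable_prodrV_coord.
Qed.

(** Where [|z|] is of order [2 ^ - j] the integrand is of order
    [2 ^ (j * (n + 2 * s - 2))], and where it is of order [2 ^ j] the integrand is
    of order [2 ^ (- j * (n + 2 * s))]. Multiplied by the volumes of the cubes,
    these become geometric sequences of ratios [2 ^ - (2 - 2 * s)] and
    [2 ^ - (2 * s)], both less than [1] since [0 < s < 1]. *)
Lemma kernel_integrable : exists2 K : R, 0 <= K &
  (\int[leb]_z (Num.min 1 (`|z| ^+ 2) / enorm (z : V) `^ p)%:E <= K%:E)%E.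
Proof.
pose q1 : R := 2^-1 `^ (2 - 2 * s); pose q2 : R := 2^-1 `^ (2 * s).
have half_pow (t : R) : 0 < t -> 0 <= (2^-1 : R) `^ t < 1.
  move=> t0; rewrite powR_ge0/= /powR gt_eqF ?invr_gt0// expR_lt1 pmulr_rlt0//.
  by rewrite ln_lt0// invr_gt0 invf_lt1 ?ltr1n// ltr0n.
have q1l : 0 <= q1 < 1.
  apply: half_pow; move: s1; lra.
have q2l : 0 <= q2 < 1.
  apply: half_pow; move: s0; lra.
pose q := Num.max q1 q2.
have ql : 0 <= q < 1 by rewrite le_max gt_max; move: q1l q2l => /andP[-> ->] /andP[_ ->].
pose a (j : nat) : R := (2^-1 ^+ j) ^+ 2 / (2^-1 ^+ j.+1) `^ p.
pose b (j : nat) : R := (2 ^+ j) `^ (- p).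
pose h (j : nat) (z : V) : R := a j * \1_(@cube R n (2^-1 ^+ j)) z + b j * \1_(@cube R n (2 ^+ j.+1)) z.
pose C : R := 2 ^+ n * 2 `^ p + 4 ^+ n.
have a0 j : 0 <= a j by rewrite divr_ge0 ?powR_ge0// sqr_ge0.
have b0 j : 0 <= b j by exact: powR_ge0.
have mc r : measurable (@cube R n r) by apply: borel_measurable; exact: measurable_cube.
have C0 : 0 <= C by rewrite addr_ge0 ?mulr_ge0 ?powR_ge0 ?exprn_ge0.
exists (C / (1 - q)).
  by rewrite divr_ge0// subr_ge0; case/andP: ql => _ /ltW.
have cubeE r (z : V) : 0 <= r -> `|z| <= r -> \1_(@cube R n r) z = 1 :> R.
  move=> r0 zr; rewrite indicE mem_set// => i; apply: le_trans zr; exact: ler_coord.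
apply: (@integral_le_geometric R _ _ leb setT _ h C q measurableT _ _ _ _ _ ql C0).
- exact: measurable_min_kernel.
- by move=> j; apply: measurable_funD; (apply: measurable_funM; [exact: measurable_cst|exact: measurable_indic]).
- by move=> j z _; rewrite addr_ge0// mulr_ge0.
- move=> z _; rewrite divr_ge0 ?powR_ge0// le_min ler01 sqr_ge0//.
- move=> z _; have [->|z_neq0] := eqVneq z 0.
    exists 0%N; rewrite normr0 expr0n/= (min_idPr _)// mul0r addr_ge0// mulr_ge0//.
  have z0 : 0 < `|z| by rewrite normr_gt0.
  have ez0 : 0 < enorm z by apply: lt_le_trans z0 (norm_le_enorm z).
  have [z1|z1] := leP `|z| 1.
    have [|j /andP[j1 j2]] := @dyadic_le1 R `|z|; first by rewrite z0.
    exists j; rewrite /h cubeE// ?exprn_ge0//.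
    rewrite mulr1 -[leLHS]addr0 lerD ?mulr_ge0//.
    apply: ler_pM; rewrite ?invr_ge0 ?powR_ge0// ?le_min ?ler01 ?sqr_ge0//.
      by rewrite ge_min; apply/orP; right; rewrite lerXn2r ?nnegrE ?exprn_ge0.
    apply: powRV_le; rewrite ?exprn_gt0 ?(ltW p0)//.
    exact: le_trans (ltW j1) (norm_le_enorm z).
  have [|j /andP[j1 j2]] := @dyadic_ge1 R `|z|; first exact: ltW.
  exists j; rewrite /h [X in _ + _ * X]cubeE ?exprn_ge0 ?(ltW j2)//.
  rewrite mulr1 -[leLHS]add0r lerD ?mulr_ge0// /b powRN.
  rewrite -[leRHS]mul1r; apply: ler_pM; rewrite ?invr_ge0 ?powR_ge0// ?le_min ?ler01 ?sqr_ge0// ?ge_min ?lexx//.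
  apply: powRV_le; rewrite ?exprn_gt0 ?(ltW p0)//.
  exact: le_trans j1 (norm_le_enorm z).
move=> j.
have ii (r c : R) : 0 <= r -> 0 <= c ->
    (\int[leb]_z (c * \1_(@cube R n r) (z : V))%:E <= (c * (2 * r) ^+ n)%:E)%E.
  move=> r0 c0; under eq_integral do rewrite EFinM.
  rewrite ge0_integralZl//; last exact/measurable_EFinP/measurable_indic.
  rewrite integral_indic// setIT [leRHS]EFinM lee_wpmul2l ?lee_fin//.
  apply: leb_norm_le => // x xr; exact: norm_rV_le.
under eq_integral do rewrite EFinD.
rewrite ge0_integralD//; last 4 first.
- by move=> x _; rewrite lee_fin mulr_ge0.
- by apply/measurable_EFinP; apply: measurable_funM => //; exact: measurable_indic.
- by move=> x _; rewrite lee_fin mulr_ge0.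
- by apply/measurable_EFinP; apply: measurable_funM => //; exact: measurable_indic.
apply: le_trans (leeD (ii _ _ (exprn_ge0 j _) (a0 j)) (ii _ _ (exprn_ge0 j.+1 _) (b0 j))) _; rewrite ?invr_ge0//.
rewrite -EFinD lee_fin /C.
have h2 : 0 < (2^-1 : R) by rewrite invr_gt0.
have e1 : a j * (2 * 2^-1 ^+ j) ^+ n = 2 ^+ n * 2 `^ p * q1 ^+ j.
  have -> : q1 ^+ j = (2^-1 ^+ j) `^ (2 - 2 * s).
    by rewrite -powR_mulrn ?powR_ge0// /q1 -powRrM mulrC powRrM powR_mulrn// ltW.
  set r := 2^-1 ^+ j; have r0 : 0 < r by rewrite exprn_gt0.
  rewrite /a [2^-1 ^+ j.+1]exprS -/r powRM ?(ltW h2) ?(ltW r0)//.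
  have -> : 2^-1 `^ p = (2 `^ p)^-1 by rewrite -powR_inv1// -powRrM mulrC mulrN1 powRN.
  rewrite exprMn invfM invrK.
  have -> : r `^ (2 - 2 * s) = r ^+ 2 * r ^+ n / r `^ p.
    rewrite -!powR_mulrn ?(ltW r0)// -powRN -!powRD ?(gt_eqF r0) ?implybT//.
    by congr (_ `^ _); ring.
  by ring.
have e2 : b j * (2 * 2 ^+ j.+1) ^+ n = 4 ^+ n * q2 ^+ j.
  have -> : q2 ^+ j = (2 ^+ j) `^ (- (2 * s)).
    rewrite -powR_mulrn ?powR_ge0// /q2 -powRrM -[2^-1]powR_inv1// -powRrM.
    by rewrite -[2 ^+ j]powR_mulrn// -powRrM; congr (_ `^ _); ring.
  set r := 2 ^+ j; have r0 : 0 < r by rewrite exprn_gt0.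
  rewrite /b [2 ^+ j.+1]exprS -/r mulrA exprMn (_ : 2 * 2 = 4); last by ring.
  rewrite mulrCA; congr (_ * _); rewrite -powR_mulrn ?(ltW r0)// -powRD ?(gt_eqF r0) ?implybT//.
  by congr (_ `^ _); ring.
rewrite e1 e2 [leRHS]mulrDl lerD// ler_wpM2l ?mulr_ge0 ?powR_ge0 ?exprn_ge0//.
  rewrite lerXn2r ?nnegrE// ?le_max ?lexx ?powR_ge0//.
by rewrite lerXn2r ?nnegrE// ?le_max ?lexx ?powR_ge0 ?orbT.
Qed.

Section tests.
Variable Omega : set V.
Hypothesis bOmega : bounded_set Omega.

(** The substitution of the increment for the second variable separates the
    kernel from the function. *)
Lemma dq_test : exists2 C : R, 0 <= C & forall phi, test_function Omega phi ->
  sqint (leb \x leb)%E setT (dq phi) /\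
  nrm2 (leb \x leb)%E setT (dq phi) <= C * energy phi.
Proof.
have [K /ltW K0 hK] := poincare_test n0 bOmega.
have [I I0 hI] := kernel_integrable.
pose L := n%:R + 4 * K.
have L0 : 0 <= L by rewrite addr_ge0// mulr_ge0.
exists (L * I); first exact: mulr_ge0.
move=> phi tphi; have mphi := test_measurable tphi; have sphi := test_sqint tphi.
have mdq := measurable_dq mphi.
have mdq2 : measurable_fun setT (fun z => dq phi z ^+ 2) by exact: measurable_funX.
suff H : (\int[(leb \x leb)%E]_z (dq phi z ^+ 2)%:E <= (L * I * energy phi)%:E)%E.
  have [i1 i2] := bounded_integrable measurableT mdq2 (fun z _ => sqr_ge0 _) H.
  by split; [split|].
have E0 := energy_ge0 phi.
rewrite (fubini_tonelli1 (fun z => (dq phi z ^+ 2)%:E)); last 2 first.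
- exact/measurable_EFinP.
- by move=> z; rewrite lee_fin sqr_ge0.
(* The first variable is the base point, the second one the increment. *)
pose H (w : V * V) : R := (phi (w.2 + w.1) - phi w.1) ^+ 2 / enorm w.2 `^ p.
have H0 w : 0 <= H w by rewrite divr_ge0 ?sqr_ge0 ?powR_ge0.
have mH : measurable_fun setT H.
  apply: measurable_funM.
    apply: measurable_funX; apply: measurable_funB; last exact: measurableT_comp mphi measurable_fst.
    have mb := continuous_borel (test_continuous tphi).
    have ms : measurable_fun setT ((fun w : V * V => w.2 + w.1) : V * V -> Defs.prodrV R n).
      apply: measurable_fun_prodrV => i /=.
      rewrite (_ : _ \o _ = (fun w : V * V => w.2 0 i + w.1 0 i)).
        by apply: measurable_funD; [exact: measurable_snd_coord|exact: measurable_fst_coord].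
      by apply/funext => w /=; rewrite mxE.
    exact: measurableT_comp mb ms.
  under eq_fun do rewrite -powRN.
  apply: (measurableT_comp (measurable_powR _)); apply: measurable_enorm => i.
  exact: measurable_snd_coord.
have -> : (\int[leb]_x fubini_F leb (fun z => (dq phi z ^+ 2)%:E) x =
    \int[leb]_x \int[leb]_z (H (x, z))%:E)%E.
  apply: eq_integral => x _; rewrite /fubini_F.
  rewrite -(@ge0_integral_shift R n x (fun y => (dq phi (x, y) ^+ 2)%:E)); last 2 first.
  - apply/measurable_EFinP; exact: (measurableT_comp mdq2 (pair1_measurable x)).
  - by move=> y; rewrite lee_fin sqr_ge0.
  apply: eq_integral => z _; congr (_%:E); rewrite /dq /H /= exprMn -sqrrN opprB.
  rewrite opprD addrCA subrr addr0 enormN exprVn; congr (_ * _^-1).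
  rewrite expr2 -powRD; first by congr (_ `^ _); lra.
  by apply/implyP => /eqP h; move: p0; lra.
rewrite (fubini_tonelli (fun w => (H w)%:E)); last 2 first.
- exact/measurable_EFinP.
- by move=> w; rewrite lee_fin.
have inner z : (\int[leb]_x (H (x, z))%:E <=
    (L * energy phi)%:E * (Num.min 1 (`|z| ^+ 2) / enorm z `^ p)%:E)%E.
  have sd : sqint leb setT (fun x => phi (x + z) - phi x).
    exact: (sqintB measurableT (sqint_shift z sphi) sphi).
  have sdZ := integrableZl measurableT (enorm z `^ p)^-1 sd.2.
  have -> : (\int[leb]_x (H (x, z))%:E = ((enorm z `^ p)^-1 * nrm2 leb setT (fun x => phi (x + z) - phi x))%:E)%E.
    have := @RintegralZl _ _ _ leb setT (fun x => (phi (x + z) - phi x) ^+ 2) (enorm z `^ p)^-1 measurableT sd.2.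
    rewrite /nrm2 => <-; rewrite -integral_Rintegral; [|exact: measurableT|exact: sdZ].
    by apply: eq_integral => x _; congr (_%:E); rewrite /H /= mulrC [z + x]addrC.
  rewrite -EFinM lee_fin mulrA [leRHS]mulrC ler_wpM2l ?invr_ge0 ?powR_ge0//.
  have h1 := nrm2_diff z tphi.
  (* Large increments are controlled by the Poincare inequality. *)
  have h2 : nrm2 leb setT (fun x => phi (x + z) - phi x) <= 4 * K * energy phi.
    have -> : (fun x => phi (x + z) - phi x) = (fun x => phi (x + z) + (-1) * phi x).
      by apply/funext => x; rewrite mulN1r.
    apply: le_trans (form_lin_le (ip_form leb measurableT) (-1) (sqint_shift z sphi) sphi) _.
    rewrite -[ip _ _ _ _ in X in X + _]/(nrm2 leb setT (fun x => phi (x + z))) (nrm2_shift z mphi).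
    rewrite -[ip _ _ _ _]/(nrm2 leb setT phi) sqrrN expr1n mul1r.
    by have := hK phi tphi; lra.
  have z2 : 0 <= `|z| ^+ 2 by exact: sqr_ge0.
  have nn : 0 <= n%:R :> R by [].
  case: (leP 1 (`|z| ^+ 2)) => z1; rewrite /L.
    by apply: le_trans h2 _; rewrite mulr1 ler_wpM2r// lerDr.
  apply: le_trans h1 _; rewrite -mulrA [X in _ * X]mulrC mulrA ler_wpM2r// ler_wpM2r// lerDl.
  exact: mulr_ge0.
apply: (@le_trans _ _ (\int[leb]_z ((L * energy phi)%:E * (Num.min 1 (`|z| ^+ 2) / enorm (z : V) `^ p)%:E))%E).
  apply: ge0_le_integral; first exact: measurableT.
  - by move=> z _; apply: integral_ge0 => x _; rewrite lee_fin.
  - have := @measurable_fun_fubini_tonelli_G _ _ _ _ R leb (fun w : V * V => (H w)%:E).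
    by apply => [|w]; [exact/measurable_EFinP|rewrite lee_fin].
  - apply: emeasurable_funM; first exact: measurable_cst.
    by apply/measurable_EFinP; exact: measurable_min_kernel.
  - by move=> z _; exact: inner.
rewrite (ge0_integralZl _ measurableT); last 3 first.
- by apply/measurable_EFinP; exact: measurable_min_kernel.
- by move=> z _; rewrite lee_fin divr_ge0 ?powR_ge0// le_min ler01 sqr_ge0.
- by rewrite lee_fin mulr_ge0.
rewrite -[X in (_ <= X%:E)%E]mulrAC [X in (_ <= X)%E]EFinM lee_wpmul2l// lee_fin mulr_ge0//.
Qed.

End tests.

End kernel.

Section gagliardo_form.
Variables (R : realType) (n : nat) (Omega : set 'rV[R]_n) (s : R).
Local Notation V := 'rV[R]_n.
Hypothesis n0 : (0 < n)%N.
Hypothesis oOmega : open Omega.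
Hypothesis bOmega : bounded_set Omega.
Hypothesis s01 : 0 < s < 1.
Local Notation H := (H01 Omega).
Local Notation gE := (gE Omega).
Local Notation leb2 := (leb \x leb)%E.
Implicit Types (u v phi : V -> R).

Let hE : is_form H gE. Proof. exact: gE_form. Qed.

(** The product of a null set with the whole space is a null set of the product,
    on either side. *)
Lemma ae_pair (P : V -> Prop) : {ae leb, forall x, P x} ->
  {ae leb2, forall z : V * V, P z.1 /\ P z.2}.
Proof.
move=> [N [mN N0 sub]]; apply: filterI.
  exists (N `*` setT); split.
  - exact: measurableX.
  - by apply: etrans (product_measure1E _ _ mN measurableT) _; rewrite [X in (X * _)%E]N0 mul0e.
  - by move=> [x y] /= nx; split=> //; exact: sub.
exists (setT `*` N); split.
- exact: measurableX.
- by apply: etrans (product_measure1E _ _ measurableT mN) _; rewrite [X in (_ * X)%E]N0 mule0.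
- by move=> [x y] /= nx; split=> //; exact: sub.
Qed.

(** The bound for test functions passes to the limit by Fatou's lemma. *)
Lemma dq_H01 : exists2 C : R, 0 <= C & forall u, H u ->
  sqint leb2 setT (dq s u) /\ nrm2 leb2 setT (dq s u) <= C * gE u u.
Proof.
have [C C0 hC] := dq_test n0 s01 bOmega; exists C => // u hu.
have [phi [tphi _ _ ce ae]] := H01_seq oOmega bOmega hu.
have ae2 : {ae leb2, forall z, setT z -> dq s (phi k) z @[k --> \oo] --> dq s u z}.
  apply: filterS (ae_pair ae) => z [h1 h2] _; apply: cvgM; last exact: cvg_cst.
  exact: cvgB.
have mdu := measurable_dq s (H01_measurable oOmega bOmega hu).
have cC : C * energy (phi k) @[k --> \oo] --> C * gE u u by apply: cvgM => //; exact: cvg_cst.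
by apply: (fatou_sqint measurableT _ mdu ae2 _ cC) => k; have [] := hC _ (tphi k).
Qed.

Lemma fracl_const_ge0 : 0 <= fracl_const n s :> R.
Proof.
rewrite invr_ge0; apply: Rintegral_ge0 => x _.
by rewrite divr_ge0 ?powR_ge0// subr_ge0 cos_le1.
Qed.

(** The left-hand side of the weak formulation, the double integral being an
    inner product of difference quotients. *)
Definition mixed u v : R :=
  gE u v + fracl_const n s / 2 * ip leb2 setT (dq s u) (dq s v).

Lemma sqint_dq u : H u -> sqint leb2 setT (dq s u).
Proof. by move=> hu; have [C _ h] := dq_H01; exact: (h u hu).1. Qed.

Lemma mixed_form : is_form H mixed.
Proof.
have [h1 h2 h3 h4] := hE; split.
- exact: h1.
- by move=> u v; rewrite /mixed h2; congr (_ + _ * _); exact: ipC.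
- move=> u v w c hu hv hw; rewrite /mixed (h3 _ _ _ _ hu hv hw).
  have su := sqint_dq hu; have sv := sqint_dq hv; have sw := sqint_dq hw.
  have -> : dq s (fun x => u x + c * v x) = (fun z => dq s u z + c * dq s v z).
    by apply/funext => z; exact: dq_lin.
  rewrite (form_linl (ip_form leb2 measurableT) c su sv sw).
  move: (gE u w) (gE v w) (ip _ _ _ (dq s w)) (ip _ _ (dq s v) _) => a b i1 i2; ring.
- move=> u hu; rewrite addr_ge0//; first exact: h4.
  by rewrite mulr_ge0 ?divr_ge0 ?fracl_const_ge0//; exact: nrm2_ge0.
Qed.

Lemma mixed_lower u : gE u u <= mixed u u.
Proof.
by rewrite /mixed lerDl mulr_ge0 ?divr_ge0 ?fracl_const_ge0//; exact: nrm2_ge0.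
Qed.

(** Together with [mixed_lower] this makes the mixed energy equivalent to the
    Dirichlet energy, so that completeness, density and the Poincare inequality
    are inherited. *)
Lemma mixed_upper : exists2 K : R, 0 < K & forall u, H u -> mixed u u <= K * gE u u.
Proof.
have [C C0 h] := dq_H01; exists (1 + fracl_const n s / 2 * C).
  by rewrite ltr_pwDl// mulr_ge0// divr_ge0// fracl_const_ge0.
move=> u hu; rewrite mulrDl mul1r /mixed lerD2l -[leRHS]mulrA ler_wpM2l ?divr_ge0 ?fracl_const_ge0//.
exact: (h u hu).2.
Qed.

Lemma mixedE u v : H u -> H v ->
  leb2.-integrable setT (fun z => (gagliardo s u v z)%:E) /\
  \int[leb]_(x in Omega) dotp (wgrad Omega u x) (wgrad Omega v x) +
    fracl_const n s / 2 * \int[leb2]_z gagliardo s u v z = mixed u v.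
Proof.
move=> hu hv; split.
  apply: eq_integrable (sqintM measurableT (sqint_dq hu) (sqint_dq hv)) => // z _.
  by rewrite /= (gagliardoE s01).
rewrite (gE_dotp oOmega bOmega hu hv); congr (_ + _ * _).
by apply: eq_Rintegral => z _; rewrite (gagliardoE s01).
Qed.

(** Both parts of the energy are compared pointwise, since the truncation is
    nondecreasing with slope at most [1]. This is the only lattice property of the
    form on which the comparison of solutions rests. *)
Lemma mixed_sramp phi k c : 0 < k -> 0 <= c -> test_function Omega phi ->
  mixed (sramp k c \o phi) (sramp k c \o phi) <= mixed phi (sramp k c \o phi).
Proof.
move=> k0 c0 tphi; have tr := test_sramp k0 c0 tphi.
have kn0 : k != 0 by rewrite gt_eqF.
have [hphi aphi] := H01_test oOmega bOmega tphi.
have [hr ar] := H01_test oOmega bOmega tr.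
have mO := open_leb oOmega.
have sp i := test_sq oOmega (test_partial i tphi).
have sr i := test_sq oOmega (test_partial i tr).
have wphi i := H01_wg oOmega bOmega i hphi.
have wr i := H01_wg oOmega bOmega i hr.
apply: lerD.
  apply: ler_sum => i _.
  rewrite (ip_ae mO (wr i) (sr i) (wr i) (ar i)) ipC.
  rewrite (ip_ae mO (wr i) (sr i) (sr i) (ar i)).
  rewrite (ip_ae mO (wphi i) (sp i) (wr i) (aphi i)) ipC.
  rewrite (ip_ae mO (wr i) (sr i) (sp i) (ar i)).
  apply: le_Rintegral; [exact: mO|exact: (sqintM mO (sr i) (sr i))|exact: (sqintM mO (sr i) (sp i))|].
  move=> x _.
  have -> : partial i (sramp k c \o phi) x = dsramp k c (phi x) * partial i phi x.
    have [d _] := test_is_derive i x tphi.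
    exact: (partial_comp (fun t => is_derive_sramp c t kn0) d).
  have /andP[d0 d1] := dsramp_itv k c (phi x).
  set d := dsramp _ _ _ in d0 d1 *; set p := partial i phi x.
  rewrite -[leRHS]mulrA -[leLHS]mulrA ler_wpM2l// mulrCA ler_piMl// -expr2 sqr_ge0//.
apply: ler_wpM2l; first by rewrite divr_ge0 ?fracl_const_ge0.
apply: le_Rintegral; [exact: measurableT|exact: (sqintM measurableT (sqint_dq hr) (sqint_dq hr))|exact: (sqintM measurableT (sqint_dq hphi) (sqint_dq hr))|].
move=> z _; rewrite -!(gagliardoE s01) /gagliardo ler_wpM2r ?invr_ge0 ?powR_ge0//.
by rewrite -expr2; exact: sramp_contract.
Qed.

End gagliardo_form.

(** * A singular weight near a graph *)

(** A weight of order [d ^ - zeta] on [W], where [d] is a height that decreases at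
    unit speed along [e] and every point of [W] leaves [Omega] when it is moved
    along [e] by its height. The set [W] is cut into the layers where [d] is at
    most [tau * 2 ^ - j]. *)
Section layers.
Variables (R : realType) (n : nat) (Omega : set 'rV[R]_n).
Local Notation V := 'rV[R]_n.
Variables (W : set V) (d : V -> R) (e : V) (tau M zeta c : R) (g : V -> R).
Hypothesis mW : measurable W.
Hypothesis WM : forall x, W x -> `|x| <= M.
Hypothesis e1 : `|e| <= 1.
Hypothesis md : measurable_fun setT d.
Hypothesis dshift : forall x t, d (x + t *: e) = d x - t.
Hypothesis tau0 : 0 < tau.
Hypothesis dW : forall x, W x -> 0 < d x <= tau.
Hypothesis exitW : forall x t, W x -> d x <= t <= tau -> ~ Omega (x + t *: e).
Hypothesis zeta01 : 0 <= zeta < 1.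
Hypothesis c0 : 0 <= c.
Hypothesis mg : measurable_fun W g.
Hypothesis g0 : forall x, W x -> 0 <= g x.
Hypothesis gd : forall x, W x -> g x <= c * d x `^ (- zeta).

Let h (j : nat) : R := tau * 2^-1 ^+ j.

Let h0 j : 0 < h j.
Proof. by rewrite mulr_gt0// exprn_gt0. Qed.

Let A (j : nat) : set V := W `&` [set x | d x <= h j].

Let mA j : measurable (A j).
Proof.
apply: measurableI => //; rewrite -[X in measurable X]setTI.
have := md measurableT (measurable_itv `]-oo, h j]).
by congr measurable; apply/seteqP; split => x /=; rewrite in_itv.
Qed.

(** The translates of a layer by the multiples of its thickness are disjoint, and
    [2 ^ j] of them fit into a fixed cube. *)
Let measA (j : nat) : (leb (A j) <= ((2 * (`|M| + tau)) ^+ n * 2^-1 ^+ j)%:E)%E.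
Proof.
pose B (m : nat) : set V := shiftX (- ((m%:R * h j) *: e)) (A j).
have Bd m x : B m x -> - (m%:R * h j) < d x <= h j - m%:R * h j.
  rewrite /B /shiftX /= => -[/dW /andP[+ _]].
  rewrite -!scaleNr /= !dshift.
  by set a := m%:R * h j; set b := h j; move=> ? ?; apply/andP; split; lra.
have mB m : measurable (B m) by exact: measurable_shiftX.
have lB m : leb (B m) = leb (A j) by exact: leb_shift.
have tB : trivIset setT B.
  apply/trivIsetP => m k _ _; wlog mk : m k / (m < k)%N.
    move=> H mk; have := mk; rewrite neq_ltn => /orP[lt|lt]; first exact: H.
    by rewrite setIC; apply: H => //; rewrite eq_sym.
  move=> _; apply/seteqP; split => x //= -[/Bd /andP[h1 _] /Bd /andP[_ h2]].
  have : m.+1%:R * h j <= k%:R * h j by rewrite ler_wpM2r ?ler_nat// ltW.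
  by rewrite -natr1; lra.
have := @leb_norm_le R n (`|M| + tau) (\big[setU/set0]_(m < 2 ^ j) B m).
rewrite measure_bigsetU// (eq_bigr (fun=> leb (A j))); last by move=> m _; exact: lB.
have Afin : leb (A j) \is a fin_num.
  rewrite ge0_fin_numE//; apply: bounded_leb_fin => //.
  by exists M; split; [exact: num_real|move=> M' MM' x [/WM xM _]; exact: (le_trans xM (ltW MM'))].
rewrite -(fineK Afin) sumEFin sumr_const card_ord !lee_fin -[_ *+ (2 ^ j)]mulr_natr natrX.
move=> H; have {}H : fine (leb (A j)) * 2 ^+ j <= (2 * (`|M| + tau)) ^+ n.
  apply: H; first by apply: bigsetU_measurable.
    by rewrite addr_ge0// ltW.
  move=> x; rewrite -bigcup_mkord => -[m /= mj [Wx _]].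
  rewrite -[x](subrK ((m%:R * h j) *: e)); apply: le_trans (ler_normD _ _) _.
  apply: lerD; first by rewrite (le_trans (WM Wx))// ler_norm.
  have mh0 : 0 <= m%:R * h j by rewrite mulr_ge0// ltW.
  have mh : m%:R * h j <= tau.
    rewrite /h mulrCA -[leRHS]mulr1 ler_wpM2l ?(ltW tau0)//.
    rewrite exprVn ler_pdivrMr ?exprn_gt0// mul1r.
    by rewrite -natrX ler_nat ltnW.
  rewrite normrZ (ger0_norm mh0); apply: le_trans mh.
  by rewrite -[leRHS]mulr1 ler_wpM2l.
by rewrite exprVn ler_pdivlMr// exprn_gt0.
Qed.

(** Functions that vanish outside [Omega] vanish at the end of the shift. *)
Let sqrA (j : nat) phi : test_function Omega phi ->
  (\int[leb]_(x in A j) (phi x ^+ 2)%:E <= (n%:R * h j ^+ 2 * energy phi)%:E)%E.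
Proof.
move=> tphi; pose z := h j *: e.
have sd : sqint leb setT (fun x => phi (x + z) - phi x).
  exact: (sqintB measurableT (sqint_shift z (test_sqint tphi)) (test_sqint tphi)).
apply: (@le_trans _ _ (nrm2 leb setT (fun x => phi (x + z) - phi x))%:E).
  rewrite -(integral_Rintegral measurableT sd.2).
  have -> : (\int[leb]_(x in A j) (phi x ^+ 2)%:E = \int[leb]_(x in A j) ((phi (x + z) - phi x) ^+ 2)%:E)%E.
    apply: eq_integral => x; rewrite inE => -[Wx dx]; congr (_%:E).
    rewrite (test_out (x := x + z) tphi) ?sub0r ?sqrrN//; apply: exitW => //.
    rewrite dx /h ler_piMr ?(ltW tau0)// exprn_ile1//.
    by rewrite invf_le1// ler1n.
  apply: (@ge0_subset_integral _ _ _ leb (A j) setT (mA j) measurableT (fun x => ((phi (x + z) - phi x) ^+ 2)%:E)).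
  - by apply/measurable_EFinP; apply: measurable_funX; exact: sd.1.
  - by move=> x _; rewrite lee_fin sqr_ge0.
  - by [].
rewrite lee_fin; apply: le_trans (nrm2_diff z tphi) _.
rewrite ler_wpM2r ?energy_ge0// ler_wpM2l// lerXn2r ?nnegrE// ?(ltW (h0 _))//.
by rewrite /z normrZ gtr0_norm// ler_piMr// ltW.
Qed.

Let q : R := 2 `^ (zeta - 1).

Let q01 : 0 <= q < 1.
Proof.
rewrite powR_ge0/= /q /powR gt_eqF// expR_lt1 pmulr_llt0 ?ln_gt0 ?ltr1n//.
by case/andP: zeta01 => _; rewrite subr_lt0.
Qed.

Let layer_of x : W x -> exists j, A j x /\ g x <= c * h j.+1 `^ (- zeta).
Proof.
move=> Wx; have /andP[d0 dt] := dW Wx.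
have [|j /andP[h1 h2]] := @dyadic_le1 R (d x / tau).
  by rewrite divr_gt0//= ler_pdivrMr// mul1r.
exists j; split; first by split => //=; rewrite /h mulrC -ler_pdivrMr.
apply: le_trans (gd Wx) _; rewrite ler_wpM2l// !powRN; have /andP[z0 _] := zeta01.
by apply: powRV_le; rewrite // /h mulrC -ler_pdivlMr// ltW.
Qed.

Let hpow j : h j.+1 `^ (- zeta) * 2^-1 ^+ j = tau `^ (- zeta) * 2 `^ zeta * q ^+ j.
Proof.
rewrite /h powRM ?exprn_ge0 ?(ltW tau0)// -!mulrA; congr (_ * _).
have E m : 2^-1 ^+ m = 2 `^ (- m%:R) :> R by rewrite exprVn powRN powR_mulrn.
rewrite !E -(powR_mulrn j) ?powR_ge0// /q -!powRrM.
rewrite -powRD ?pnatr_eq0 ?implybT// -powRD ?pnatr_eq0 ?implybT//.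
by congr (_ `^ _); rewrite -natr1; ring.
Qed.

(** Points of height of order [2 ^ - j] carry a weight of order [2 ^ (j * zeta)],
    so a mass of order [2 ^ - j] on each layer is enough for a geometric series. *)
Let layered (w : V -> R) (L : R) : measurable_fun W w -> (forall x, 0 <= w x) -> 0 <= L ->
  (forall j, (\int[leb]_(x in A j) (w x)%:E <= (L * 2^-1 ^+ j)%:E)%E) ->
  (\int[leb]_(x in W) (g x * w x)%:E <=
    (c * (tau `^ (- zeta) * 2 `^ zeta) / (1 - q) * L)%:E)%E.
Proof.
move=> mw w0 L0 wL; rewrite mulrAC.
pose f_ j x := (c * h j.+1 `^ (- zeta)) * (w x * \1_(A j) x).
have ch j : 0 <= c * h j.+1 `^ (- zeta) by rewrite mulr_ge0 ?powR_ge0.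
have mf j : measurable_fun W (fun x => w x * \1_(A j) x).
  by apply: measurable_funM; [exact: mw|exact: measurable_indic].
have C0 : 0 <= c * (tau `^ (- zeta) * 2 `^ zeta) * L by rewrite !mulr_ge0 ?powR_ge0.
apply: (@integral_le_geometric R _ _ leb W _ f_ _ q mW _ _ _ _ _ q01 C0).
- exact: measurable_funM.
- by move=> j; apply: measurable_funM; [exact: measurable_cst|exact: mf].
- by move=> j x _; rewrite mulr_ge0// mulr_ge0.
- by move=> x Wx; rewrite mulr_ge0 ?g0.
- move=> x Wx; have [j [Aj gj]] := layer_of Wx; exists j.
  by rewrite /f_ indicE mem_set// mulr1 ler_wpM2r.
move=> j; under eq_integral do rewrite /f_ EFinM.
rewrite (ge0_integralZl _ mW); last 3 first.
- by apply/measurable_EFinP; exact: mf.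
- by move=> x _; rewrite lee_fin mulr_ge0.
- by rewrite lee_fin.
have -> : (\int[leb]_(x in W) (w x * \1_(A j) x)%:E = \int[leb]_(x in A j) (w x)%:E)%E.
  have AW : W `&` A j = A j by rewrite /A setIA setIid.
  rewrite -{2}AW integral_mkcondr; apply: eq_integral => x _.
  by rewrite patchE indicE; case: ifP; rewrite ?mulr1 ?mulr0.
apply: le_trans (lee_wpmul2l _ (wL j)) _; first by rewrite lee_fin.
rewrite -EFinM lee_fin; have := hpow j.
set a := h j.+1 `^ _; set b := tau `^ _ * _; set r := 2^-1 ^+ j => H.
have -> : c * a * (L * r) = c * (a * r) * L by ring.
by rewrite H [leLHS](_ : _ = c * b * L * q ^+ j)//; ring.
Qed.

Let K0 : 0 <= c * (tau `^ (- zeta) * 2 `^ zeta) / (1 - q).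
Proof.
by rewrite divr_ge0 ?mulr_ge0 ?powR_ge0// subr_ge0; case/andP: q01 => _ /ltW.
Qed.

Lemma graph_weight_integral : exists2 K : R, 0 <= K &
  (\int[leb]_(x in W) (g x)%:E <= K%:E)%E.
Proof.
have L0 : 0 <= (2 * (`|M| + tau)) ^+ n by rewrite exprn_ge0// mulr_ge0// addr_ge0// ltW.
exists (c * (tau `^ (- zeta) * 2 `^ zeta) / (1 - q) * (2 * (`|M| + tau)) ^+ n).
  exact: mulr_ge0.
have := @layered (fun=> 1) _ (measurable_cst _) (fun=> ler01) L0.
under eq_integral do rewrite mulr1; apply => j.
by rewrite integral_cst// mul1e; exact: measA.
Qed.

Lemma graph_weight_sqr : exists2 K : R, 0 <= K &
  forall phi, test_function Omega phi ->
  (\int[leb]_(x in W) (g x * phi x ^+ 2)%:E <= (K * energy phi)%:E)%E.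
Proof.
exists (c * (tau `^ (- zeta) * 2 `^ zeta) / (1 - q) * (n%:R * tau ^+ 2)).
  by rewrite mulr_ge0// mulr_ge0 ?sqr_ge0.
move=> phi tphi; rewrite -mulrA; have E0 := energy_ge0 phi.
apply: layered.
- by apply: measurable_funX; apply: measurable_funTS; exact: test_measurable tphi.
- by move=> x; exact: sqr_ge0.
- by rewrite mulr_ge0// mulr_ge0 ?sqr_ge0.
move=> j; apply: le_trans (sqrA j tphi) _; rewrite lee_fin [leRHS]mulrAC ler_wpM2r//.
rewrite -[leRHS]mulrA ler_wpM2l// /h exprMn ler_wpM2l ?sqr_ge0// expr2.
by rewrite ler_piMr ?exprn_ge0 ?exprn_ile1 ?invr_ge0// invf_le1// ler1n.
Qed.

End layers.

(** * Regularity of the boundary *)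

Section boundary.
Variable R : realType.

Lemma sum_ord_le n (F : 'I_n -> R) (c : R) : (forall i, F i <= c) ->
  \sum_(i < n) F i <= n%:R * c.
Proof.
move=> Fc; apply: (@le_trans _ _ (\sum_(i < n) c)); first by apply: ler_sum => i _.
by rewrite sumr_const card_ord mulr_natl.
Qed.

Lemma enorm_le_norm n (x : 'rV[R]_n) : enorm x <= n%:R * `|x|.
Proof.
have nx : 0 <= n%:R * `|x| by rewrite mulr_ge0.
rewrite -(ler_pXn2r (n := 2)) ?nnegrE ?enorm_ge0// sqr_enorm exprMn.
apply: (@le_trans _ _ (n%:R * `|x| ^+ 2)).
  apply: sum_ord_le => i.
  by rewrite -[leLHS](real_normK (num_real _)) lerXn2r ?nnegrE// ler_coord.
rewrite ler_wpM2r ?sqr_ge0//; case: n {x nx} => [|n]; first by rewrite expr0n.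
by rewrite expr2 ler_peMl// ler1n.
Qed.

Lemma lipschitz_continuous (U W : normedModType R) (g : U -> W) (K : R) :
  (forall x y, `|g x - g y| <= K * `|x - y|) -> continuous g.
Proof.
move=> gK x; apply/cvgrPdist_le => e e0.
have K0 : 0 < `|K| + 1 by rewrite ltr_wpDl.
apply/nbhs_ballP; exists (e / (`|K| + 1)); first by rewrite /= divr_gt0.
move=> y; rewrite -ball_normE /= => xy; apply: le_trans (gK x y) _.
apply: (@le_trans _ _ ((`|K| + 1) * `|x - y|)).
  by rewrite ler_wpM2r// (le_trans (ler_norm K))// lerDl.
by rewrite mulrC -ler_pdivlMr// ltW.
Qed.

(** The gradient, being Lipschitz, is bounded on a ball; the mean value theorem is
    then applied along segments. *)
Lemma C11_lipschitz m (phi : 'rV[R]_m -> R) (x0 : 'rV[R]_m) (r : R) : C11 phi -> 0 <= r ->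
  exists2 M : R, 0 <= M & forall x y, `|x - x0| <= r -> `|y - x0| <= r ->
    `|phi x - phi y| <= M * `|x - y|.
Proof.
move=> [dphi [L hL]] r0.
pose D := \sum_(i < m) `|partial i phi x0| + `|L| * (m%:R * r).
have D0 : 0 <= D by rewrite addr_ge0 ?sumr_ge0// !mulr_ge0.
have pD p i : `|p - x0| <= r -> `|partial i phi p| <= D.
  move=> pr; rewrite -[partial i phi p](subrK (partial i phi x0)) addrC.
  apply: le_trans (ler_normD _ _) _; apply: lerD.
    by rewrite (bigD1 i)//= lerDl sumr_ge0.
  have := enorm_coord (grad phi p - grad phi x0) i; rewrite !mxE => h.
  apply: le_trans h _; apply: le_trans (hL p x0) _.
  apply: le_trans (ler_wpM2r (enorm_ge0 _) (ler_norm L)) _.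
  rewrite ler_wpM2l//; apply: le_trans (enorm_le_norm _) _.
  by rewrite ler_wpM2l.
exists (m%:R * D); first by rewrite mulr_ge0.
move=> x y xr yr; pose v := x - y.
pose df (t : R) := 'd phi (y + t *: v) v.
have der (t : R) : is_derive t (1 : R) (fun t : R => phi (y + t *: v)) (df t).
  by apply: is_derive_along; split; [exact: diff_derivable|rewrite deriveE].
have [|c c01] := @MVT_segment R (fun t : R => phi (y + t *: v)) df 0 1 ler01 (fun t _ => der t).
  apply: continuous_subspaceT => t; apply: differentiable_continuous.
  apply/derivable1_diffP; exact: (@ex_derive _ _ _ _ _ _ _ (der t)).
rewrite scale0r scale1r addr0 /v addrCA subrr addr0 subr0 mulr1 => ->.
have cr : `|y + c *: v - x0| <= r.
  have -> : y + c *: v - x0 = (1 - c) *: (y - x0) + c *: (x - x0).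
    by rewrite /v; apply/rowP => i; rewrite !mxE; ring.
  move: c01; rewrite in_itv/= => /andP[c0 c1].
  apply: le_trans (ler_normD _ _) _; rewrite !normrZ (ger0_norm c0) ger0_norm ?subr_ge0//.
  apply: (@le_trans _ _ ((1 - c) * r + c * r)); last by rewrite -mulrDl subrK mul1r.
  by apply: lerD; rewrite ler_wpM2l// subr_ge0.
rewrite -/v; have -> : df c = \sum_(i < m) v 0 i *: 'd phi (y + c *: v) (delta_mx 0 i : 'rV[R]_m).
  rewrite /df [X in 'd phi _ X = _](row_sum_delta v) linear_sum.
  by apply: eq_bigr => i _; rewrite linearZ.
apply: le_trans (ler_norm_sum _ _ _) _.
rewrite -mulrA; apply: sum_ord_le => i.
rewrite normrM mulrC; apply: ler_pM => //; last exact: ler_coord.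
by rewrite -deriveE//; exact: pD.
Qed.

Section orthogonal.
Variables (n : nat) (Q : 'M[R]_n) (k : 'I_n).
Hypothesis QQ : Q *m Q^T = 1%:M.

Lemma orth_entry_le1 (l : 'I_n) (i : 'I_n) : `|Q i l| <= 1.
Proof.
have /mulmx1C/matrixP/(_ l l) := QQ; rewrite !mxE eqxx => h.
rewrite -(ler_pXn2r (n := 2)) ?nnegrE// real_normK ?num_real// expr1n -[leRHS]h.
rewrite (bigD1 i)//= mxE expr2 lerDl; apply: sumr_ge0 => j _.
by rewrite mxE -expr2 sqr_ge0.
Qed.

Lemma orth_coord_le (x : 'rV[R]_n) j : `|(x *m Q) 0 j| <= n%:R * `|x|.
Proof.
rewrite mxE; apply: le_trans (ler_norm_sum _ _ _) _.
apply: sum_ord_le => i; rewrite normrM -[leRHS]mulr1; apply: ler_pM => //; first exact: ler_coord.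
exact: orth_entry_le1.
Qed.

(** The set lies above the graph, so lowering the [k]-th rotated coordinate leads
    out of it. *)
Definition outward : 'rV[R]_n := \row_j (- Q j k).

Lemma outward_le1 : `|outward| <= 1.
Proof. by apply: norm_rV_le => // i; rewrite mxE normrN; exact: orth_entry_le1. Qed.

Lemma outwardQ : outward *m Q = - delta_mx 0 k.
Proof.
apply/rowP => j; rewrite !mxE eqxx /=; have /mulmx1C/matrixP/(_ k j) := QQ.
rewrite !mxE eq_sym => <-; rewrite -sumrN; apply: eq_bigr => i _.
by rewrite !mxE mulNr.
Qed.

Variable phi : 'rV[R]_n.-1 -> R.

Definition height (x : 'rV[R]_n) : R := (x *m Q) 0 k - phi (col' k (x *m Q)).

Lemma height_shift x t : height (x + t *: outward) = height x - t.
Proof.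
rewrite /height mulmxDl -scalemxAl outwardQ.
have -> : col' k (x *m Q + t *: - delta_mx 0 k) = col' k (x *m Q).
  by apply/rowP => j; rewrite !mxE eqxx /= eq_sym (negbTE (neq_lift k j)) oppr0 mulr0 addr0.
by rewrite !mxE !eqxx /= mulrN1 addrAC.
Qed.

Lemma col'Q_le (x y : 'rV[R]_n) : `|col' k (x *m Q) - col' k (y *m Q)| <= n%:R * `|x - y|.
Proof.
apply: norm_rV_le => [|i]; first by rewrite mulr_ge0.
rewrite !mxE; have := orth_coord_le (x - y) (lift k i).
by rewrite mulmxBl !mxE.
Qed.

Lemma height_continuous : continuous phi -> continuous height.
Proof.
move=> cphi.
have c1 : continuous ((fun x : 'rV[R]_n => (x *m Q) 0 k) : 'rV[R]_n -> R^o).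
  apply: (@lipschitz_continuous _ _ _ n%:R) => y z.
  by have := orth_coord_le (y - z) k; rewrite mulmxBl !mxE.
have c2 : continuous (fun x : 'rV[R]_n => col' k (x *m Q)).
  exact: (lipschitz_continuous col'Q_le).
have c3 : continuous ((fun x : 'rV[R]_n => phi (col' k (x *m Q))) : 'rV[R]_n -> R^o).
  by move=> x; apply: (continuous_comp (f := fun x : 'rV[R]_n => col' k (x *m Q))); [exact: c2|exact: cphi].
by move=> x; exact: (cvgB (c1 x) (c3 x)).
Qed.

End orthogonal.

End boundary.

(** * The weight on a bounded open set of class C^{1,1} *)

Section weight.
Variables (R : realType) (n : nat) (Omega : set 'rV[R]_n) (zeta c2 : R) (f : 'rV[R]_n -> R).
Local Notation V := 'rV[R]_n.
Hypothesis n0 : (0 < n)%N.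
Hypothesis oOmega : open Omega.
Hypothesis bOmega : bounded_set Omega.
Hypothesis cOmega : C11_boundary Omega.
Hypothesis zeta01 : 0 <= zeta < 1.
Hypothesis mf : measurable_fun Omega f.
Hypothesis f0 : forall x, Omega x -> 0 <= f x.
Hypothesis c20 : 0 < c2.
Hypothesis fle : forall x, Omega x -> f x <= c2 * bdist Omega x `^ (- zeta).
Implicit Types (A B : set V) (phi : V -> R).

Let mO : measurable Omega. Proof. exact: open_leb. Qed.

Definition weight_bounded A (K : R) :=
  (\int[leb]_(x in Omega `&` A) (f x)%:E <= K%:E)%E /\
  forall phi, test_function Omega phi ->
    (\int[leb]_(x in Omega `&` A) (f x * phi x ^+ 2)%:E <= (K * energy phi)%:E)%E.

Let mfphi phi : test_function Omega phi -> measurable_fun Omega (fun x => f x * phi x ^+ 2).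
Proof.
move=> tphi; apply: measurable_funM; first exact: mf.
by apply: measurable_funX; apply: measurable_funTS; exact: test_measurable tphi.
Qed.

Let powRN_le (a b : R) : 0 < a -> a <= b -> b `^ (- zeta) <= a `^ (- zeta).
Proof. by move=> a0 ab; rewrite !powRN; apply: powRV_le => //; case/andP: zeta01. Qed.

(** Away from the boundary the weight is bounded, and the Poincare inequality
    controls the squares. *)
Lemma weight_interior x0 : Omega x0 -> exists U K, [/\ open U, U x0, 0 <= K & weight_bounded U K].
Proof.
move=> Ox0; have /nbhs_ballP[r /= r0 hr] := open_nbhs_nbhs (conj oOmega Ox0).
have [M M0 hM] := bounded_norm bOmega.
have [P P0 hP] := poincare_test n0 bOmega.
pose U := ball x0 (r / 2).
have oU : open U by exact: ball_open.
have mU : measurable (Omega `&` U) by apply: measurableI => //; exact: open_leb.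
pose m := 1 + (r / 2) `^ (- zeta).
have m0 : 0 <= m by rewrite addr_ge0// powR_ge0.
have fm x : Omega x -> U x -> f x <= c2 * m.
  move=> Ox; rewrite /U -ball_normE /= => Ux.
  apply: le_trans (fle Ox) _; rewrite ler_wpM2l ?(ltW c20)//.
  have [[y0 by0]|nb] := pselect (bdry Omega !=set0); last first.
    (* The infimum of an empty set is [0] by convention. *)
    have -> : bdist Omega x = 0.
      rewrite /bdist (_ : [set _ | _ in _] = set0) ?inf0//.
      by apply/seteqP; split => // t [y hy _]; apply: nb; exists y.
    have -> : (0 : R) `^ (- zeta) = (- zeta == 0)%:R by rewrite /powR eqxx.
    by rewrite /m; case: (_ == _); rewrite ?lerDl ?powR_ge0// addr_ge0// powR_ge0.
  rewrite /m -[leLHS]add0r lerD// powRN_le ?divr_gt0//.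
  apply: lb_le_inf; first by exists (enorm (x - y0)); exists y0.
  move=> _ [y [_ ny] <-]; apply: le_trans (norm_le_enorm _).
  rewrite leNgt; apply/negP => xy; apply: ny; rewrite (interior_id _).1//.
  apply: hr; rewrite -ball_normE /=.
  have -> : x0 - y = (x0 - x) + (x - y) by rewrite addrA subrK.
  apply: le_lt_trans (ler_normD _ _) _; rewrite [ltRHS](_ : _ = r / 2 + r / 2); last by field.
  exact: ltrD.
pose K1 := c2 * m * (2 * M) ^+ n; pose K2 := c2 * m * P.
have K10 : 0 <= K1 by rewrite !mulr_ge0 ?(ltW c20)// exprn_ge0// mulr_ge0// ltW.
have K20 : 0 <= K2 by rewrite mulr_ge0 ?(ltW P0)// mulr_ge0// ltW.
have mfU : measurable_fun (Omega `&` U) f by apply: measurable_funS mf.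
exists U, (K1 + K2); split => //; first exact: ballxx (divr_gt0 r0 _).
  exact: addr_ge0.
split.
  apply: (@le_trans _ _ (\int[leb]_(x in Omega `&` U) (cst (c2 * m)%:E x))%E).
    apply: ge0_le_integral => //.
    - by move=> x [Ox _]; rewrite lee_fin f0.
    - exact/measurable_EFinP.
    - by move=> x [Ox Ux]; rewrite lee_fin fm.
  rewrite integral_cst//; apply: le_trans (_ : (K1%:E <= _)%E); last by rewrite lee_fin lerDl.
  rewrite /K1 [leRHS]EFinM; apply: lee_wpmul2l; first by rewrite lee_fin mulr_ge0// ltW.
  by apply: leb_norm_le => // [|x [/hM]//]; exact: ltW.
move=> phi tphi; have sphi := test_sqint tphi; have E0 := energy_ge0 phi.
have mphi := test_measurable tphi.
apply: (@le_trans _ _ (\int[leb]_(x in Omega `&` U) (c2 * m * phi x ^+ 2)%:E)%E).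
  apply: ge0_le_integral => //.
  - by move=> x [Ox _]; rewrite lee_fin mulr_ge0 ?f0// sqr_ge0.
  - by apply/measurable_EFinP; apply: measurable_funS (mfphi tphi).
  - apply/measurable_EFinP; apply: measurable_funM; first exact: measurable_cst.
    by apply: measurable_funX; exact: measurable_funTS.
  - by move=> x [Ox Ux]; rewrite lee_fin ler_wpM2r ?fm// sqr_ge0.
apply: (@le_trans _ _ (\int[leb]_x (c2 * m * phi x ^+ 2)%:E)%E).
  apply: ge0_subset_integral => //.
    apply/measurable_EFinP; apply: measurable_funM; [exact: measurable_cst|exact: measurable_funX].
  by move=> x _; rewrite lee_fin mulr_ge0 ?sqr_ge0// mulr_ge0// ltW.
have sZ := integrableZl measurableT (c2 * m) sphi.2.
rewrite (integral_Rintegral measurableT sZ) lee_fin RintegralZl//; last exact: sphi.2.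
have h := hP phi tphi; rewrite /nrm2 in h.
apply: (@le_trans _ _ (K2 * energy phi)); last by rewrite ler_wpM2r// lerDr.
by rewrite /K2 -[leRHS]mulrA ler_wpM2l// mulr_ge0// ltW.
Qed.

(** In the rotated coordinates the height above the graph is at most a multiple of
    the distance to the boundary: boundary points have nonpositive height, and
    the height is Lipschitz since the graph is. *)
Lemma weight_boundary x0 : bdry Omega x0 ->
  exists U K, [/\ open U, U x0, 0 <= K & weight_bounded U K].
Proof.
move=> bx0; have [r [Q [k [phi0 [r0 QQ cphi hy]]]]] := cOmega bx0.
have nR : 0 < n%:R :> R by rewrite ltr0n.
have [M M0 hM] := bounded_norm bOmega.
pose d := height Q k phi0; pose e := outward Q k.
have cphi0 : continuous phi0 by move=> x; apply: differentiable_continuous; exact: cphi.1.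
have cd : continuous d := height_continuous QQ cphi0.
have [L L0 hL] := C11_lipschitz (col' k (x0 *m Q)) cphi (ltW r0).
(* So small that the points of the layer, their shifts and the boundary points
   near them remain in the coordinate patch; the factor [n] compares the
   Euclidean norm with the sup norm. *)
pose tau := r / (4 * n%:R); have tau0 : 0 < tau by rewrite divr_gt0// mulr_gt0.
have ntau : n%:R * tau = r / 4 by rewrite /tau; field; rewrite gt_eqF.
have OQ y : n%:R * `|y - x0| < r -> (Omega y <-> 0 < d y).
  move=> yr; rewrite /d /height subr_gt0; apply: hy.
  exact: le_lt_trans (enorm_le_norm _) yr.
have nO y : bdry Omega y -> ~ Omega y by move=> [_]; rewrite (interior_id _).1.
have bd y : bdry Omega y -> n%:R * `|y - x0| < r -> d y <= 0.
  by move=> /nO ny yr; rewrite leNgt; apply/negP => /(OQ y yr).2.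
pose U := ball x0 tau `&` [set x | d x < tau].
have oU : open U.
  apply: openI; first exact: ball_open.
  by have /continuousP/(_ _ (@open_lt R tau)) := cd.
have Ux0 : U x0.
  split; first exact: ballxx.
  by rewrite /= (le_lt_trans _ tau0)// bd// subrr normr0 mulr0.
have Ur x : U x -> n%:R * `|x - x0| < r / 4.
  by move=> [+ _]; rewrite -ball_normE /= distrC -ntau ltr_pM2l.
have r4 : r / 4 < r by rewrite ltr_pdivrMr// ltr_pMr// ltr1n.
pose W := Omega `&` U.
have mW : measurable W by apply: measurableI => //; exact: open_leb.
have e1 : `|e| <= 1 by exact: outward_le1.
have dsh x t : d (x + t *: e) = d x - t by exact: height_shift.
have dW x : W x -> 0 < d x <= tau.
  by move=> [Ox Ux]; rewrite ltW ?andbT; [apply/OQ => //; exact: lt_trans (Ur _ Ux) r4|case: Ux].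
have exW x t : W x -> d x <= t <= tau -> ~ Omega (x + t *: e).
  move=> Wx /andP[dt tt]; have [Ox Ux] := Wx; have /andP[d0 _] := dW x Wx.
  have t0 : 0 <= t by exact: le_trans (ltW d0) dt.
  suff xr : n%:R * `|x + t *: e - x0| < r.
    by move=> /(OQ _ xr).1; rewrite dsh subr_gt0 ltNge dt.
  rewrite addrAC; apply: le_lt_trans (ler_wpM2l (ltW nR) (ler_normD _ _)) _.
  rewrite mulrDr; have h1 := Ur x Ux.
  have h2 : n%:R * `|t *: e| <= r / 4.
    rewrite -ntau ler_wpM2l// normrZ ger0_norm// -[leRHS]mulr1; exact: ler_pM.
  lra.
pose C := 1 + (n%:R + L * n%:R).
have C0 : 0 < C by rewrite ltr_pwDl// addr_ge0// mulr_ge0.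
have C1 : 1 <= C by rewrite lerDl addr_ge0// mulr_ge0.
have dC x : W x -> d x <= C * bdist Omega x.
  move=> Wx; have [Ox Ux] := Wx; have /andP[d0 dt] := dW x Wx.
  rewrite mulrC -ler_pdivrMr//; apply: lb_le_inf; first by exists (enorm (x - x0)); exists x0.
  move=> _ [y hyb <-]; rewrite ler_pdivrMr// mulrC.
  have [xy|xy] := leP tau (enorm (x - y)).
    by apply: le_trans dt (le_trans xy _); rewrite ler_peMl// enorm_ge0.
  have xyn : `|x - y| < tau := le_lt_trans (norm_le_enorm _) xy.
  have h1 := Ur x Ux.
  have yr : n%:R * `|y - x0| < r.
    have -> : y - x0 = (y - x) + (x - x0) by rewrite addrA subrK.
    apply: le_lt_trans (ler_wpM2l (ltW nR) (ler_normD _ _)) _; rewrite mulrDr.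
    have : n%:R * `|y - x| < r / 4 by rewrite -ntau ltr_pM2l// distrC.
    lra.
  have dy := bd y hyb yr.
  apply: (@le_trans _ _ (d x - d y)); first by rewrite lerBrDr -lerBrDl subrr.
  have -> : d x - d y = ((x - y) *m Q) 0 k - (phi0 (col' k (x *m Q)) - phi0 (col' k (y *m Q))).
    by rewrite /d /height mulmxBl !mxE; ring.
  have a1 := orth_coord_le QQ (x - y) k.
  have a2 : `|phi0 (col' k (x *m Q)) - phi0 (col' k (y *m Q))| <= L * (n%:R * `|x - y|).
    apply: le_trans (hL _ _ _ _) _.
    - by apply: le_trans (col'Q_le k QQ _ _) _; apply: ltW; exact: lt_trans h1 r4.
    - by apply: le_trans (col'Q_le k QQ _ _) _; exact: ltW.
    - by rewrite ler_wpM2l// col'Q_le.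
  apply: le_trans (ler_norm _) _; apply: le_trans (ler_normB _ _) _.
  apply: le_trans (lerD a1 a2) _; rewrite mulrA -mulrDl.
  apply: ler_pM => //; first by rewrite addr_ge0// mulr_ge0.
    by rewrite /C lerDr.
  exact: norm_le_enorm.
have gd x : W x -> f x <= (c2 * C `^ zeta) * d x `^ (- zeta).
  move=> Wx; have [Ox Ux] := Wx; have /andP[d0 dt] := dW x Wx.
  apply: le_trans (fle Ox) _; rewrite -mulrA ler_wpM2l ?(ltW c20)//.
  have -> : C `^ zeta * d x `^ (- zeta) = (d x / C) `^ (- zeta).
    rewrite powRM ?invr_ge0 ?ltW// mulrC; congr (_ * _).
    by rewrite -powR_inv1 ?ltW// -powRrM mulrNN mul1r.
  apply: powRN_le; first by rewrite divr_gt0.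
  by rewrite ler_pdivrMr// mulrC dC.
have md : measurable_fun setT d by exact: continuous_leb.
have mfW : measurable_fun W f := measurable_funS mO (@subIsetl _ _ _) mf.
have c0' : 0 <= c2 * C `^ zeta by rewrite mulr_ge0 ?powR_ge0// ltW.
have WM x : W x -> `|x| <= M by move=> [/hM].
have f0W x : W x -> 0 <= f x by move=> [/f0].
have [K1 K10 h1] := graph_weight_integral mW WM e1 md dsh tau0 dW zeta01 c0' mfW f0W gd.
have [K2 K20 h2] := graph_weight_sqr mW e1 md tau0 dW exW zeta01 c0' mfW f0W gd.
exists U, (K1 + K2); split => //; first exact: addr_ge0.
split; first by apply: le_trans h1 _; rewrite lee_fin lerDl.
move=> phi tphi; apply: le_trans (h2 phi tphi) _.
by rewrite lee_fin ler_wpM2r ?energy_ge0// lerDr.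
Qed.

Lemma weight_boundedU A B K L : measurable A -> measurable B ->
  weight_bounded A K -> weight_bounded B L -> weight_bounded (A `|` B) (K + L).
Proof.
move=> mA mB [a1 a2] [b1 b2].
have sub (g : V -> R) : measurable_fun Omega g -> (forall x, Omega x -> 0 <= g x) ->
    (\int[leb]_(x in Omega `&` (A `|` B)) (g x)%:E <=
     \int[leb]_(x in Omega `&` A) (g x)%:E + \int[leb]_(x in Omega `&` B) (g x)%:E)%E.
  move=> mg g0; have mG S : S `<=` Omega -> measurable_fun S (fun x => (g x)%:E).
    by move=> SO; apply/measurable_EFinP; exact: measurable_funS mg.
  have E : Omega `&` (A `|` B) = (Omega `&` A) `|` (Omega `&` (B `\` A)).
    apply/seteqP; split => x /=.
      by move=> [Ox [Ax|Bx]]; [left|have [Ax|nAx] := pselect (A x); [left|right]].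
    by move=> [[Ox Ax]|[Ox [Bx _]]]; split => //; [left|right].
  have mBA : measurable (B `\` A) by exact: measurableD.
  rewrite E ge0_integral_setU//.
  - apply: leeD => //; apply: ge0_subset_integral.
    + exact: measurableI.
    + exact: measurableI.
    + by apply: mG => x [].
    + by move=> x [Ox _]; rewrite lee_fin g0.
    + by move=> x [Ox [Bx _]].
  - exact: measurableI.
  - exact: measurableI.
  - by apply: mG => x [[]|[]].
  - by move=> x [[Ox _]|[Ox _]]; rewrite lee_fin g0.
  - by apply/disj_setPS => x [[_ Ax] [_ [_ nAx]]].
split; first by apply: le_trans (sub f mf f0) _; rewrite EFinD; exact: leeD.
move=> phi tphi; apply: le_trans (sub _ (mfphi tphi) _) _.
  by move=> x Ox; rewrite mulr_ge0 ?f0// sqr_ge0.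
by rewrite mulrDl EFinD leeD// ?a2 ?b2.
Qed.

(** Compactness of the closure turns the local bounds into global ones. *)
Lemma weight_bound : exists2 K : R, 0 <= K & weight_bounded setT K.
Proof.
have loc x : exists UK : set V * R, closure Omega x ->
    [/\ open UK.1, UK.1 x, 0 <= UK.2 & weight_bounded UK.1 UK.2].
  have [cx|ncx] := pselect (closure Omega x); last by exists (set0, 0).
  have [Ox|nx] := pselect (Omega x).
    by have [U [K h]] := weight_interior Ox; exists (U, K).
  have [|U [K h]] := @weight_boundary x; last by exists (U, K).
  by split => //; rewrite (interior_id _).1.
have {loc}[F hF] := choice loc.
have cpt : compact (closure Omega).
  apply: bounded_closed_compact; last exact: closed_closure.
  have [M M0 hM] := bounded_norm bOmega.
  exists M; split; first exact: num_real.
  move=> M' MM' x cx /=; rewrite leNgt; apply/negP => M'x.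
  have [|y [Oy xy]] := cx (ball x (`|x| - M')).
    by apply: nbhsx_ballx; rewrite subr_gt0.
  move: xy; rewrite -ball_normE /= => xy.
  have := hM y Oy; have := ler_normD (x - y) y; rewrite subrK; move: xy M'x MM'.
  by set a := `|x - y|; set b := `|x|; set cc := `|y|; move=> *; lra.
rewrite compact_cover in cpt.
have [||D' D'c cov] := cpt V (closure Omega) (fun x => (F x).1).
- by move=> x cx; have [] := hF x cx.
- by move=> x cx; exists x => //; have [] := hF x cx.
have H : forall s : seq V, (forall x, x \in s -> closure Omega x) ->
    exists K, [/\ 0 <= K, measurable (\bigcup_(x in [set` s]) (F x).1) &
      weight_bounded (\bigcup_(x in [set` s]) (F x).1) K].
  elim => [_|x s IH hs].
    exists 0; rewrite set_nil bigcup_set0; split => //; split.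
      by rewrite setI0 integral_set0.
    by move=> phi _; rewrite setI0 integral_set0 mul0r.
  have [|K [K0 mK bK]] := IH; first by move=> y ys; apply: hs; rewrite inE ys orbT.
  have [oU Ux L0 bL] := hF x (hs x (mem_head _ _)).
  have -> : [set` x :: s] = x |` [set` s].
    apply/seteqP; split => y /=; rewrite inE; first by case/orP => [/eqP|]; [left|right].
    by case=> [->|->]; rewrite ?eqxx ?orbT.
  exists ((F x).2 + K); rewrite bigcup_setU1; split.
  - exact: addr_ge0.
  - by apply: measurableU => //; exact: open_leb.
  - by apply: weight_boundedU => //; exact: open_leb.
have [|K [K0 mK [b1 b2]]] := H (finmap.enum_fset D'); first by move=> x /D'c; rewrite inE.
have E : Omega `&` (\bigcup_(x in [set` finmap.enum_fset D']) (F x).1) = Omega `&` setT.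
  by rewrite setIT; apply/setIidPl => x Ox; apply: cov; exact: subset_closure.
by exists K => //; split; rewrite -E.
Qed.

Lemma weight_integrable : leb.-integrable Omega (EFin \o f).
Proof.
have [K K0 [h _]] := weight_bound; rewrite setIT in h.
exact: (bounded_integrable mO mf f0 h).1.
Qed.

Lemma weight_sqr_H01 : exists2 K : R, 0 <= K & forall u, H01 Omega u ->
  leb.-integrable Omega (EFin \o (fun x => f x * u x ^+ 2)) /\
  \int[leb]_(x in Omega) (f x * u x ^+ 2) <= K * gE Omega u u.
Proof.
have [K K0 [_ hK]] := weight_bound; exists K => // u hu.
have [phi [tphi _ _ ce ae]] := H01_seq oOmega bOmega hu.
have mfu : measurable_fun Omega (fun x => f x * u x ^+ 2).
  apply: measurable_funM; first exact: mf.
  by apply: measurable_funX; exact: (H01_sq oOmega bOmega hu).1.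
have fu0 x : Omega x -> 0 <= f x * u x ^+ 2 by move=> Ox; rewrite mulr_ge0 ?f0// sqr_ge0.
apply: (bounded_integrable mO mfu fu0).
apply: (@fatou_le _ _ _ leb Omega mO (fun k x => f x * phi k x ^+ 2) _ (fun k => K * energy (phi k))).
- by move=> k; exact: mfphi.
- exact: mfu.
- by move=> k x Ox; rewrite mulr_ge0 ?f0// sqr_ge0.
- exact: fu0.
- by apply: filterS ae => x h Ox; apply: cvgM; [exact: cvg_cst|exact: cvg_sqr].
- by move=> k; have := hK _ (tphi k); rewrite setIT.
- by apply: cvgM => //; exact: cvg_cst.
Qed.

(** The two bounds combined by Young's inequality. *)
Lemma weight_H01 : exists2 K : R, 0 <= K & forall u, H01 Omega u ->
  leb.-integrable Omega (EFin \o (fun x => f x * `|u x|)) /\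
  forall t : R, 0 < t -> \int[leb]_(x in Omega) (f x * `|u x|) <= K * (t + t^-1 * gE Omega u u).
Proof.
have fi := weight_integrable; have [K K0 hK] := weight_sqr_H01.
pose F := \int[leb]_(x in Omega) f x.
have F0 : 0 <= F by apply: Rintegral_ge0.
exists (F + K) => [|u hu]; first exact: addr_ge0.
have [fui fuK] := hK u hu.
have su := H01_sq oOmega bOmega hu.
have E0 := form_ge0 (gE_form oOmega bOmega) hu.
have mfu : measurable_fun Omega (fun x => f x * `|u x|).
  by apply: measurable_funM; [exact: mf|apply: measurableT_comp => //; exact: su.1].
have pw (t : R) x : 0 < t -> Omega x -> f x * `|u x| <= t * f x + t^-1 * (f x * u x ^+ 2).
  move=> t0 Ox; rewrite -(real_normK (num_real (u x))).
  have -> : t * f x + t^-1 * (f x * `|u x| ^+ 2) = f x * (t + t^-1 * `|u x| ^+ 2) by ring.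
  rewrite ler_wpM2l ?f0// -(ler_pM2l t0) mulrDr mulrA mulfV ?gt_eqF// mul1r.
  by have := normr_ge0 (u x); set y := `|u x|; nra.
have dom (t : R) : leb.-integrable Omega (EFin \o (fun x => t * f x + t^-1 * (f x * u x ^+ 2))).
  exact: (integrableD mO (integrableZl mO t fi) (integrableZl mO t^-1 fui)).
have ii : leb.-integrable Omega (EFin \o (fun x => f x * `|u x|)).
  apply: (integrable_dom mO mfu _ (dom 1)) => x Ox.
  by rewrite ger0_norm; [exact: pw|rewrite mulr_ge0 ?f0].
split => // t t0.
apply: (@le_trans _ _ (\int[leb]_(x in Omega) (t * f x + t^-1 * (f x * u x ^+ 2)))).
  by apply: le_Rintegral; [exact: mO|exact: ii|exact: dom|move=> x Ox; exact: pw].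
rewrite RintegralD//; last 2 first.
- exact: (integrableZl mO t fi).
- exact: (integrableZl mO t^-1 fui).
rewrite !RintegralZl// -/F mulrDl.
have ti : 0 < t^-1 by rewrite invr_gt0.
apply: (@le_trans _ _ (t * F + t^-1 * (K * gE Omega u u))); first by rewrite lerD2l ler_wpM2l// ltW.
rewrite !mulrDr mulrC -!addrA lerD2l.
rewrite addrC -addrA addrCA; set a := F * _.
have -> : t^-1 * (K * gE Omega u u) = K * (t^-1 * gE Omega u u) by rewrite mulrCA.
have a0 : 0 <= a by rewrite mulr_ge0// mulr_ge0// ltW.
by rewrite lerDl addr_ge0// mulr_ge0// ltW.
Qed.

End weight.

(** * Regularised powers *)

Lemma le_Rintegral_ae d (T : measurableType d) (R : realType)
    (mu : {measure set T -> \bar R}) (D : set T) (f g : T -> R) : measurable D ->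
  mu.-integrable D (EFin \o f) -> mu.-integrable D (EFin \o g) ->
  {ae mu, forall x, D x -> f x <= g x} ->
  \int[mu]_(x in D) f x <= \int[mu]_(x in D) g x.
Proof.
move=> mD fi gi fg; rewrite -subr_ge0 -(RintegralB mD gi fi).
have di := integrableB mD gi fi.
have md : measurable_fun D (fun x => g x - f x) by exact: integrable_mfun di.
rewrite (@Rintegral_ae _ _ _ mu D mD _ (fun x => `|g x - f x|)) //.
- by apply: Rintegral_ge0.
- exact: measurableT_comp.
- by apply: filterS fg => x h Dx; rewrite ger0_norm// subr_ge0 h.
Qed.

Section regularised_power.
Variables (R : realType) (gamma : R).
Hypothesis gamma01 : 0 < gamma <= 1.

Let g0 : 0 < gamma. Proof. by case/andP: gamma01. Qed.

Let g1 : gamma <= 1. Proof. by case/andP: gamma01. Qed.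

(** The singular power [t ^ - gamma] shifted by [e], and frozen at its value at [0]
    for negative arguments; it is bounded and nonincreasing. *)
Definition regpow (e t : R) : R := ((Num.max t 0 + e) `^ gamma)^-1.

Let wpos (e t : R) : 0 < e -> 0 < Num.max t 0 + e.
Proof. by move=> e0; rewrite ltr_wpDl// le_max lexx orbT. Qed.

Lemma regpow_itv e t : 0 < e -> 0 <= regpow e t <= (e `^ gamma)^-1.
Proof.
move=> e0; rewrite invr_ge0 powR_ge0/=; apply: powRV_le => //; first exact: ltW.
by rewrite lerDr le_max lexx orbT.
Qed.

Lemma regpow_anti e e' t t' : 0 < e -> Num.max t 0 + e <= Num.max t' 0 + e' ->
  regpow e' t' <= regpow e t.
Proof. by move=> e0; apply: powRV_le; [exact: ltW|exact: wpos]. Qed.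

Lemma powV_continuous (x : R) : 0 < x -> {for x, continuous (fun t => (t `^ gamma)^-1)}.
Proof.
move=> x0; apply: continuousV; first by rewrite gt_eqF// powR_gt0.
apply: differentiable_continuous; apply/derivable1_diffP.
by apply: derivable_powR; rewrite in_itv/= x0.
Qed.

Lemma regpow_continuous e : 0 < e -> continuous (regpow e).
Proof.
move=> e0 t; apply: (continuous_comp (f := fun t : R => Num.max t 0 + e : R) (g := fun t : R => (t `^ gamma)^-1 : R)).
  apply: (@lipschitz_continuous R R^o R^o _ 1) => x y; rewrite mul1r opprD addrACA subrr addr0.
  by case: (leP x 0) => hx; case: (leP y 0) => hy; rewrite ?subrr ?normr0// ?sub0r ?subr0 ?normrN;
     rewrite ?(gtr0_norm hx) ?(gtr0_norm hy) ler_normr; apply/orP; [right|left]; lra.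
exact: powV_continuous (wpos _ e0).
Qed.

(** Here [gamma <= 1] enters: [t * t ^ - gamma = t ^ (1 - gamma)] is bounded by
    [1 + t], which makes the energies of the approximations bounded. *)
Lemma regpow_mul_le e t : 0 < e -> regpow e t * t <= 1 + `|t|.
Proof.
move=> e0; have /andP[h0 _] := regpow_itv t e0.
have [t0|t0] := leP t 0.
  by apply: (@le_trans _ _ 0); [rewrite mulr_ge0_le0|rewrite addr_ge0].
rewrite gtr0_norm// /regpow max_l ?(ltW t0)//.
have w0 : 0 < t + e by rewrite addr_gt0.
have [w1|w1] := leP 1 (t + e).
  apply: (@le_trans _ _ t); last by rewrite lerDr.
  rewrite ler_piMl ?(ltW t0)// invf_le1 ?powR_gt0//.
  by rewrite -(powRr0 (t + e)); apply: ler_powR => //; exact: ltW.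
apply: (@le_trans _ _ 1); last by rewrite lerDl ltW.
rewrite mulrC ler_pdivrMr ?powR_gt0// mul1r.
apply: (@le_trans _ _ (t + e)); first by rewrite lerDl ltW.
by apply: ger1_powR => //; rewrite w0 ltW.
Qed.

(** Young's inequality, or its logarithmic limit, gives the concavity of the
    primitive of the power without any differentiation. *)
Lemma pow_tangent : exists G : R -> R, forall x y : R, 0 < x -> 0 < y ->
  G y - G x <= (x `^ gamma)^-1 * (y - x).
Proof.
have [e1|ne1] := eqVneq gamma 1.
  exists (@ln R) => x y x0 y0; rewrite e1 powRr1 ?(ltW x0)//.
  rewrite -ln_div ?posrE// mulrBr mulVf ?gt_eqF//.
  have -> : y / x = 1 + (x^-1 * y - 1) by rewrite addrC subrK mulrC.
  apply: le_ln1Dx; rewrite ltrBrDl subrr mulr_gt0// invr_gt0//.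
have p0 : 0 < 1 - gamma by rewrite subr_gt0 lt_neqAle ne1.
exists (fun t : R => t `^ (1 - gamma) / (1 - gamma)) => x y x0 y0.
have Y : y `^ (1 - gamma) * x `^ gamma <= (1 - gamma) * y + gamma * x.
  have := @conjugate_powR R (y `^ (1 - gamma)) (x `^ gamma) (1 - gamma)^-1 gamma^-1.
  rewrite !invrK -!powRrM (mulfV (lt0r_neq0 p0)) (mulfV (lt0r_neq0 g0)).
  rewrite (powRr1 (ltW x0)) (powRr1 (ltW y0)) [y * _]mulrC [x * _]mulrC.
  by apply; rewrite ?powR_ge0 ?invr_gt0// subrK.
have xp : x `^ (1 - gamma) = x * (x `^ gamma)^-1.
  rewrite powRB; last by rewrite (gt_eqF x0) implybT.
  by rewrite powRr1 ?ltW.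
rewrite -mulrBl ler_pdivrMr//.
have w0 : 0 < x `^ gamma by rewrite powR_gt0.
rewrite -(ler_pM2r w0) xp mulrBl divfK ?gt_eqF//.
rewrite [leRHS](_ : _ = (1 - gamma) * (y - x)); last by field; rewrite gt_eqF.
by move: Y; move: (_ * _ `^ gamma) => q; lra.
Qed.

(** A concave primitive, of which only the tangent inequality is recorded. *)
Lemma regpow_primitive e : 0 < e -> exists g : R -> R, g 0 = 0 /\
  forall s t, g t - g s <= regpow e s * (t - s).
Proof.
move=> e0; have [G hG] := pow_tangent.
pose c := (e `^ gamma)^-1.
pose g t := if 0 <= t then G (t + e) - G e else c * t.
have rp t : 0 <= t -> regpow e t = ((t + e) `^ gamma)^-1 by move=> t0; rewrite /regpow max_l.
have rn t : t <= 0 -> regpow e t = c by move=> t0; rewrite /regpow max_r// add0r.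
have pe t : 0 <= t -> 0 < t + e by move=> t0; rewrite ltr_wpDl.
have T0 t : 0 <= t -> G (t + e) - G e <= c * t.
  by move=> t0; have := hG e (t + e) e0 (pe t t0); rewrite addrK.
exists g; split; first by rewrite /g lexx add0r subrr.
move=> s t; rewrite /g; case: (leP 0 s) => s0; case: (leP 0 t) => t0.
- rewrite (rp s s0); have := hG (s + e) (t + e) (pe s s0) (pe t t0).
  have -> : t + e - (s + e) = t - s by ring.
  lra.
- rewrite (rp s s0); have := hG (s + e) e (pe s s0) e0.
  have cs : ((s + e) `^ gamma)^-1 <= c by apply: powRV_le; rewrite ?(ltW g0)// lerDr.
  have -> : e - (s + e) = - s by ring.
  move: cs; set d := _^-1 => cs h; nra.
- by rewrite (rn s (ltW s0)); have := T0 t t0; lra.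
- by rewrite (rn s (ltW s0)); lra.
Qed.

End regularised_power.

(** * Existence for a bounded nonlinearity *)

Section abstract_problem.
Variables (R : realType) (n : nat) (Omega : set 'rV[R]_n).
Local Notation V := 'rV[R]_n.
Local Notation H := (H01 Omega).
Local Notation test := (test_function Omega).
Local Notation nrm := (nrm2 leb Omega).
Implicit Types (u v w phi psi z : V -> R).
Hypothesis oOmega : open Omega.
Hypothesis bOmega : bounded_set Omega.
Variable a : (V -> R) -> (V -> R) -> R.
Hypothesis aform : is_form H a.
Hypothesis acomplete : forall u_ : nat -> V -> R, (forall k, H (u_ k)) ->
  (forall e : R, 0 < e -> exists m0, forall m k, (m0 <= m)%N -> (m0 <= k)%N ->
     dist2 a (u_ m) (u_ k) < e) ->
  exists2 u, H u & dist2 a (u_ k) u @[k --> \oo] --> (0 : R).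
Hypothesis adense : forall u, H u -> exists2 phi : nat -> V -> R, forall k, test (phi k) &
  dist2 a (phi k) u @[k --> \oo] --> (0 : R).
Hypothesis apoincare : exists2 C : R, 0 < C & forall u, H u -> nrm u <= C * a u u.
Hypothesis aramp : forall phi (k : R), 0 < k -> forall c : R, 0 <= c -> test phi ->
  a (sramp k c \o phi) (sramp k c \o phi) <= a phi (sramp k c \o phi).
Variable f : V -> R.
Hypothesis mf : measurable_fun Omega f.
Hypothesis f0 : forall x, Omega x -> 0 <= f x.
Hypothesis fi : leb.-integrable Omega (EFin \o f).
Hypothesis fweight : exists2 K : R, 0 <= K & forall u, H u ->
  leb.-integrable Omega (EFin \o (fun x => f x * `|u x|)) /\
  forall t : R, 0 < t -> \int[leb]_(x in Omega) (f x * `|u x|) <= K * (t + t^-1 * a u u).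

Let mO : measurable Omega. Proof. exact: open_leb. Qed.

Let Hsub u v : H u -> H v -> H (fun x => u x - v x).
Proof. exact: (form_sub aform). Qed.

Let Hlin u v c : H u -> H v -> H (fun x => u x + c * v x).
Proof. by have [h _ _ _] := aform; exact: h. Qed.

Let Htest phi : test phi -> H phi.
Proof. by move=> /(H01_test oOmega bOmega)[]. Qed.

Let Hmeas u : H u -> measurable_fun Omega u.
Proof. by move=> /(H01_sq oOmega bOmega)[]. Qed.

Lemma weight_abs u : H u -> leb.-integrable Omega (EFin \o (fun x => f x * `|u x|)).
Proof. by move=> hu; have [K _ h] := fweight; exact: (h u hu).1. Qed.

Lemma weight_mul (k w : V -> R) (M : R) : measurable_fun Omega k ->
  (forall x, Omega x -> `|k x| <= M * f x) -> measurable_fun Omega w ->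
  leb.-integrable Omega (EFin \o (fun x => f x * `|w x|)) ->
  leb.-integrable Omega (EFin \o (fun x => k x * w x)).
Proof.
move=> mk kM mw iw; apply: (@integrable_dom _ _ _ leb Omega mO _ (fun x => M * (f x * `|w x|))) (integrableZl mO M iw).
  exact: measurable_funM.
by move=> x Ox; rewrite normrM mulrA ler_wpM2r// kM.
Qed.

(** The parameter [t] of the weighted bound is chosen proportional to the
    tolerance, and the squared distance is then brought below [t ^ 2]. *)
Lemma weight_cvg (u_ : nat -> V -> R) u : (forall k, H (u_ k)) -> H u ->
  dist2 a (u_ k) u @[k --> \oo] --> (0 : R) ->
  \int[leb]_(x in Omega) (f x * `|u_ k x - u x|) @[k --> \oo] --> (0 : R).
Proof.
move=> hu_ hu c; have [K K0 hK] := fweight.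
have i0 k : 0 <= \int[leb]_(x in Omega) (f x * `|u_ k x - u x|).
  by apply: Rintegral_ge0 => x Ox; rewrite mulr_ge0 ?f0.
apply/(cvg0_eps i0) => e e0.
pose t := e / (2 * (K + 1)).
have K1 : 0 < K + 1 by rewrite ltr_wpDl.
have t0 : 0 < t by rewrite divr_gt0// mulr_gt0.
have [m hm] := (cvg0_eps (fun k => form_ge0 aform (Hsub (hu_ k) hu))).1 c _ (mulr_gt0 t0 t0).
exists m => k mk; apply: le_lt_trans ((hK _ (Hsub (hu_ k) hu)).2 _ t0) _.
have := hm k mk; set q := a _ _ => qt.
have : t^-1 * q <= t by rewrite ler_pdivrMl// ltW.
have tK : t * (2 * (K + 1)) = e by rewrite /t divfK// gt_eqF// mulr_gt0.
by move: K0 t0; nra.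
Qed.

(** A bounded nonlinearity [h] and a concave primitive [g] of it, given through its
    tangent inequality. *)
Section minimisation.
Variables (h g : R -> R) (M : R).
Hypothesis hM : forall t, 0 <= h t <= M.
Hypothesis hc : continuous h.
Hypothesis gtan : forall s t, g t - g s <= h s * (t - s).
Hypothesis g00 : g 0 = 0.

Let M0 : 0 <= M. Proof. by have /andP[] := hM 0; exact: le_trans. Qed.

Let glip s t : `|g t - g s| <= M * `|t - s|.
Proof.
have := gtan s t; have := gtan t s; have /andP[] := hM s; have /andP[] := hM t.
have := ler_norm (t - s); have := ler_norm (s - t); rewrite distrC.
move: (h s) (h t) => p q; rewrite ler_norml.
case: (ger0P (t - s)) => ts; move=> *; apply/andP; split; nra.
Qed.

Let gc : continuous g.
Proof.
by apply: (@lipschitz_continuous R R^o R^o g M) => x y; exact: glip.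
Qed.

Let mcomp (k : R -> R) u : continuous k -> H u -> measurable_fun Omega (fun x => k (u x)).
Proof.
by move=> ck /Hmeas mu; exact: (measurableT_comp (continuous_measurable_fun ck) mu).
Qed.

Let ifg u : H u -> leb.-integrable Omega (EFin \o (fun x => f x * g (u x))).
Proof.
move=> hu; have := integrableZl mO M (weight_abs hu) => hi.
apply: (@integrable_dom _ _ _ leb Omega mO (fun x => f x * g (u x)) (fun x => M * (f x * `|u x|))) hi.
  by apply: measurable_funM; [exact: mf|exact: mcomp gc hu].
move=> x Ox; rewrite normrM ger0_norm ?f0// mulrCA ler_wpM2l ?f0//.
by have := glip 0 (u x); rewrite g00 !subr0.
Qed.

Let ifh u v : H u -> H v -> leb.-integrable Omega (EFin \o (fun x => f x * h (u x) * v x)).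
Proof.
move=> hu hv; apply: (@weight_mul _ _ M) (Hmeas hv) (weight_abs hv).
  by apply: measurable_funM; [exact: mf|exact: mcomp hc hu].
move=> x Ox; have /andP[h0 h1] := hM (u x).
by rewrite normrM ger0_norm ?f0// ger0_norm// mulrC ler_wpM2r ?f0.
Qed.

Let G u : R := \int[leb]_(x in Omega) (f x * g (u x)).

Let J u : R := a u u / 2 - G u.

Let Glip u v : H u -> H v -> `|G u - G v| <= M * \int[leb]_(x in Omega) (f x * `|u x - v x|).
Proof.
move=> hu hv; have hd := weight_abs (Hsub hu hv).
rewrite /G -(RintegralB mO (ifg hu) (ifg hv)).
have ii := integrableB mO (ifg hu) (ifg hv).
apply: le_trans (le_normr_Rintegral mO ii) _.
rewrite -(RintegralZl M mO hd); apply: le_Rintegral => //.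
- have := integrable_norm ii; by apply: eq_integrable => // x _.
- exact: (integrableZl mO M hd).
move=> x Ox; by rewrite -mulrBr normrM ger0_norm ?f0// mulrCA ler_wpM2l ?f0.
Qed.

(** Strong convexity of [J]: the parallelogram identity for the form and the
    concavity of [g]. *)
Let Jmid u v : H u -> H v ->
  dist2 a u v / 8 <=
  J u / 2 + J v / 2 - J (fun x => 2^-1 * (u x + v x)).
Proof.
move=> hu hv; pose w x := 2^-1 * (u x + v x).
have wE : w = (fun x => u x + (- 2^-1) * (u x - v x)) by apply/funext => x; rewrite /w; field.
have hw : H w by rewrite wE; exact: (Hlin (- 2^-1) hu (Hsub hu hv)).
have aw : a w w = a u u / 4 + a u v / 2 + a v v / 4.
  rewrite wE (form_lin2 aform _ hu (Hsub hu hv)) (form_sub2 aform hu hv).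
  have -> : a u (fun x => u x - v x) = a u u - a u v.
    by rewrite (form_sym aform) (form_subl aform hu hv hu) (form_sym aform v).
  by field.
have Gw : G u / 2 + G v / 2 <= G w.
  rewrite /G !(mulrC _ 2^-1) -(RintegralZl _ mO (ifg hu)) -(RintegralZl _ mO (ifg hv)).
  have iu := integrableZl mO 2^-1 (ifg hu); have iv := integrableZl mO 2^-1 (ifg hv).
  rewrite -(RintegralD mO iu iv); apply: le_Rintegral.
  - exact: mO.
  - exact: (integrableD mO iu iv).
  - exact: ifg.
  move=> x Ox; rewrite mulrCA [X in _ + X]mulrCA -mulrDr ler_wpM2l ?f0//.
  by have := gtan (w x) (u x); have := gtan (w x) (v x); rewrite /w; lra.
rewrite -/w /J aw (form_sub2 aform hu hv); lra.
Qed.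

(** Young's inequality absorbs the weighted term into the quadratic one. *)
Let Jbound : exists L : R, forall u, H u -> L <= J u.
Proof.
have [K K0 hK] := fweight; pose t := 2 * (M * K) + 1.
have MK : 0 <= M * K by rewrite mulr_ge0.
have t0 : 0 < t by rewrite ltr_wpDl// mulr_ge0.
exists (- (M * K * t)) => u hu.
have A0 := form_ge0 aform hu.
have h0 := Glip hu (form_sub aform hu hu).
have G0 : G (fun x => u x - u x) = 0.
  rewrite /G (_ : (fun x => _) = cst 0) ?Rintegral0//.
  by apply/funext => x; rewrite subrr g00 mulr0.
rewrite G0 subr0 in h0.
have E : \int[leb]_(x in Omega) (f x * `|u x - (u x - u x)|) = \int[leb]_(x in Omega) (f x * `|u x|).
  by apply: eq_Rintegral => x _; rewrite subrr subr0.
rewrite E in h0.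
have h1 : G u <= M * (K * (t + t^-1 * a u u)).
  by apply: le_trans (ler_norm _) (le_trans h0 _); rewrite ler_wpM2l//; exact: (hK u hu).2.
have h2 : M * K * (t^-1 * a u u) <= a u u / 2.
  rewrite mulrA [leRHS]mulrC ler_wpM2r// ler_pdivrMr// /t; lra.
rewrite /J; move: h1; rewrite !mulrDr !mulrA => h1; move: h2; rewrite !mulrA => h2; lra.
Qed.

(** A minimising sequence is Cauchy because the functional is uniformly
    convex. *)
Let exists_min : exists2 u, H u & forall v, H v -> J u <= J v.
Proof.
have [L hL] := Jbound.
have H0 : H (fun=> 0) by apply: Htest; exact: test0.
pose S := [set J u | u in H].
have Sinf : has_inf S.
  split; first by exists (J (fun=> 0)); exists (fun=> 0).
  by exists L => _ [u hu <-]; exact: hL.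
pose m := inf S.
have mJ u : H u -> m <= J u by move=> hu; apply: ge_inf; [exact: Sinf.2|exists u].
have /choice[u_ hu_] k : exists u, H u /\ J u < m + k.+1%:R^-1.
  have [|_ [u hu <-] lt] := @inf_adherent R S k.+1%:R^-1 _ Sinf; first by rewrite invr_gt0.
  by exists u.
have Hu k := (hu_ k).1.
have [|u hu c] := acomplete Hu.
  move=> e e0; have [m0 hm0] : exists m0 : nat, m0.+1%:R^-1 < e / 8 :> R.
    by have [m0 h0] := ltr_add_invr (divr_gt0 e0 (ltr0n R 8)); exists m0; rewrite add0r in h0.
  exists m0 => k l mk ml.
  have J1 j : (m0 <= j)%N -> J (u_ j) < m + e / 8.
    move=> mj; apply: lt_trans (hu_ j).2 _; rewrite ltrD2l; apply: le_lt_trans hm0.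
    by rewrite lef_pV2 ?posrE// ler_nat.
  have := Jmid (Hu k) (Hu l); have := J1 k mk; have := J1 l ml.
  have := mJ _ (_ : H (fun x => 2^-1 * (u_ k x + u_ l x))).
  have hw : H (fun x => 2^-1 * (u_ k x + u_ l x)).
    have -> : (fun x => 2^-1 * (u_ k x + u_ l x)) = (fun x => u_ k x + (- 2^-1) * (u_ k x - u_ l x)).
      by apply/funext => x; field.
    exact: (Hlin (- 2^-1) (Hu k) (Hsub (Hu k) (Hu l))).
  move=> /(_ hw); move: (J _) (J (u_ k)) (J (u_ l)) (a _ _) => j1 j2 j3 q; lra.
exists u => // v hv.
have cG : G (u_ k) @[k --> \oo] --> G u.
  apply: (@dist_cvg _ (fun k => M * \int[leb]_(x in Omega) (f x * `|u_ k x - u x|))).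
    by move=> k; exact: (Glip (Hu k) hu).
  by apply: cvgM0; exact: weight_cvg.
have cA := form_cvg2 aform Hu hu c.
have cJ : J (u_ k) @[k --> \oo] --> J u.
  by apply: cvgB => //; apply: cvgM => //; exact: cvg_cst.
have cm : m + k.+1%:R^-1 @[k --> \oo] --> m.
  exact: cvgDl0 (@cvg_harmonic R).
apply: le_trans (mJ v hv); apply: (ler_cvg_to cJ cm).
by apply: nearW => k; apply: ltW; exact: (hu_ k).2.
Qed.

(** The minimiser is compared with [u + t * psi]; as [t] tends to [0] this gives one
    inequality, and the other one follows for [- psi]. *)
Lemma exists_bounded_nonlinearity : exists2 u, H u &
  forall psi, H psi -> a u psi = \int[leb]_(x in Omega) (f x * h (u x) * psi x).
Proof.
have [u hu umin] := exists_min; exists u => // psi0 hpsi0.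
have one psi : H psi -> \int[leb]_(x in Omega) (f x * h (u x) * psi x) <= a u psi.
  move=> hpsi; pose w (k : nat) x := u x + k.+1%:R^-1 * psi x.
  have hw k : H (w k) by exact: Hlin.
  have step k : \int[leb]_(x in Omega) (f x * h (w k x) * psi x) <= a u psi + k.+1%:R^-1 * (a psi psi / 2).
    pose t : R := k.+1%:R^-1; have t0 : 0 < t by rewrite invr_gt0.
    have := umin _ (hw k); rewrite /J (form_lin2 aform _ hu hpsi) -/t.
    have : t * \int[leb]_(x in Omega) (f x * h (w k x) * psi x) <= G (w k) - G u.
      rewrite -(RintegralZl t mO (ifh (hw k) hpsi)) -(RintegralB mO (ifg (hw k)) (ifg hu)).
      apply: le_Rintegral.
      - exact: mO.
      - exact: (integrableZl mO t (ifh (hw k) hpsi)).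
      - exact: (integrableB mO (ifg (hw k)) (ifg hu)).
      move=> x Ox; rewrite -mulrBr !mulrA [t * f x]mulrC -!mulrA ler_wpM2l ?f0//.
      have := gtan (w k x) (u x); rewrite {1 3}/w opprD addrA subrr sub0r -/t; lra.
    set I := \int[leb]_(x in _) _; move=> h1 h2.
    by rewrite -(ler_pM2l t0); lra.
  have cI : \int[leb]_(x in Omega) (f x * h (w k x) * psi x) @[k --> \oo] --> \int[leb]_(x in Omega) (f x * h (u x) * psi x).
    apply: (@dominated_Rintegral _ _ _ leb Omega mO (fun k x => f x * h (w k x) * psi x) (fun x => f x * h (u x) * psi x) (fun x => M * (f x * `|psi x|)) _ _ _ _ _).2.
    - by move=> k; exact: integrable_mfun (ifh (hw k) hpsi).
    - exact: integrable_mfun (ifh hu hpsi).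
    - apply: aeW => x Ox; apply: cvgM; last exact: cvg_cst.
      apply: cvgM; first exact: cvg_cst.
      apply: continuous_cvg; first exact: hc.
      exact: cvgDl0 (@cvg_harmonicMr R _).
    - exact: (integrableZl mO M (weight_abs hpsi)).
    - move=> k x Ox; have /andP[h0 h1] := hM (w k x).
      by rewrite !normrM ger0_norm ?f0// ger0_norm// mulrCA -mulrA ler_wpM2l ?f0// ler_wpM2r.
  have cr : a u psi + k.+1%:R^-1 * (a psi psi / 2) @[k --> \oo] --> a u psi.
    exact: cvgDl0 (@cvg_harmonicMr R _).
  by apply: (ler_cvg_to cI cr); exact: nearW.
apply/le_anti; rewrite (one _ hpsi0) andbT.
have H0 : H (fun=> 0) by apply: Htest; exact: test0.
have hN := Hlin (-1) H0 hpsi0.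
have := one _ hN.
have -> : a u (fun x => 0 + -1 * psi0 x) = - a u psi0.
  rewrite (form_sym aform) (form_linl aform _ H0 hpsi0 hu).
  by rewrite (form_zerol aform hu) add0r mulN1r (form_sym aform).
have -> : \int[leb]_(x in Omega) (f x * h (u x) * (0 + -1 * psi0 x)) =
   - \int[leb]_(x in Omega) (f x * h (u x) * psi0 x).
  rewrite -[RHS]mulN1r -(RintegralZl (-1) mO (ifh hu hpsi0)).
  by apply: eq_Rintegral => x _; ring.
by rewrite lerN2.
Qed.

End minimisation.

(** * Comparison *)

(** Truncated approximations of [z] test the equation; only their limit is
    controlled, since the truncation of [z] itself need not be available. *)
Lemma comparison z (hh : V -> R) (K c : R) : H z -> 0 <= c -> 0 <= K ->
  measurable_fun Omega hh -> (forall x, Omega x -> `|hh x| <= K * f x) ->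
  (forall psi, H psi -> a z psi = \int[leb]_(x in Omega) (hh x * psi x)) ->
  {ae leb, forall x, Omega x -> c < z x -> hh x <= 0} ->
  {ae leb, forall x, Omega x -> z x <= c}.
Proof.
move=> hz c0 K0 mh hK eqz neg; pose P := sramp 1 c.
have n10 : (1 : R) != 0 by rewrite oner_neq0.
have Plip s t : `|P s - P t| <= `|s - t| by exact: sramp_lip.
have P0 : P 0 = 0 by exact: sramp_eq0.
have Ple t : `|P t| <= `|t| by have := Plip t 0; rewrite P0 !subr0.
have cP : continuous P.
  by apply: (@lipschitz_continuous R R^o R^o P 1) => x y; rewrite mul1r; exact: Plip.
have mP u : measurable_fun Omega u -> measurable_fun Omega (fun x => P (u x)).
  by move=> mu; exact: (measurableT_comp (continuous_measurable_fun cP) mu).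
have [phi tphi cphi] := adense hz.
have hphi k := Htest (tphi k).
pose psi k := P \o phi k.
have tpsi k : test (psi k) by exact: test_sramp (tphi k).
have hpsi k := Htest (tpsi k).
have ih w := @weight_mul hh w K mh hK.
have iz : leb.-integrable Omega (EFin \o (fun x => f x * `|P (z x)|)).
  apply: (@integrable_dom _ _ _ leb Omega mO _ (fun x => f x * `|z x|)) (weight_abs hz).
    apply: measurable_funM; first exact: mf.
    by apply: measurableT_comp; [exact: normr_measurable|apply: mP; exact: Hmeas].
  by move=> x Ox; rewrite ger0_norm ?mulr_ge0 ?f0// ler_wpM2l ?f0.
have mPz := mP _ (Hmeas hz).
have ihz := ih _ mPz iz.
have Iz : \int[leb]_(x in Omega) (hh x * P (z x)) <= 0.
  rewrite -(Rintegral0 leb Omega); apply: (le_Rintegral_ae mO ihz (integrable0 _ _)).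
  apply: filterS neg => x h Ox; have [cz|zc] := ltP c (z x).
    by rewrite mulr_le0_ge0 ?h// sramp_ge0.
  by rewrite (_ : P (z x) = 0) ?mulr0//; exact: sramp_eq0.
pose r k := K * \int[leb]_(x in Omega) (f x * `|phi k x - z x|) +
  dist2 a (phi k) z.
have r0 : r k @[k --> \oo] --> (0 : R).
  exact: cvgD0 (cvgM0 K (weight_cvg hphi hz cphi)) cphi.
have est k : a (psi k) (psi k) <= 2 * r k.
  have h1 : a (psi k) (psi k) <= a (phi k) (psi k) by exact: aramp.
  have h2 : a (phi k) (psi k) = a z (psi k) + a (fun x => phi k x - z x) (psi k).
    by rewrite (form_subl aform (hphi k) hz (hpsi k)) addrC subrK.
  have h3 : a z (psi k) <= K * \int[leb]_(x in Omega) (f x * `|phi k x - z x|).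
    have ik := ih _ (Hmeas (hpsi k)) (weight_abs (hpsi k)).
    have id := weight_abs (Hsub (hphi k) hz).
    rewrite (eqz _ (hpsi k)) -(RintegralZl K mO id).
    apply: (@le_trans _ _ (\int[leb]_(x in Omega) (hh x * psi k x) - \int[leb]_(x in Omega) (hh x * P (z x)))).
      by rewrite lerDl oppr_ge0.
    rewrite -(RintegralB mO ik ihz); apply: le_Rintegral.
    - exact: mO.
    - exact: (integrableB mO ik ihz).
    - exact: (integrableZl mO K id).
    move=> x Ox; rewrite -mulrBr; apply: le_trans (ler_norm _) _.
    by rewrite normrM mulrA; apply: ler_pM => //; [exact: hK|exact: Plip].
  have h4 := form_young aform (ltr0n R 2) (Hsub (hphi k) hz) (hpsi k).
  have := form_ge0 aform (hpsi k); have := ler_norm (a (fun x => phi k x - z x) (psi k)).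
  move: h1 h3 h4; rewrite h2 /r; set D := a (psi k) (psi k); set A := a z (psi k).
  set I := K * _; set E := a _ (psi k); set B := a _ _ => *; lra.
have [C C0 hC] := apoincare.
have cz : nrm (fun x => phi k x - z x) @[k --> \oo] --> (0 : R).
  by apply: squeeze0 (cvgM0 C cphi) => k; rewrite nrm2_ge0 (hC _ (Hsub (hphi k) hz)).
have cpsi : nrm (psi k) @[k --> \oo] --> (0 : R).
  apply: squeeze0 (cvgM0 C (cvgM0 2 r0)) => k; rewrite nrm2_ge0 andTb.
  by apply: le_trans (hC _ (hpsi k)) _; rewrite ler_wpM2l ?(ltW C0).
have sz := H01_sq oOmega bOmega hz.
have sPz : sqint leb Omega (fun x => P (z x)).
  by apply: (sqint_bound mO mPz sz) => x _; exact: Ple.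
have sphi k := H01_sq oOmega bOmega (hphi k).
have spsi k := H01_sq oOmega bOmega (hpsi k).
have nP k : nrm (fun x => P (z x)) <= 2 * nrm (psi k) + 2 * nrm (fun x => phi k x - z x).
  have sd := sqintB mO sPz (spsi k).
  have -> : (fun x => P (z x)) = (fun x => psi k x + 1 * (P (z x) - psi k x)).
    by apply/funext => x; rewrite mul1r addrC subrK.
  apply: le_trans (form_lin_le (ip_form leb mO) 1 (spsi k) sd) _.
  rewrite expr1n mul1r lerD2l ler_wpM2l//.
  rewrite -[ip _ _ _ _]/(nrm (fun x => P (z x) - psi k x)) nrm2_sub.
  apply: (nrm2_le mO (sqintB mO (spsi k) sPz) (sqintB mO (sphi k) sz)).
  by move=> x _; exact: Plip.
have nP0 : nrm (fun x => P (z x)) <= 0.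
  by apply: (cvgr_to_ge (cvgD0 (cvgM0 2 cpsi) (cvgM0 2 cz))); exact: nearW.
have := nrm2_le0_ae mO sPz nP0; apply: filterS => x h Ox.
by rewrite leNgt; apply/negP => /(sramp_gt0 ltr01); rewrite -/P h// ltxx.
Qed.

(** * The singular problem *)

Section singular.
Variable gamma : R.
Hypothesis gamma01 : 0 < gamma <= 1.
Hypothesis fpos : forall x, Omega x -> 0 < f x.
Local Notation solves u := (forall psi, H psi ->
  leb.-integrable Omega (fun x => (f x / u x `^ gamma * psi x)%:E) /\
  a u psi = \int[leb]_(x in Omega) (f x / u x `^ gamma * psi x)).

Let g0 : 0 < gamma. Proof. by case/andP: gamma01. Qed.

Let H0 : H (fun=> 0). Proof. by apply: Htest; exact: test0. Qed.

Let e_ (k : nat) : R := k.+1%:R^-1.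

Let e0 k : 0 < e_ k. Proof. by rewrite invr_gt0. Qed.

Let e_le k l : (k <= l)%N -> e_ l <= e_ k.
Proof. by move=> kl; rewrite lef_pV2 ?posrE// ler_nat. Qed.

Let h k := regpow gamma (e_ k).
Let M k : R := (e_ k `^ gamma)^-1.

Let hM k t : 0 <= h k t <= M k. Proof. exact: regpow_itv. Qed.

Let hc k : continuous (h k). Proof. exact: regpow_continuous. Qed.

Section approximations.
Variable u_ : nat -> V -> R.
Hypothesis Hu_ : forall k, H (u_ k).
Hypothesis equ_ : forall k psi, H psi ->
  a (u_ k) psi = \int[leb]_(x in Omega) (f x * h k (u_ k x) * psi x).

Let F k x : R := f x * h k (u_ k x).
Let A k : R := a (u_ k) (u_ k).

Let mF k : measurable_fun Omega (F k).
Proof.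
apply: measurable_funM; first exact: mf.
exact: (measurableT_comp (continuous_measurable_fun (@hc k)) (Hmeas (Hu_ k))).
Qed.

Let F0 k x : Omega x -> 0 <= F k x.
Proof. by move=> Ox; rewrite mulr_ge0 ?f0//; case/andP: (hM k (u_ k x)). Qed.

Let FM k x : Omega x -> F k x <= M k * f x.
Proof. by move=> Ox; rewrite /F mulrC ler_wpM2r ?f0//; case/andP: (hM k (u_ k x)). Qed.

Let iF k w : measurable_fun Omega w -> leb.-integrable Omega (EFin \o (fun x => f x * `|w x|)) ->
  leb.-integrable Omega (EFin \o (fun x => F k x * w x)).
Proof.
apply: (weight_mul (M := M k)); first exact: mF.
by move=> x Ox; rewrite ger0_norm ?F0// FM.
Qed.

Let iFH k w : H w -> leb.-integrable Omega (EFin \o (fun x => F k x * w x)).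
Proof. by move=> hw; apply: iF; [exact: Hmeas|exact: weight_abs]. Qed.

Let iF1 k : leb.-integrable Omega (EFin \o F k).
Proof.
apply: (@integrable_dom _ _ _ leb Omega mO _ (fun x => M k * f x)) (integrableZl mO (M k) fi).
  exact: mF.
by move=> x Ox; rewrite ger0_norm ?F0// FM.
Qed.

Let diff_eq k l psi : H psi -> a (fun x => u_ k x - u_ l x) psi =
  \int[leb]_(x in Omega) ((F k x - F l x) * psi x).
Proof.
move=> hpsi; rewrite (form_subl aform (Hu_ k) (Hu_ l) hpsi) !equ_//.
rewrite -(RintegralB mO (iFH k hpsi) (iFH l hpsi)).
by apply: eq_Rintegral => x _; rewrite mulrBl.
Qed.

Let diff_bound k l x : Omega x -> `|F k x - F l x| <= (M k + M l) * f x.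
Proof.
move=> Ox; apply: le_trans (ler_normB _ _) _; rewrite mulrDl.
by apply: lerD; rewrite ger0_norm ?F0// FM.
Qed.

Let M_ge0 k : 0 <= M k. Proof. by rewrite invr_ge0 powR_ge0. Qed.

Let u_ge0 k : {ae leb, forall x, Omega x -> 0 <= u_ k x}.
Proof.
have Hz := Hsub H0 (Hu_ k).
have := @comparison (fun x => 0 - u_ k x) (fun x => -1 * F k x) (M k) 0 Hz (lexx _) (M_ge0 k).
have mh : measurable_fun Omega (fun x => -1 * F k x).
  by apply: measurable_funM; [exact: measurable_cst|exact: mF].
have hK x : Omega x -> `|-1 * F k x| <= M k * f x.
  by move=> Ox; rewrite mulN1r normrN ger0_norm ?F0// FM.
have eqz psi : H psi -> a (fun x => 0 - u_ k x) psi = \int[leb]_(x in Omega) (-1 * F k x * psi x).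
  move=> hpsi; rewrite (form_subl aform H0 (Hu_ k) hpsi) (form_zerol aform hpsi) sub0r equ_//.
  rewrite -[LHS]mulN1r -(RintegralZl (-1) mO (iFH k hpsi)).
  by apply: eq_Rintegral => x _; rewrite mulrA.
have neg : {ae leb, forall x, Omega x -> 0 < 0 - u_ k x -> -1 * F k x <= 0}.
  by apply: aeW => x Ox _; rewrite mulN1r oppr_le0 F0.
move=> /(_ mh hK eqz neg); apply: filterS => x hx Ox.
by have := hx Ox; rewrite sub0r oppr_le0.
Qed.

(** Where [u_k] exceeds [u_l] by more than [c] the regularised right-hand sides are
    in the opposite order. *)
Let compare_diff k l c : 0 <= c ->
  {ae leb, forall x, Omega x -> c < u_ k x - u_ l x ->
     Num.max (u_ l x) 0 + e_ l <= Num.max (u_ k x) 0 + e_ k} ->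
  {ae leb, forall x, Omega x -> u_ k x - u_ l x <= c}.
Proof.
move=> c0 ae; apply: (comparison (hh := fun x => F k x - F l x) (K := M k + M l) (Hsub (Hu_ k) (Hu_ l)) c0).
- by rewrite addr_ge0.
- by apply: measurable_funB; exact: mF.
- exact: diff_bound.
- exact: diff_eq.
- apply: filterS ae => x hx Ox lt; rewrite subr_le0 ler_wpM2l ?f0//.
  by apply: regpow_anti => //; exact: hx.
Qed.

(** The approximations increase while their shifts by the regularisation
    parameter decrease; the limit is squeezed in between. *)
Let u_mono : {ae leb, forall x, Omega x -> forall k, 0 <= u_ k x /\
  forall l, (k <= l)%N -> u_ k x <= u_ l x <= u_ k x + e_ k - e_ l}.
Proof.
have aek k : {ae leb, forall x, Omega x -> 0 <= u_ k x /\
    forall l, (k <= l)%N -> u_ k x <= u_ l x <= u_ k x + e_ k - e_ l}.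
  have ael l : {ae leb, forall x, Omega x -> (k <= l)%N -> u_ k x <= u_ l x <= u_ k x + e_ k - e_ l}.
    have [kl|nkl] := boolP (k <= l)%N; last exact: aeW.
    have up := @compare_diff k l 0 (lexx _).
    have dn := @compare_diff l k (e_ k - e_ l) _.
    have h1 : {ae leb, forall x, Omega x -> u_ k x - u_ l x <= 0}.
      apply: up; apply: aeW => x Ox; rewrite subr_gt0 => lt.
      apply: lerD; last exact: e_le.
      by rewrite ge_max !le_max (ltW lt) lexx orbT.
    have h2 : {ae leb, forall x, Omega x -> u_ l x - u_ k x <= e_ k - e_ l}.
      apply: dn; first by rewrite subr_ge0 e_le.
      apply: filterS (u_ge0 k) => x uk Ox lt; rewrite max_l ?uk//.
      have : u_ l x <= Num.max (u_ l x) 0 by rewrite le_max lexx.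
      by move: lt; lra.
    apply: filterS2 h1 h2 => x x1 x2 Ox _; have := x1 Ox; have := x2 Ox.
    by move=> *; apply/andP; split; lra.
  have := ae_foralln ael; apply: filterS2 (u_ge0 k) => x ux hx Ox; split; first exact: ux.
  by move=> l; exact: hx.
by have := ae_foralln aek; apply: filterS => x hx Ox k; exact: hx.
Qed.

(** The increments are nonnegative and so is the right-hand side of the equation
    of [u_k], which the increment tests; hence [a (u_k, u_l - u_k) >= 0]. *)
Let A_mono k l : (k <= l)%N ->
  dist2 a (u_ l) (u_ k) <= A l - A k.
Proof.
move=> kl; rewrite (form_sub2 aform (Hu_ l) (Hu_ k)).
suff : 0 <= a (u_ k) (u_ l) - a (u_ k) (u_ k).
  by rewrite (form_sym aform (u_ l)) /A; lra.
rewrite (form_sym aform (u_ k) (u_ l)) -(form_subl aform (Hu_ l) (Hu_ k) (Hu_ k)).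
have Hd := Hsub (Hu_ l) (Hu_ k).
rewrite (form_sym aform) equ_// -(Rintegral0 leb Omega).
apply: (le_Rintegral_ae mO (integrable0 _ _) (iFH k Hd)).
apply: filterS u_mono => x hx Ox; have [_ /(_ l kl) /andP[h1 _]] := hx Ox k.
by rewrite mulr_ge0 ?F0// subr_ge0.
Qed.

(** Each equation is tested with its own solution. *)
Let A_bounded : exists2 B : R, 0 <= B & forall k, A k <= B.
Proof.
have [K K0 hK] := fweight; pose t := 2 * K + 1.
have t0 : 0 < t by rewrite ltr_wpDl// mulr_ge0.
pose If := \int[leb]_(x in Omega) f x.
have If0 : 0 <= If by exact: Rintegral_ge0.
exists (2 * (If + K * t)) => [|k].
  by rewrite mulr_ge0// addr_ge0// mulr_ge0// ltW.
have [iu hu] := hK _ (Hu_ k); have A0 := form_ge0 aform (Hu_ k).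
have h1 : A k <= If + \int[leb]_(x in Omega) (f x * `|u_ k x|).
  rewrite /A /If (equ_ k (Hu_ k)) -(RintegralD mO fi iu); apply: le_Rintegral.
  - exact: mO.
  - exact: (iFH k (Hu_ k)).
  - exact: (integrableD mO fi iu).
  move=> x Ox; rewrite -[X in X + _]mulr1 -mulrDr -mulrA ler_wpM2l ?f0//.
  exact: regpow_mul_le.
have h2 := hu t t0.
have h3 : K * (t^-1 * A k) <= A k / 2.
  rewrite mulrA [leRHS]mulrC ler_wpM2r// ler_pdivrMr//.
  by rewrite /t mulrDr mulrA mulVf// mul1r lerDl.
move: h2; rewrite mulrDr -/(A k) => h2.
have h4 := le_trans h1 (lerD (lexx _) h2); move: h3 h4.
by move: (K * t) (K * _) => p q; lra.
Qed.

(** The energies increase and are bounded, and their increments dominate the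
    squared distances. *)
Let A_cauchy (e : R) : 0 < e -> exists m0, forall m k, (m0 <= m)%N -> (m0 <= k)%N ->
  dist2 a (u_ m) (u_ k) < e.
Proof.
move=> ep; have [B B0 hB] := A_bounded.
have Sup : has_sup (range A).
  by split; [exists (A 0%N); exists 0%N|exists B => _ [k _ <-]; exact: hB].
have [_ [m0 _ <-] lt] := sup_adherent ep Sup.
have key m k : (m0 <= m)%N -> (m <= k)%N ->
    dist2 a (u_ k) (u_ m) < e.
  move=> h1 h2; apply: le_lt_trans (A_mono h2) _.
  have Ak : A k <= sup (range A) by apply: ub_le_sup; [exact: Sup.2|exists k].
  have Am : A m0 <= A m.
    have := A_mono h1; have := form_ge0 aform (Hsub (Hu_ m) (Hu_ m0)).
    by move=> h3 h4; rewrite -subr_ge0; exact: le_trans h3 h4.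
  by move: lt Ak Am; set S := sup _; lra.
exists m0 => m k h1 h2; case: (leqP m k) => mk; last exact: key (ltnW mk).
by rewrite (form_sub_swap aform (Hu_ m) (Hu_ k)); exact: key mk.
Qed.

(** The truncations of the positive parts of smooth approximations of [psi]
    test the equation; both signs of [psi] are needed. *)
Let abs_bound B k psi : A k <= B -> H psi ->
  \int[leb]_(x in Omega) (F k x * `|psi x|) <= B + a psi psi.
Proof.
move=> AB; pose pp (psi : V -> R) x := Num.max (psi x) 0.
have ipp w : H w -> leb.-integrable Omega (EFin \o (fun x => F k x * pp w x)).
  move=> hw; have mw : measurable_fun Omega (pp w).
    by apply: measurable_maxr; [exact: Hmeas|exact: measurable_cst].
  apply: iF; first exact: mw.
  apply: (@integrable_dom _ _ _ leb Omega mO _ (fun x => f x * `|w x|)) (weight_abs hw).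
    apply: measurable_funM; first exact: mf.
    by apply: measurableT_comp; [exact: normr_measurable|exact: mw].
  move=> x Ox; rewrite ger0_norm ?mulr_ge0 ?f0// ler_wpM2l ?f0// /pp.
  by case: (leP (w x) 0) => ?; rewrite ?normr0.
pose I := \int[leb]_(x in Omega) F k x.
have half w : H w -> \int[leb]_(x in Omega) (F k x * pp w x) <= (B + a w w) / 2.
  move=> hw; have [phi tphi cphi] := adense hw; have hphi j := Htest (tphi j).
  pose r j := \int[leb]_(x in Omega) (f x * `|phi j x - w x|).
  have step j : \int[leb]_(x in Omega) (F k x * pp w x) <=
      (B + a (phi j) (phi j)) / 2 + (j.+1%:R^-1 * I + M k * r j).
    have j0 : 0 < j.+1%:R :> R by [].
    pose p := sramp j.+1%:R 0 \o phi j.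
    have hp : H p by apply: Htest; exact: test_sramp.
    have ap : a p p <= a (phi j) (phi j).
      have h1 : a p p <= a (phi j) p by exact: aramp.
      have := form_young aform ltr01 (hphi j) hp; rewrite invr1 !mul1r => h2.
      by have := ler_norm (a (phi j) p); lra.
    have id := weight_abs (Hsub (hphi j) hw).
    have iI := integrableZl mO j.+1%:R^-1 (iF1 k); have iM := integrableZl mO (M k) id.
    have iIM := integrableD mO iI iM.
    have h1 : \int[leb]_(x in Omega) (F k x * pp w x) <= a (u_ k) p + (j.+1%:R^-1 * I + M k * r j).
      rewrite (equ_ _ hp) -(RintegralZl _ mO (iF1 k)) -(RintegralZl _ mO id).
      rewrite -(RintegralD mO iI iM) -(RintegralD mO (iFH k hp) iIM).
      apply: le_Rintegral; [exact: mO|exact: ipp|exact: (integrableD mO (iFH k hp) iIM)|].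
      move=> x Ox; apply: (@le_trans _ _ (F k x * (p x + j.+1%:R^-1 + `|phi j x - w x|))).
        rewrite ler_wpM2l ?F0// /pp /p /=.
        have := sramp_ge 0 (phi j x) j0; have := sramp_ge0 0 (phi j x) j0.
        have : 0 <= j.+1%:R^-1 :> R by [].
        have := ler_norm (w x - phi j x); rewrite distrC ge_max; have := normr_ge0 (phi j x - w x).
        move: (phi j x) (w x) (j.+1%:R^-1) (sramp _ _ _) `|_| => z y i t d *.
        by apply/andP; split; lra.
      rewrite !mulrDr -addrA lerD2l [_^-1 * _]mulrC lerD2l [leRHS]mulrA.
      by rewrite ler_wpM2r// FM.
    have := form_young aform ltr01 (Hu_ k) hp; rewrite invr1 !mul1r -/(A k) => h2.
    have h3 := ler_norm (a (u_ k) p); apply: le_trans h1 _.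
    by rewrite lerD2r; lra.
  have cr := cvgD0 (@cvg_harmonicMr R I) (cvgM0 (M k) (weight_cvg hphi hw cphi)).
  have c : (B + a (phi j) (phi j)) / 2 + (j.+1%:R^-1 * I + M k * r j) @[j --> \oo] --> (B + a w w) / 2.
    rewrite -[X in _ --> X]addr0; apply: cvgD cr; apply: cvgM; last exact: cvg_cst.
    by apply: cvgD; [exact: cvg_cst|exact: (form_cvg2 aform hphi hw cphi)].
  by apply: (cvgr_to_ge c); exact: nearW.
move=> hpsi; have hN := Hlin (-1) H0 hpsi.
have h1 := half _ hpsi; have := half _ hN.
rewrite (form_lin2 aform _ H0 hpsi) (form_zerol aform H0) (form_zerol aform hpsi) => h2.
have -> : \int[leb]_(x in Omega) (F k x * `|psi x|) =
    \int[leb]_(x in Omega) (F k x * pp psi x) + \int[leb]_(x in Omega) (F k x * pp (fun x => 0 + -1 * psi x) x).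
  rewrite -(RintegralD mO (ipp _ hpsi) (ipp _ hN)).
  apply: eq_Rintegral => x _; rewrite -mulrDr /pp add0r mulN1r; congr (_ * _).
  by case: (leP (psi x) 0) => p; case: (leP (- psi x) 0) => q; rewrite ?(ler0_norm p) ?(gtr0_norm p); lra.
lra.
Qed.

(** Where the limit is not positive the approximations vanish, so that the right-hand
    sides are of order [e_k ^ - gamma] there, whereas their integrals against a bump
    stay bounded; this forces positivity. The limit nonlinearity is integrable
    against every [psi] by Fatou's lemma, and it dominates the approximate ones. *)
Lemma singular_limit : exists2 u, H u &
  {ae leb, forall x, Omega x -> 0 < u x} /\
  solves u.
Proof.
have [u hu cu] := acomplete Hu_ A_cauchy.
have [B B0 hB] := A_bounded; have [C C0 hC] := apoincare.
have su := H01_sq oOmega bOmega hu; have su_ k := H01_sq oOmega bOmega (Hu_ k).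
have cn : nrm (fun x => u_ k x - u x) @[k --> \oo] --> (0 : R).
  by apply: squeeze0 (cvgM0 C cu) => k; rewrite nrm2_ge0 (hC _ (Hsub (Hu_ k) hu)).
have [th hth ae] := nrm2_cvg_ae mO su_ su cn.
have good : {ae leb, forall x, Omega x -> forall k, 0 <= u_ k x /\ u_ k x <= u x <= u_ k x + e_ k}.
  apply: filterS2 ae u_mono => x cx mx Ox k; have [u0 hk] := mx Ox k; split => //.
  have c := cx Ox; apply/andP; split.
    apply: (cvgr_to_ge c); exists k => // j /= kj.
    by have /andP[] := hk _ (leq_trans kj (hth j)).
  apply: (cvgr_to_le c); exists k => // j /= kj.
  have /andP[_ h1] := hk _ (leq_trans kj (hth j)).
  by apply: le_trans h1 _; rewrite lerBlDr lerDl ltW.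
have mu := Hmeas hu.
have upos : {ae leb, forall x, Omega x -> 0 < u x}.
  have [p [q [D [pqO OE]]]] := box_cover oOmega.
  have aej j : {ae leb, forall x, D j -> obox (p j) (q j) x -> 0 < u x}.
    have [Dj|nDj] := pselect (D j); last by apply: aeW => x /nDj.
    have tb := @test_function_boxbump R n Omega 1 (p j) (q j) ltr01 (pqO j Dj).
    set phi := boxbump 1 (p j) (q j) in tb.
    have hphi := Htest tb.
    have phi0 x : 0 <= phi x by exact: boxbump_ge0.
    pose Z : set V := Omega `&` u @^-1` `]-oo, 0].
    have mZ : measurable Z by apply: mu => //; exact: measurable_itv.
    pose g x := f x * phi x * \1_Z x.
    have g0' x : Omega x -> 0 <= g x by move=> Ox; rewrite !mulr_ge0 ?f0.
    have mg : measurable_fun Omega g.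
      apply: measurable_funM; last exact: measurable_indic.
      by apply: measurable_funM; [exact: mf|exact: Hmeas].
    have ig : leb.-integrable Omega (EFin \o g).
      apply: (@integrable_dom _ _ _ leb Omega mO _ (fun x => f x * `|phi x|)) (weight_abs hphi) => //.
      move=> x Ox; have i1 : \1_Z x <= 1 :> R by rewrite indicE; case: (_ \in _).
      by rewrite (ger0_norm (g0' x Ox)) /g (ger0_norm (phi0 x)) ler_piMr// mulr_ge0 ?f0.
    have I0 : \int[leb]_(x in Omega) g x <= 0.
      have step k : \int[leb]_(x in Omega) g x <= e_ k `^ gamma * (B + a phi phi).
        have iabs : leb.-integrable Omega (EFin \o (fun x => F k x * `|phi x|)).
          have := iFH k hphi; apply: eq_integrable => // x _.
          by rewrite /= ger0_norm.
        have ek : 0 <= e_ k `^ gamma by exact: powR_ge0.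
        apply: (@le_trans _ _ (e_ k `^ gamma * \int[leb]_(x in Omega) (F k x * `|phi x|))); last first.
          by rewrite ler_wpM2l// (abs_bound (hB k) hphi).
        rewrite -(RintegralZl _ mO iabs).
        apply: (le_Rintegral_ae mO ig (integrableZl mO (e_ k `^ gamma) iabs)).
        apply: filterS good => x gx Ox; have [uk0 /andP[ukx _]] := gx Ox k.
        rewrite /g indicE; have [xZ|_] := boolP (x \in Z); last first.
          by rewrite mulr0 mulr_ge0// mulr_ge0 ?F0.
        have ux : u x <= 0 by move: xZ; rewrite inE => -[_]; rewrite /= in_itv.
        have uk : u_ k x = 0 by apply/le_anti; rewrite uk0 (le_trans ukx ux).
        have w0 : e_ k `^ gamma != 0 by rewrite gt_eqF// powR_gt0.
        rewrite mulr1 /F /h uk /regpow maxxx add0r (ger0_norm (phi0 x)).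
        by rewrite mulrA [X in _ <= X * _]mulrC divfK.
      have c : e_ k `^ gamma * (B + a phi phi) @[k --> \oo] --> (0 : R).
        rewrite -(mul0r (B + a phi phi)); apply: cvgM; last exact: cvg_cst.
        have := powR_cvg0 g0 => /cvg_at_rightP/(_ (fun k => e_ k)); apply.
        by split; [move=> k; exact: e0|exact: cvg_harmonic].
      by apply: (cvgr_to_ge c); exact: nearW.
    have := Rintegral_le0_ae mO ig g0' I0; apply: filterS => x gx _ xb.
    have Ox : Omega x by rewrite OE; exists j.
    rewrite ltNge; apply/negP => ux; have := gx Ox.
    have xZ : Z x by split => //=; rewrite in_itv.
    rewrite /g indicE mem_set// mulr1 => /eqP; rewrite mulf_eq0 !gt_eqF ?fpos//.
    exact: boxbump_gt0.
  have := ae_foralln aej; apply: filterS => x hx.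
  by rewrite OE => -[j Dj xj]; exact: (hx j).
exists u => //; split => // psi hpsi.
have mpsi := Hmeas hpsi.
have mw : measurable_fun Omega (fun x => f x / u x `^ gamma).
  apply: measurable_funM; first exact: mf.
  under eq_fun do rewrite -powRN.
  exact: (measurableT_comp (measurable_powR _) mu).
have cF : {ae leb, forall x, Omega x -> F k x @[k --> \oo] --> f x / u x `^ gamma}.
  apply: filterS2 good upos => x gx ux Ox; apply: cvgM; first exact: cvg_cst.
  have E k : h k (u_ k x) = ((u_ k x + e_ k) `^ gamma)^-1.
    by rewrite /h /regpow max_l//; have [] := gx Ox k.
  have cw : u_ k x + e_ k @[k --> \oo] --> u x.
    apply: (@dist_cvg _ (fun k => e_ k)); last exact: cvg_harmonic.
    move=> k; have [_ /andP[h1 h2]] := gx Ox k; rewrite ger0_norm ?subr_ge0//.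
    by rewrite lerBlDr addrC lerD2l.
  pose pw (t : R) : R := (t `^ gamma)^-1.
  have cp : {for u x, continuous pw} := powV_continuous (ux Ox).
  have cE : pw (u_ k x + e_ k) @[k --> \oo] --> pw (u x).
    by apply: continuous_cvg; [exact: cp|exact: cw].
  have -> : (fun k => h k (u_ k x)) = (fun k => pw (u_ k x + e_ k)) by exact/funext.
  exact: cE.
have mabs : measurable_fun Omega (fun x => `|psi x|).
  by apply: measurableT_comp; [exact: normr_measurable|exact: mpsi].
have iabs : leb.-integrable Omega (EFin \o (fun x => f x / u x `^ gamma * `|psi x|)).
  have w0 x : Omega x -> 0 <= f x / u x `^ gamma * `|psi x|.
    by move=> Ox; rewrite !mulr_ge0 ?f0// invr_ge0 powR_ge0.
  have iFa k : leb.-integrable Omega (EFin \o (fun x => F k x * `|psi x|)).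
    apply: iF => //; have := weight_abs hpsi.
    by apply: eq_integrable => // x _; rewrite /= normr_id.
  apply: (bounded_integrable mO _ w0 (C := B + a psi psi) _).1; first exact: measurable_funM.
  apply: (@fatou_le _ _ _ leb Omega mO (fun k x => F k x * `|psi x|) _ (fun=> B + a psi psi)); last exact: cvg_cst.
  - by move=> k; apply: measurable_funM; [exact: mF|exact: mabs].
  - exact: measurable_funM.
  - by move=> k x Ox; rewrite mulr_ge0 ?F0.
  - exact: w0.
  - by apply: filterS cF => x hx Ox; apply: cvgM; [exact: hx|exact: cvg_cst].
  - by move=> k; rewrite (integral_Rintegral mO (iFa k)) lee_fin; exact: (abs_bound (hB k) hpsi).
have dom : {ae leb, forall x, Omega x -> forall k, `|F k x * psi x| <= f x / u x `^ gamma * `|psi x|}.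
  apply: filterS2 good upos => x gx ux Ox k; have [uk0 /andP[h1 h2]] := gx Ox k.
  rewrite normrM ger0_norm ?F0// ler_wpM2r// ler_wpM2l ?f0// /h /regpow max_l//.
  by apply: powRV_le; rewrite ?(ltW g0) ?ux.
have [i1 c1] := @dominated_Rintegral_ae _ _ _ leb Omega mO (fun k x => F k x * psi x)
  (fun x => f x / u x `^ gamma * psi x) (fun x => f x / u x `^ gamma * `|psi x|)
  (fun k => measurable_funM (mF k) mpsi) (measurable_funM mw mpsi)
  (filterS (fun x hx Ox => cvgM (hx Ox) (cvg_cst (psi x))) cF) iabs dom.
split => //; have c2 := form_cvg aform Hu_ hu hpsi cu.
rewrite (funext (fun k => equ_ k hpsi)) in c2.
exact: (cvg_unique (@Rhausdorff R) c2 c1).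
Qed.

End approximations.

Lemma singular_solution : exists2 u, H u &
  {ae leb, forall x, Omega x -> 0 < u x} /\
  solves u.
Proof.
have ex k : exists u, H u /\ forall psi, H psi ->
    a u psi = \int[leb]_(x in Omega) (f x * h k (u x) * psi x).
  have [g [g00 gt]] := regpow_primitive gamma01 (e0 k).
  have [u hu eu] := exists_bounded_nonlinearity (hM k) (@hc k) gt g00.
  by exists u.
have [u_ hu_] := choice ex.
exact: (singular_limit (fun k => (hu_ k).1) (fun k psi => (hu_ k).2 psi)).
Qed.

(** The right-hand side decreases with the solution while the form is
    positive, so the difference of two solutions has no energy. *)
Lemma singular_unique u v : H u -> H v ->
  {ae leb, forall x, Omega x -> 0 < u x} -> {ae leb, forall x, Omega x -> 0 < v x} ->
  solves u ->   solves v ->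
  {ae leb, forall x, Omega x -> u x = v x}.
Proof.
move=> hu hv u0 v0 eu ev; have hd := Hsub hu hv.
have [iu e1] := eu _ hd; have [iv e2] := ev _ hd.
have le0 : dist2 a u v <= 0.
  rewrite (form_subl aform hu hv hd) e1 e2 -(RintegralB mO iu iv) -(Rintegral0 leb Omega).
  apply: (le_Rintegral_ae mO (integrableB mO iu iv) (integrable0 _ _)).
  apply: filterS2 u0 v0 => x ux vx Ox; have {}ux := ux Ox; have {}vx := vx Ox.
  rewrite -mulrBl -mulrBr -mulrA mulr_ge0_le0 ?f0//.
  have mono := powRV_le (ltW g0).
  have [uv|vu] := leP (u x) (v x).
    by rewrite mulr_ge0_le0 ?subr_le0// subr_ge0 mono.
  by rewrite mulr_le0_ge0 ?subr_le0 ?subr_ge0 ?mono ?ltW.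
have [C C0 hC] := apoincare.
have n0 : nrm (fun x => u x - v x) <= 0.
  apply: le_trans (hC _ hd) _.
  by rewrite pmulr_rle0.
have := nrm2_le0_ae mO (H01_sq oOmega bOmega hd) n0; apply: filterS => x hx Ox.
by apply/eqP; rewrite -subr_eq0 hx.
Qed.

End singular.

End abstract_problem.

(** * Minimal solutions *)

Section solution.
Variables (R : realType) (n : nat) (Omega : set 'rV[R]_n) (s gamma zeta : R) (f : 'rV[R]_n -> R).
Local Notation V := 'rV[R]_n.
Hypothesis n0 : (0 < n)%N.
Hypothesis dOmega : domain Omega.
Hypothesis bOmega : bounded_set Omega.
Hypothesis cOmega : C11_boundary Omega.
Hypothesis s01 : 0 < s < 1.
Hypothesis gamma0 : 0 < gamma.
Hypothesis zeta02 : 0 <= zeta < 2.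
Hypothesis gz1 : gamma + zeta <= 1.
Hypothesis fA : Aclass Omega zeta f.
Local Notation H := (H01 Omega).
Local Notation a := (mixed Omega s).

Let oOmega : open Omega. Proof. by case: dOmega. Qed.

(** A bounded open set is not closed, since a coordinate would attain its
    maximum on it. *)
Lemma bdry_nonempty : bdry Omega !=set0.
Proof.
have [ne _ _] := dOmega; apply: contrapT => nb.
have cl : closed Omega.
  move=> x cx; apply: contrapT => nx; apply: nb; exists x; split => //.
  by rewrite (interior_id _).1.
have cpt : compact Omega by exact: bounded_closed_compact.
pose i := Ordinal n0; pose p (x : V) : R := x 0 i.
have cp : continuous p.
  by apply: (@lipschitz_continuous R V R^o p 1) => x y; rewrite mul1r /p; have := ler_coord (x - y) i; rewrite !mxE.
have [x Ox xmax] : exists2 x, Omega x & forall y, Omega y -> p y <= p x.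
  have [x] := compact_EVT_max ne cpt (continuous_subspaceT cp).
  by rewrite inE => Ox hx; exists x => // y Oy; apply: hx; rewrite inE.
have /nbhs_ballP[r /= r0 hr] := open_nbhs_nbhs (conj oOmega Ox).
have Oy : Omega (x + (r / 2) *: delta_mx 0 i).
  apply: hr; rewrite -ball_normE /= opprD addrA subrr sub0r normrN normrZ gtr0_norm ?divr_gt0//.
  apply: (@le_lt_trans _ _ (r / 2 * 1)); last by rewrite mulr1 ltr_pdivrMr// ltr_pMr// ltr1n.
  by rewrite ler_wpM2l ?divr_ge0 ?(ltW r0)// norm_delta_le1.
have := xmax _ Oy; rewrite /p !mxE !eqxx mulr1 gerDl leNgt divr_gt0//.
Qed.

Lemma bdist_gt0 x : Omega x -> 0 < bdist Omega x.
Proof.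
move=> Ox; have /nbhs_ballP[r /= r0 hr] := open_nbhs_nbhs (conj oOmega Ox).
have [y0 by0] := bdry_nonempty.
apply: lt_le_trans r0 _; apply: lb_le_inf; first by exists (enorm (x - y0)); exists y0.
move=> _ [y [_ ny] <-]; apply: le_trans (norm_le_enorm _).
rewrite leNgt; apply/negP => xy; apply: ny; rewrite (interior_id _).1//.
by apply: hr; rewrite -ball_normE.
Qed.

Lemma Aclass_gt0 x : Omega x -> 0 < f x.
Proof.
have [_ _ [c1 [c2 [c10 _ h]]]] := fA => Ox; have /andP[h1 _] := h x Ox.
by apply: lt_le_trans h1; rewrite mulr_gt0// powR_gt0// bdist_gt0.
Qed.

Let zeta01 : 0 <= zeta < 1.
Proof. by have /andP[-> _] := zeta02; move: gz1 gamma0; lra. Qed.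

Let gamma01 : 0 < gamma <= 1.
Proof. by have /andP[z0 _] := zeta01; rewrite gamma0/=; move: gz1 z0; lra. Qed.

Let aform : is_form H a. Proof. exact: mixed_form. Qed.

Lemma mixed_complete (u_ : nat -> V -> R) : (forall k, H (u_ k)) ->
  (forall e : R, 0 < e -> exists m0, forall m k, (m0 <= m)%N -> (m0 <= k)%N ->
     dist2 a (u_ m) (u_ k) < e) ->
  exists2 u, H u & dist2 a (u_ k) u @[k --> \oo] --> (0 : R).
Proof.
move=> hu cau; have [|u hu0 c] := H01_complete n0 oOmega bOmega hu.
  move=> e e0; have [m0 h] := cau e e0; exists m0 => m k h1 h2.
  by apply: le_lt_trans (h m k h1 h2); exact: mixed_lower.
exists u; first exact: hu0.
have [K K0 hK] := mixed_upper n0 oOmega bOmega s01.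
apply: squeeze0 (cvgM0 K c) => k; have hd := form_sub aform (hu k) hu0.
by rewrite (form_ge0 aform hd) (hK _ hd).
Qed.

Lemma mixed_dense u : H u -> exists2 phi : nat -> V -> R, forall k, test_function Omega (phi k) &
  dist2 a (phi k) u @[k --> \oo] --> (0 : R).
Proof.
move=> hu; have [phi [tphi _ c _ _]] := H01_seq oOmega bOmega hu; exists phi; first exact: tphi.
have [K K0 hK] := mixed_upper n0 oOmega bOmega s01.
apply: squeeze0 (cvgM0 K c) => k.
have hd := form_sub aform (H01_test oOmega bOmega (tphi k)).1 hu.
by rewrite (form_ge0 aform hd) (hK _ hd).
Qed.

Lemma mixed_poincare : exists2 C : R, 0 < C & forall u, H u -> nrm2 leb Omega u <= C * a u u.
Proof.
have [C C0 h] := H01_poincare n0 oOmega bOmega; exists C => // u hu.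
by apply: le_trans (h u hu) _; rewrite ler_wpM2l ?(ltW C0)// mixed_lower.
Qed.

Lemma mixed_weight : leb.-integrable Omega (EFin \o f) /\
  exists2 K : R, 0 <= K & forall u, H u ->
  leb.-integrable Omega (EFin \o (fun x => f x * `|u x|)) /\
  forall t : R, 0 < t -> \int[leb]_(x in Omega) (f x * `|u x|) <= K * (t + t^-1 * a u u).
Proof.
have [mf f0 [c1 [c2 [_ c20 h]]]] := fA.
have fle x : Omega x -> f x <= c2 * bdist Omega x `^ (- zeta) by move=> /h /andP[].
split; first exact: (weight_integrable n0 oOmega bOmega cOmega zeta01 mf f0 c20 fle).
have [K K0 hK] := weight_H01 n0 oOmega bOmega cOmega zeta01 mf f0 c20 fle.
exists K => // u hu; have [iu hu2] := hK u hu; split => // t t0.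
apply: le_trans (hu2 t t0) _; rewrite ler_wpM2l// lerD2l ler_wpM2l ?invr_ge0 ?(ltW t0)//.
exact: mixed_lower.
Qed.

(** Solutions are unique almost everywhere, so the one constructed is minimal. *)
Lemma exists_minimal_solution : exists u, minimal_weak_solution Omega s gamma f u.
Proof.
have [mf f0 _] := fA; have [fi fw] := mixed_weight.
have ramp phi (k : R) : 0 < k -> forall c : R, 0 <= c -> test_function Omega phi ->
    a (sramp k c \o phi) (sramp k c \o phi) <= a phi (sramp k c \o phi).
  by move=> k0 c c0; exact: mixed_sramp.
have [u hu [u0 eu]] := singular_solution oOmega bOmega aform mixed_complete mixed_dense
  mixed_poincare ramp mf f0 fi fw gamma01 Aclass_gt0.
exists u; split.
  split => // psi hpsi; have [i1 e1] := mixedE n0 oOmega bOmega s01 hu hpsi.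
  by have [i2 e2] := eu psi hpsi; split; [exact: i1|exact: i2|rewrite e1].
move=> v [hv v0 ev].
have ev' psi : H psi -> leb.-integrable Omega (fun x => (f x / v x `^ gamma * psi x)%:E) /\
    a v psi = \int[leb]_(x in Omega) (f x / v x `^ gamma * psi x).
  move=> hpsi; have [_ i2 e2] := ev psi hpsi; split => //.
  by rewrite -e2 (mixedE n0 oOmega bOmega s01 hv hpsi).2.
have := singular_unique oOmega bOmega aform mixed_poincare f0 gamma01 hu hv u0 v0 eu ev'.
by apply: filterS => x h Ox; rewrite h.
Qed.

End solution.

Theorem theorem2p6 (R : realType) (N : nat) (Omega : set 'rV[R]_N)
    (s gamma zeta : R) (f : 'rV[R]_N -> R) :
  (3 <= N)%N ->
  domain Omega -> bounded_set Omega -> C11_boundary Omega ->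
  0 < s < 1 ->
  0 < gamma -> 0 <= zeta < 2 -> gamma + zeta <= 1 ->
  Aclass Omega zeta f ->
  exists u : 'rV[R]_N -> R, minimal_weak_solution Omega s gamma f u.
Proof.
move=> N3 dO bO cO s01 g0 z2 gz fA.
exact: (exists_minimal_solution (leq_trans _ N3) dO bO cO s01 g0 z2 gz fA).
Qed.
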